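(* For any Turing degree $\mathbf d$ with $\mathbf 0<\mathbf d<\mathbf 0'$, there is a theory $U$ such that $\mathsf{G1}$ holds for $U$, $U$ is interpretable in $\mathbf R$, and $U$ has Turing degree $\mathbf d$.
   Context: Theories are identified with the sets of Gödel numbers of their sentences, so they have Turing degrees. $\mathbf R$ is Robinson's theory in language $\{\mathbf 0,\mathbf S,+,\cdot,\le\}$ ($\le$ primitive, $\overline n=\mathbf S^n\mathbf 0$) with schemes $\overline m+\overline n=\overline{m+n}$; $\overline m\cdot\overline n=\overline{m\cdot n}$; $\overline m\neq\overline n$ for $m\neq n$; $\forall x(x\le\overline n\to x=\overline 0\vee\dots\vee x=\overline n)$; $\forall x(x\le\overline n\vee\overline n\le x)$. Interpretability is the usual relative interpretation of theories. ''$\mathsf{G1}$ holds for $U$'': $U$ is recursively axiomatizable and consistent, and for every recursively axiomatizable consistent theory $S$, if $U$ is interpretable in $S$ then $S$ is incomplete.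
   Formalization: The degree d is additionally assumed recursively enumerable: theories are taken deductively closed, so a recursively axiomatizable U has an r.e. set of theorems and the claim fails for every non-r.e. degree d with 0 < d < 0'. *)

(* Defs.v *)
From mathcomp Require Import ssreflect ssrfun ssrbool eqtype ssrnat seq div.

Set Implicit Arguments.
Unset Strict Implicit.
Unset Printing Implicit Defensive.

Definition cpair (a b : nat) : nat := (a + b) * (a + b).+1 %/ 2 + b.

Definition code_list (l : seq nat) : nat :=
  foldr (fun x c => (cpair x c).+1) 0 l.

Inductive prog : Type :=
| PZero : prog
| PSucc : prog
| PProj : nat -> prog
| POrc  : prog
| PComp : prog -> seq prog -> prog
| PRec  : prog -> prog -> prog
| PMu   : prog -> prog.

Inductive eval (O : nat -> Prop) : prog -> seq nat -> nat -> Prop :=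
| ev_zero xs : eval O PZero xs 0
| ev_succ xs : eval O PSucc xs (nth 0 xs 0).+1
| ev_proj i xs : eval O (PProj i) xs (nth 0 xs i)
| ev_orc1 xs : O (nth 0 xs 0) -> eval O POrc xs 1
| ev_orc0 xs : ~ O (nth 0 xs 0) -> eval O POrc xs 0
| ev_comp f gs xs ys v :
    evals O gs xs ys -> eval O f ys v -> eval O (PComp f gs) xs v
| ev_rec0 f g xs v : eval O f xs v -> eval O (PRec f g) (0 :: xs) v
| ev_recS f g n xs r v :
    eval O (PRec f g) (n :: xs) r -> eval O g (n :: r :: xs) v ->
    eval O (PRec f g) (n.+1 :: xs) v
| ev_mu f xs n :
    eval O f (n :: xs) 0 ->
    (forall m, m < n -> exists k, eval O f (m :: xs) k.+1) ->
    eval O (PMu f) xs n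
with evals (O : nat -> Prop) : seq prog -> seq nat -> seq nat -> Prop :=
| evs_nil xs : evals O [::] xs [::]
| evs_cons g gs xs y ys :
    eval O g xs y -> evals O gs xs ys -> evals O (g :: gs) xs (y :: ys).

Definition Treducible (A B : nat -> Prop) : Prop :=
  exists p : prog, forall n,
    (A n -> eval B p [:: n] 1) /\ (~ A n -> eval B p [:: n] 0).

Definition Tequiv (A B : nat -> Prop) : Prop :=
  Treducible A B /\ Treducible B A.

Definition emptyset : nat -> Prop := fun _ => False.

Definition computable (A : nat -> Prop) : Prop := Treducible A emptyset.

Definition ce (A : nat -> Prop) : Prop :=
  exists p : prog, forall n, A n <-> exists v, eval emptyset p [:: n] v.

Fixpoint code_prog (p : prog) : nat :=
  match p with
  | PZero => cpair 0 0
  | PSucc => cpair 1 0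
  | PProj i => cpair 2 i
  | POrc => cpair 3 0
  | PComp f gs =>
      cpair 4 (cpair (code_prog f)
                 (foldr (fun g c => (cpair (code_prog g) c).+1) 0 gs))
  | PRec f g => cpair 5 (cpair (code_prog f) (code_prog g))
  | PMu f => cpair 6 (code_prog f)
  end.

(* The halting set; its Turing degree is 0'. *)
Definition K : nat -> Prop :=
  fun n => exists p, code_prog p = n /\ exists v, eval emptyset p [:: n] v.

(* Function symbol (f, k) = symbol number f applied to k arguments;    *)
(* likewise relation symbols.  Connectives: falsum, ->, forall.        *)
Inductive term : Type :=
| Var : nat -> term
| Func : nat -> seq term -> term.

Inductive form : Type :=
| Fal : form
| Eq : term -> term -> form
| Rel : nat -> seq term -> form
| Imp : form -> form -> form
| All : form -> form.

Definition Neg (a : form) : form := Imp a Fal.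
Definition Tru : form := Neg Fal.
Definition Or (a b : form) : form := Imp (Neg a) b.
Definition And (a b : form) : form := Neg (Imp a (Neg b)).
Definition Ex (a : form) : form := Neg (All (Neg a)).
Definition Exs (k : nat) (a : form) : form := iter k Ex a.
Definition Alls (k : nat) (a : form) : form := iter k All a.

Fixpoint subst_t (s : nat -> term) (t : term) : term :=
  match t with
  | Var n => s n
  | Func f ts => Func f (map (subst_t s) ts)
  end.

Definition up (s : nat -> term) : nat -> term :=
  fun n => match n with
           | 0 => Var 0
           | m.+1 => subst_t (fun k => Var k.+1) (s m)
           end.

Fixpoint subst_f (s : nat -> term) (a : form) : form :=
  match a with
  | Fal => Fal
  | Eq t1 t2 => Eq (subst_t s t1) (subst_t s t2)
  | Rel r ts => Rel r (map (subst_t s) ts)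
  | Imp a b => Imp (subst_f s a) (subst_f s b)
  | All a => All (subst_f (up s) a)
  end.

Definition lift (a : form) : form := subst_f (fun k => Var k.+1) a.

Definition inst (t : term) (a : form) : form :=
  subst_f (fun n => match n with 0 => t | m.+1 => Var m end) a.

Fixpoint tbound (n : nat) (t : term) : bool :=
  match t with
  | Var m => m < n
  | Func _ ts => all (tbound n) ts
  end.

Fixpoint fbound (n : nat) (a : form) : bool :=
  match a with
  | Fal => true
  | Eq t1 t2 => tbound n t1 && tbound n t2
  | Rel _ ts => all (tbound n) ts
  | Imp a b => fbound n a && fbound n b
  | All a => fbound n.+1 a
  end.

Record lang : Type := Lang {
  lfun : nat -> nat -> bool;   (* lfun f k : function symbol f of arity k *)
  lrel : nat -> nat -> bool    (* lrel r k : relation symbol r of arity k *)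
}.

Fixpoint term_in (L : lang) (t : term) : bool :=
  match t with
  | Var _ => true
  | Func f ts => lfun L f (size ts) && all (term_in L) ts
  end.

Fixpoint form_in (L : lang) (a : form) : bool :=
  match a with
  | Fal => true
  | Eq t1 t2 => term_in L t1 && term_in L t2
  | Rel r ts => lrel L r (size ts) && all (term_in L) ts
  | Imp a b => form_in L a && form_in L b
  | All a => form_in L a
  end.

Definition sentence (L : lang) (a : form) : Prop :=
  form_in L a /\ fbound 0 a.

Fixpoint code_t (t : term) : nat :=
  match t with
  | Var n => cpair 0 n
  | Func f ts =>
      cpair 1 (cpair f (foldr (fun u c => (cpair (code_t u) c).+1) 0 ts))
  end.

Fixpoint code_f (a : form) : nat :=
  match a with
  | Fal => 0
  | Eq t1 t2 => (cpair 0 (cpair (code_t t1) (code_t t2))).+1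
  | Rel r ts => (cpair 1 (cpair r (code_list (map code_t ts)))).+1
  | Imp a b => (cpair 2 (cpair (code_f a) (code_f b))).+1
  | All a => (cpair 3 (code_f a)).+1
  end.

Definition codes (T : form -> Prop) : nat -> Prop :=
  fun n => exists a, code_f a = n /\ T a.

(* (axioms of the theory are sentences, so Gen is sound)               *)
Inductive prov (T : form -> Prop) : form -> Prop :=
| pr_ax a : T a -> prov T a
| pr_K a b : prov T (Imp a (Imp b a))
| pr_S a b c : prov T (Imp (Imp a (Imp b c)) (Imp (Imp a b) (Imp a c)))
| pr_DN a : prov T (Imp (Neg (Neg a)) a)
| pr_inst a t : prov T (Imp (All a) (inst t a))
| pr_allimp a b : prov T (Imp (All (Imp (lift a) b)) (Imp a (All b)))
| pr_refl t : prov T (Eq t t)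
| pr_leib s t a : prov T (Imp (Eq s t) (Imp (inst s a) (inst t a)))
| pr_mp a b : prov T (Imp a b) -> prov T a -> prov T b
| pr_gen a : prov T a -> prov T (All a).

Record theory : Type := Theory {
  th_lang : lang;
  th_set : form -> Prop
}.

Definition is_theory (T : theory) : Prop :=
  forall a, th_set T a <-> sentence (th_lang T) a /\ prov (th_set T) a.

Definition consistent (T : theory) : Prop := ~ th_set T Fal.

Definition complete (T : theory) : Prop :=
  forall a, sentence (th_lang T) a -> th_set T a \/ th_set T (Neg a).

Definition rec_lang (L : lang) : Prop :=
  computable (fun n => exists f k, lfun L f k /\ n = cpair f k) /\
  computable (fun n => exists r k, lrel L r k /\ n = cpair r k).

Definition rec_axiomatizable (T : theory) : Prop :=
  rec_lang (th_lang T) /\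
  exists A : form -> Prop,
    (forall a, A a -> sentence (th_lang T) a) /\
    computable (codes A) /\
    (forall a, sentence (th_lang T) a -> (th_set T a <-> prov A a)).

Record interp : Type := Interp {
  idom : form;                    (* domain, free variable 0 *)
  ifun : nat -> nat -> form;      (* graph of f/k: args 0..k-1, value k *)
  irel : nat -> nat -> form       (* relation r/k: args 0..k-1 *)
}.

Definition at_var (i : nat) : nat -> term :=
  fun n => match n with 0 => Var i | m.+1 => Var n end.

Definition dom_at (tau : interp) (i : nat) : form := subst_f (at_var i) (idom tau).

(* tr_term tau t : "var 0 = t^tau", where variable m of t is variable m+1 *)
Fixpoint tr_term (tau : interp) (t : term) : form :=
  match t with
  | Var n => Eq (Var 0) (Var n.+1)
  | Func f ts =>
      let k := size ts in
      Exs k (And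
        ((fix go (i : nat) (us : seq term) : form :=
            match us with
            | [::] => Tru
            | u :: us' =>
                And (And (dom_at tau i)
                         (subst_f (fun n => match n with
                                            | 0 => Var i
                                            | m.+1 => Var (m.+1 + k) end)
                                  (tr_term tau u)))
                    (go i.+1 us')
            end) 0 ts)
        (ifun tau f k))
  end.

Fixpoint tr_args (tau : interp) (k i : nat) (us : seq term) : form :=
  match us with
  | [::] => Tru
  | u :: us' =>
      And (And (dom_at tau i)
               (subst_f (fun n => match n with
                                  | 0 => Var i
                                  | m.+1 => Var (m + k) end)
                        (tr_term tau u)))
          (tr_args tau k i.+1 us')
  end.

Fixpoint tr_form (tau : interp) (a : form) : form :=
  match a with
  | Fal => Fal
  | Eq s t => Ex (And (tr_term tau s) (tr_term tau t))
  | Rel r ts => Exs (size ts) (And (tr_args tau (size ts) 0 ts) (irel tau r (size ts)))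
  | Imp a b => Imp (tr_form tau a) (tr_form tau b)
  | All a => All (Imp (idom tau) (tr_form tau a))
  end.

Fixpoint doms (tau : interp) (k : nat) : form :=
  match k with
  | 0 => Tru
  | j.+1 => And (dom_at tau j) (doms tau j)
  end.

Definition graph_at (tau : interp) (f k d v : nat) : form :=
  subst_f (fun n => if n < k then Var (n + d) else if n == k then Var v else Var n)
          (ifun tau f k).

Definition interprets (T S : theory) : Prop :=
  exists tau : interp,
    (form_in (th_lang S) (idom tau) /\ fbound 1 (idom tau)) /\
        (forall f k, lfun (th_lang T) f k ->
           form_in (th_lang S) (ifun tau f k) /\ fbound k.+1 (ifun tau f k)) /\
        (forall r k, lrel (th_lang T) r k ->
           form_in (th_lang S) (irel tau r k) /\ fbound k (irel tau r k)) /\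
        th_set S (Ex (idom tau)) /\
        (forall f k, lfun (th_lang T) f k ->
           th_set S (Alls k (Imp (doms tau k)
              (Ex (And (idom tau) (graph_at tau f k 1 0)))))
           /\ th_set S (Alls k (Imp (doms tau k)
              (All (All (Imp (graph_at tau f k 2 1)
                         (Imp (graph_at tau f k 2 0) (Eq (Var 1) (Var 0))))))))) /\
        (forall a, th_set T a -> th_set S (tr_form tau a)).

Definition LA : lang :=
  Lang (fun f k => ((f == 0) && (k == 0)) || ((f == 1) && (k == 1)) ||
                   ((f == 2) && (k == 2)) || ((f == 3) && (k == 2)))
       (fun r k => (r == 0) && (k == 2)).

Definition zero : term := Func 0 [::].
Definition succ (t : term) : term := Func 1 [:: t].
Definition plus (s t : term) : term := Func 2 [:: s; t].
Definition times (s t : term) : term := Func 3 [:: s; t].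
Definition le (s t : term) : form := Rel 0 [:: s; t].
Definition num (n : nat) : term := iter n succ zero.

Definition bigOr (l : seq form) : form := foldr Or Fal l.

Inductive R_ax : form -> Prop :=
| Rax_plus m n : R_ax (Eq (plus (num m) (num n)) (num (m + n)))
| Rax_times m n : R_ax (Eq (times (num m) (num n)) (num (m * n)))
| Rax_neq m n : m <> n -> R_ax (Neg (Eq (num m) (num n)))
| Rax_le n : R_ax (All (Imp (le (Var 0) (num n))
                       (bigOr (map (fun i => Eq (Var 0) (num i)) (iota 0 n.+1)))))
| Rax_tot n : R_ax (All (Or (le (Var 0) (num n)) (le (num n) (Var 0)))).

Definition R_theory : theory :=
  Theory LA (fun a => sentence LA a /\ prov R_ax a).

Definition G1 (U : theory) : Prop :=
  rec_axiomatizable U /\ consistent U /\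
  forall S : theory, is_theory S -> rec_axiomatizable S -> consistent S ->
    interprets U S -> ~ complete S.

(* Main.v *)
(** A computably enumerable set D that is not computable is coded into a disjoint pair A, B of
    computably enumerable sets which no computable set separates and which are computable from D
    (Shoenfield): a number <e, x> is put into A or B only when x enters D, against the value that
    the e-th program has computed on <e, x> by then.  A separating program would have to be slower
    than the enumeration of D, and its running time would then decide D.

    The theory U speaks about one equivalence relation: no two classes have the same finite size,
    there is a class of size n + 1 for n in A, and none for n in B (Janiczak, Visser).  If a
    consistent complete axiomatizable S interprets U, then {n | S proves the translation of
    "some class has size n + 1"} is computable and separates A from B.

    By an Ehrenfeucht-Fraisse argument a sentence of quantifier rank r is decided by U together with
    the information which sizes below r + 1 occur.  So an unprovable sentence is refuted by U plus
    some finite pattern of sizes compatible with A and B, and a search for a proof or for such a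
    refutation reduces U to D.

    In a model of R, Rosser's comparison of witnesses defines a set containing A and disjoint from B
    on the standard numbers; with disjoint blocks of n + 1 numbers for each n in this set one
    obtains a model of U, since the blocks of nonstandard n are infinite.

    Computable enumerability of evaluation and provability is obtained from a finite system of Horn
    clauses on numbers: a derivation is a finite set of timestamped facts, coded as in Goedel's beta
    function, so that derivability becomes the projection of a bounded arithmetical formula. *)
From mathcomp Require Import ssreflect ssrfun ssrbool eqtype ssrnat seq div choice fintype bigop.
From mathcomp Require Import boolp zify.
From Stdlib Require Import ClassicalEpsilon.
Require Import Defs.

Set Implicit Arguments.
Unset Strict Implicit.
Unset Printing Implicit Defensive.

(** * First-order logic *)

(** Provability in U and in R is checked in all models and brought back by the completeness theorem,
    so that neither the game nor the interpretation needs formal derivations; syntax is handled only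
    where proofs have to be enumerated. One bounded formula, [Theta], plays two roles: it is
    decidable, which yields the searches behind every reduction, and at standard numbers it has the
    same truth value in all models of R, which lets R speak about A and B.

    Every set that contains A and avoids B is the set of sizes of some model of U. Hence U commits
    itself to nothing beyond A and B, and its degree can be kept at that of D. The obstacle in R is
    that it controls only standard numbers: blocks with nonstandard labels may overlap or collapse,
    and must be kept from producing finite classes. For the game, the pair is built so that A is
    infinite: every model of U then has arbitrarily large finite classes, which answer large or
    infinite ones without any appeal to compactness. *)

Fixpoint Forall (T : Type) (P : T -> Prop) (l : seq T) : Prop :=
  if l is x :: l' then P x /\ Forall P l' else True.

(** Terms nest inside [seq], and the generated induction principle gives no hypothesis for the
    arguments of [Func]. *)
Fixpoint term_nested_ind (P : term -> Prop) (hV : forall n, P (Var n))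
  (hF : forall f ts, Forall P ts -> P (Func f ts)) (t : term) : P t :=
  match t with
  | Var n => hV n
  | Func f ts => hF f ts
      ((fix go (l : seq term) : Forall P l :=
          match l return Forall P l with
          | [::] => I
          | u :: l' => conj (term_nested_ind hV hF u) (go l')
          end) ts)
  end.

Lemma map_Forall (T U : Type) (f g : T -> U) l :
  Forall (fun x => f x = g x) l -> map f l = map g l.
Proof. by elim: l => //= x l IH [-> /IH ->]. Qed.

Definition scons (T : Type) (x : T) (e : nat -> T) : nat -> T :=
  fun n => if n is m.+1 then e m else x.

Notation "x .: e" := (scons x e) (at level 55, right associativity).

Lemma inst_scons t a : inst t a = subst_f (t .: Var) a.
Proof. by []. Qed.

Lemma subst_t_comp s r t :
  subst_t s (subst_t r t) = subst_t (fun n => subst_t s (r n)) t.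
Proof.
by elim/term_nested_ind: t => //= f ts H; rewrite -map_comp (map_Forall H).
Qed.

Lemma up_comp s r :
  (fun n => subst_t (up s) (up r n)) = up (fun n => subst_t s (r n)).
Proof. by apply: funext => -[|n] //=; rewrite !subst_t_comp. Qed.

Lemma subst_f_comp a s r :
  subst_f s (subst_f r a) = subst_f (fun n => subst_t s (r n)) a.
Proof.
elim: a s r => //=.
- by move=> t u s r; rewrite !subst_t_comp.
- move=> R ts s r; rewrite -map_comp; congr Rel; apply: eq_map => t.
  exact: subst_t_comp.
- by move=> a IHa b IHb s r; rewrite IHa IHb.
- by move=> a IH s r; rewrite IH up_comp.
Qed.

Lemma subst_t_Var t : subst_t Var t = t.
Proof.
by elim/term_nested_ind: t => //= f ts H; rewrite (map_Forall H) map_id.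
Qed.

Lemma up_Var : up Var = Var.
Proof. by apply: funext => -[|n]. Qed.

Lemma subst_f_Var a : subst_f Var a = a.
Proof.
elim: a => //=.
- by move=> t u; rewrite !subst_t_Var.
- by move=> R ts; rewrite (eq_map subst_t_Var) map_id.
- by move=> a -> b ->.
- by move=> a IH; rewrite up_Var IH.
Qed.

Lemma subst_t_bound k s r t :
  (forall n, n < k -> s n = r n) -> tbound k t -> subst_t s t = subst_t r t.
Proof.
move=> E; elim/term_nested_ind: t => [n /E //|f ts H /= B].
by congr Func; apply: map_Forall; elim: ts H B => //= t ts IH [h1 h2] /andP[/h1-> /(IH h2)].
Qed.

Lemma up_bound k s r : (forall n, n < k -> s n = r n) ->
  forall n, n < k.+1 -> up s n = up r n.
Proof. by move=> E [|n] //= h; rewrite E. Qed.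

Lemma subst_f_bound k s r a :
  (forall n, n < k -> s n = r n) -> fbound k a -> subst_f s a = subst_f r a.
Proof.
elim: a k s r => //=.
- by move=> t u k s r E /andP[B1 B2]; rewrite !(subst_t_bound E).
- move=> R ts k s r E B; congr Rel; elim: ts B => //= t ts IH /andP[B1 B2].
  by rewrite (subst_t_bound E) // IH.
- by move=> a IHa b IHb k s r E /andP[B1 B2]; rewrite (IHa k s r) // (IHb k s r).
- by move=> a IH k s r E B; rewrite (IH k.+1 _ (up r)) //; apply: up_bound.
Qed.

Lemma subst_f_closed s a : fbound 0 a -> subst_f s a = a.
Proof. by move=> B; rewrite -[RHS]subst_f_Var; apply: subst_f_bound B. Qed.

Lemma subst_inst s t a :
  subst_f s (inst t a) = inst (subst_t s t) (subst_f (up s) a).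
Proof.
rewrite /inst !subst_f_comp; congr (subst_f _ a); apply: funext => -[|n] //=.
by rewrite subst_t_comp /= subst_t_Var.
Qed.

Lemma subst_lift s a : subst_f (up s) (lift a) = lift (subst_f s a).
Proof. by rewrite /lift !subst_f_comp. Qed.

Lemma tbound_mono m n t : m <= n -> tbound m t -> tbound n t.
Proof.
move=> le; elim/term_nested_ind: t => [k /= h|f ts H /=]; first exact: leq_trans le.
by elim: ts H => //= t ts IH [h1 h2] /andP[/h1-> /(IH h2)].
Qed.

Lemma fbound_mono m n a : m <= n -> fbound m a -> fbound n a.
Proof.
elim: a m n => //=.
- by move=> t u m n le /andP[B1 B2]; rewrite !(tbound_mono le).
- move=> R ts m n le; elim: ts => //= t ts IH /andP[B1 /IH->].
  by rewrite (tbound_mono le).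
- by move=> a IHa b IHb m n le /andP[B1 B2]; rewrite (IHa m) // (IHb m).
- by move=> a IH m n le; apply: IH.
Qed.

Lemma tbound_ex t : exists n, tbound n t.
Proof.
elim/term_nested_ind: t => [n|f ts H /=]; first by exists n.+1 => /=.
elim: ts H => [|t ts IH /= [[n hn] /IH [m hm]]]; first by exists 0.
exists (maxn n m); rewrite (tbound_mono _ hn) ?leq_maxl //=.
by elim: ts hm {IH} => //= u ts IH /andP[h1 /IH->]; rewrite (tbound_mono _ h1) ?leq_maxr.
Qed.

Lemma fbound_ex a : exists n, fbound n a.
Proof.
elim: a => /=; first by exists 0.
- move=> t u; have [n hn] := tbound_ex t; have [m hm] := tbound_ex u.
  by exists (maxn n m); rewrite (tbound_mono _ hn) ?leq_maxl ?(tbound_mono _ hm) ?leq_maxr.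
- move=> R ts; have [n /= hn] := tbound_ex (Func R ts); by exists n.
- move=> a [n hn] b [m hm].
  by exists (maxn n m); rewrite (fbound_mono _ hn) ?leq_maxl ?(fbound_mono _ hm) ?leq_maxr.
- by move=> a [n hn]; exists n; apply: fbound_mono hn.
Qed.

(** * Structures and satisfaction *)

Record structure : Type := Structure {
  dom : Type;
  fI : nat -> seq dom -> dom;
  rI : nat -> seq dom -> Prop
}.

Fixpoint teval (M : structure) (e : nat -> dom M) (t : term) : dom M :=
  match t with
  | Var n => e n
  | Func f ts => fI f (map (teval e) ts)
  end.

Fixpoint sat (M : structure) (e : nat -> dom M) (a : form) : Prop :=
  match a with
  | Fal => False
  | Eq t u => teval e t = teval e u
  | Rel r ts => rI r (map (teval e) ts)
  | Imp a b => sat e a -> sat e b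
  | All a => forall x, sat (x .: e) a
  end.

Definition models (M : structure) (T : form -> Prop) : Prop :=
  forall a, T a -> forall e : nat -> dom M, sat e a.

Section Sat.
Variable M : structure.
Implicit Type e : nat -> dom M.

Lemma teval_subst e s t :
  teval e (subst_t s t) = teval (fun n => teval e (s n)) t.
Proof.
by elim/term_nested_ind: t => //= f ts H; rewrite -map_comp (map_Forall H).
Qed.

Lemma sat_subst e s a :
  sat e (subst_f s a) <-> sat (fun n => teval e (s n)) a.
Proof.
elim: a e s => //=.
- by move=> t u e s; rewrite !teval_subst.
- move=> R ts e s; rewrite -map_comp.
  by rewrite (eq_map (_ : _ =1 teval (fun n => teval e (s n)))) // => t /=; rewrite teval_subst.
- by move=> a IHa b IHb e s; rewrite IHa IHb.
- move=> a IH e s; split=> H x; move: (H x); rewrite IH.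
  all: suff -> : (fun n => teval (x .: e) (up s n)) = x .: (fun n => teval e (s n)) by [].
  all: by apply: funext => -[|n] //=; rewrite teval_subst.
Qed.

Lemma sat_inst e t a : sat e (inst t a) <-> sat (teval e t .: e) a.
Proof.
rewrite /inst sat_subst.
suff -> : (fun n => teval e match n with 0 => t | m.+1 => Var m end) = teval e t .: e by [].
by apply: funext => -[|n].
Qed.

Lemma sat_lift e x a : sat (x .: e) (lift a) <-> sat e a.
Proof. by rewrite /lift sat_subst. Qed.

Lemma teval_bound k e e' t :
  (forall n, n < k -> e n = e' n) -> tbound k t -> teval e t = teval e' t.
Proof.
move=> E; elim/term_nested_ind: t => [n /E //|f ts H /= B].
by congr fI; apply: map_Forall; elim: ts H B => //= t ts IH [h1 h2] /andP[/h1-> /(IH h2)].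
Qed.

Lemma sat_bound k e e' a :
  (forall n, n < k -> e n = e' n) -> fbound k a -> sat e a <-> sat e' a.
Proof.
elim: a k e e' => //=.
- by move=> t u k e e' E /andP[B1 B2]; rewrite !(teval_bound E).
- move=> R ts k e e' E B; suff -> : map (teval e) ts = map (teval e') ts by [].
  elim: ts B => //= t ts IH /andP[B1 B2].
  by rewrite (teval_bound E) // IH.
- by move=> a IHa b IHb k e e' E /andP[B1 B2]; rewrite (IHa k e e') // (IHb k e e').
- move=> a IH k e e' E B; split=> H x.
    by rewrite -(IH k.+1 (x .: e)) // => -[|n] //= /E.
  by rewrite (IH k.+1 _ (x .: e')) // => -[|n] //= /E.
Qed.

Lemma sat_closed e e' a : fbound 0 a -> sat e a <-> sat e' a.
Proof. exact: sat_bound. Qed.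

Lemma sat_Neg e a : sat e (Neg a) <-> ~ sat e a.
Proof. by []. Qed.

Lemma sat_Tru e : sat e Tru <-> True.
Proof. by split=> // _ /=. Qed.

Lemma sat_And e a b : sat e (And a b) <-> sat e a /\ sat e b.
Proof. split=> /= [H|[ha hb] H]; last exact: H.
by split; apply: contrapT => h; apply: H. Qed.

Lemma sat_Or e a b : sat e (Or a b) <-> sat e a \/ sat e b.
Proof.
split=> /= [H|[ha|//] h]; last by case: (h ha).
by have [|h] := EM (sat e a); [left | right; apply: H].
Qed.

Lemma sat_Ex e a : sat e (Ex a) <-> exists x, sat (x .: e) a.
Proof.
split=> /= [H|[x hx] H]; last exact: (H x).
by apply: contrapT => h; apply: H => x hx; apply: h; exists x.
Qed.

Lemma soundness T a : models M T -> prov T a -> forall e, sat e a.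
Proof.
move=> MT; elim=> {a} //=.
- by move=> a b c e h1 h2 h3; apply: h1 => //; apply: h2.
- by move=> a e h; apply: contrapT.
- by move=> a t e h; rewrite sat_inst.
- by move=> a b e h ha x; apply: h; rewrite sat_lift.
- by move=> s t a e E; rewrite !sat_inst E.
- by move=> a b _ IH1 _ IH2 e; apply: IH1.
Qed.

End Sat.

(** The domain of a structure may be empty; then there are no assignments and [models] holds
    vacuously, hence the hypothesis [inhabited]. *)
Lemma models_consistent M T : inhabited (dom M) -> models M T -> ~ prov T Fal.
Proof. by move=> [x] MT /(soundness MT) /(_ (fun=> x)). Qed.

Lemma prov_mono (T T' : form -> Prop) a :
  (forall b, T b -> prov T' b) -> prov T a -> prov T' a.
Proof.
move=> sub; elim=> {a}; try by [constructor | move=> a /sub].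
by move=> a b _ h1 _ h2; apply: pr_mp h1 h2.
Qed.

(** * Derivations from closed axioms *)

Section Prov.
Variable T : form -> Prop.
Hypothesis Tclosed : forall a, T a -> fbound 0 a.

(** The axioms are closed, so a substitution can be pushed through a whole derivation. This lets
    variables take the place of new constants in the Henkin construction. *)
Lemma prov_subst a : prov T a -> forall s, prov T (subst_f s a).
Proof.
elim=> {a}.
- by move=> a Ta s; rewrite subst_f_closed ?Tclosed //; apply: pr_ax.
- by move=> a b s; apply: pr_K.
- by move=> a b c s; apply: pr_S.
- by move=> a s; apply: pr_DN.
- by move=> a t s /=; rewrite subst_inst; apply: pr_inst.
- by move=> a b s /=; rewrite subst_lift; apply: pr_allimp.
- by move=> t s; apply: pr_refl.
- by move=> t u a s /=; rewrite !subst_inst; apply: pr_leib.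
- by move=> a b _ h1 _ h2 s; apply: pr_mp (h1 s) (h2 s).
- by move=> a _ h s; apply: pr_gen.
Qed.

(* Derivations without generalization: unlike [prov], these admit the deduction theorem for open hypotheses. *)
Inductive der (G : form -> Prop) : form -> Prop :=
| der_thm a : prov T a -> der G a
| der_hyp a : G a -> der G a
| der_mp a b : der G (Imp a b) -> der G a -> der G b.

Lemma der_mono (G G' : form -> Prop) a :
  (forall b, G b -> G' b) -> der G a -> der G' a.
Proof.
move=> sub; elim=> {a}; [exact: der_thm | by move=> a /sub; apply: der_hyp |].
by move=> a b _ h1 _; apply: der_mp.
Qed.

Definition ext (G : form -> Prop) (a : form) : form -> Prop := fun b => b = a \/ G b.

Lemma der_K G a b : der G b -> der G (Imp a b).
Proof. by apply: der_mp; apply: der_thm; apply: pr_K. Qed.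

Lemma der_id G a : der G (Imp a a).
Proof.
apply: der_mp (der_thm _ (pr_K _ a a)).
exact: der_mp (der_thm _ (pr_S _ _ _ _)) (der_thm _ (pr_K _ a (Imp a a))).
Qed.

Lemma deduction G a b : der (ext G a) b -> der G (Imp a b).
Proof.
elim=> {b}.
- by move=> b h; apply: der_K; apply: der_thm.
- by move=> b [->|h]; [apply: der_id | apply: der_K; apply: der_hyp].
- move=> b c _ h1 _; apply: der_mp; apply: der_mp h1.
  exact/der_thm/pr_S.
Qed.

Lemma der_ext G a b : der G b -> der (ext G a) b.
Proof. by apply: der_mono => c; right. Qed.

Lemma der_ext1 G a : der (ext G a) a.
Proof. by apply: der_hyp; left. Qed.

Lemma der_contra G a : der (ext G (Neg a)) Fal -> der G a.
Proof. by move=> /deduction; apply: der_mp; apply/der_thm/pr_DN. Qed.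

Lemma der_exfalso G a : der G Fal -> der G a.
Proof. by move=> h; apply: der_contra; apply: der_ext. Qed.

Lemma der_empty a : der (fun _ => False) a -> prov T a.
Proof. by elim=> {a} // a b _ h1 _ h2; apply: pr_mp h1 h2. Qed.

Lemma prov_id a : prov T (Imp a a).
Proof. exact/der_empty/der_id. Qed.

Lemma inst0_up a : inst (Var 0) (subst_f (up (fun k => Var k.+1)) a) = a.
Proof.
rewrite /inst subst_f_comp -[RHS]subst_f_Var.
by congr (subst_f _ a); apply: funext => -[|n].
Qed.

(** Not an axiom of [prov]: it comes from [pr_allimp], with the lifted [All a] as the antecedent
    that is free of variable 0. *)
Lemma prov_all_distr a b : prov T (Imp (All (Imp a b)) (Imp (All a) (All b))).
Proof.
have inst0 c : prov T (Imp (lift (All c)) c).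
  by have := pr_inst T (subst_f (up (fun k => Var k.+1)) c) (Var 0); rewrite inst0_up.
have h1 : prov T (Imp (All (Imp a b)) (All (Imp (lift (All a)) b))).
  apply: pr_mp (pr_allimp _ _ _) _; apply: pr_gen.
  apply: der_empty; apply: deduction; apply: deduction.
  apply: der_mp (_ : der _ a).
    by apply: der_mp (der_thm _ (inst0 _)) _; apply: der_ext; apply: der_ext1.
  by apply: der_mp (der_thm _ (inst0 _)) _; apply: der_ext1.
apply: der_empty; apply: deduction.
apply: der_mp (der_thm _ (pr_allimp _ _ _)) _.
by apply: der_mp (der_thm _ h1) _; apply: der_ext1.
Qed.

(** The eigenvariable condition in de Bruijn form: a hypothesis [lift g] does not mention variable
    0. *)
Lemma der_gen G a :
  der (fun c => exists2 g, G g & c = lift g) a -> der G (All a).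
Proof.
elim=> {a}.
- by move=> a h; apply/der_thm/pr_gen.
- move=> a [g Gg ->]; apply: der_mp (der_hyp Gg).
  by apply: der_mp (der_thm _ (pr_allimp _ _ _)) _; apply/der_thm/pr_gen/prov_id.
- move=> a b _ h1 _; apply: der_mp; apply: der_mp h1.
  exact/der_thm/prov_all_distr.
Qed.

Lemma der_subst G s a : der G a ->
  der (fun c => exists2 g, G g & c = subst_f s g) (subst_f s a).
Proof.
elim=> {a}.
- by move=> a h; apply/der_thm/prov_subst.
- by move=> a h; apply: der_hyp; exists a.
- by move=> a b _ h1 _; apply: der_mp.
Qed.

(** The substitution [s] renames v to 0 and shifts all other variables: it undoes the instantiation
    at v, and on the hypotheses, which live below v, it agrees with [lift]. *)
Lemma der_fresh G v a : (forall g, G g -> fbound v g) -> fbound v.+1 a ->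
  der G (inst (Var v) a) -> der G (All a).
Proof.
move=> BG Ba; pose s n := if n == v then Var 0 else Var n.+1.
move=> /(@der_subst _ s).
have -> : subst_f s (inst (Var v) a) = a.
  rewrite /inst subst_f_comp -[RHS]subst_f_Var; apply: subst_f_bound Ba.
  by move=> [|n] /= h; rewrite /s ?eqxx //; have -> : n == v = false by lia.
move=> h; apply: der_gen; apply: der_mono h => c [g Gg ->]; exists g => //.
apply: subst_f_bound (BG _ Gg) => n h.
by rewrite /s; have -> : n == v = false by lia.
Qed.

(** A refutation of the Henkin implication yields its premise [inst (Var v) a]; as v is fresh, this
    generalizes to the conclusion [All a], and the implication holds after all. *)
Lemma henkin_consistent G v a : (forall g, G g -> fbound v g) -> fbound v.+1 a ->
  der (ext G (Imp (inst (Var v) a) (All a))) Fal -> der G Fal.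
Proof.
move=> BG Ba /deduction h.
have h1 : der G (inst (Var v) a).
  apply: der_contra; apply: der_mp (der_ext _ h) _; apply: deduction.
  apply: der_exfalso; apply: der_mp (der_ext1 _ _); apply: der_ext.
  exact: der_ext1.
apply: (der_mp h); apply: der_K; exact: der_fresh h1.
Qed.

End Prov.

(** * Codes *)

(** Doubling removes the division, after which [lia] and [nia] can reason about pairs. *)
Lemma cpairE a b : 2 * cpair a b = (a + b) * (a + b).+1 + 2 * b.
Proof.
rewrite /cpair mulnDr; congr (_ + _); rewrite mulnC divnK // dvdn2.
by rewrite oddM /= andbN.
Qed.

Lemma cpair_inj a b c d : cpair a b = cpair c d -> a = c /\ b = d.
Proof.
move=> E; have := cpairE a b; rewrite E cpairE => {}E.
(* A pair with sum s lies between the triangular numbers of s and s + 1, so its value determines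
   s. *)
have : a + b = c + d by nia.
by nia.
Qed.

Lemma cpair_surj n : exists a b, n = cpair a b.
Proof.
elim: n => [|n [a [b ->]]]; first by exists 0, 0.
case: a => [|a].
  exists b.+1, 0; have := cpairE 0 b; have := cpairE b.+1 0; nia.
exists a, b.+1; have := cpairE a.+1 b; have := cpairE a b.+1; nia.
Qed.

Lemma cpair_gel a b : a <= cpair a b.
Proof. have := cpairE a b; nia. Qed.

Lemma cpair_ger a b : b <= cpair a b.
Proof. have := cpairE a b; nia. Qed.

Lemma code_list_inj : injective code_list.
Proof.
by elim=> [|x l IH] [|y l'] //= [] /cpair_inj[-> /IH->].
Qed.

Lemma code_list_surj n : exists l, code_list l = n.
Proof.
have [m le] := ubnP n; elim: m n le => // m IH [|n] le; first by exists [::].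
have [a [b E]] := cpair_surj n; have [|l El] := IH b; first by have := cpair_ger a b; lia.
by exists (a :: l) => /=; rewrite El E.
Qed.

Lemma code_tE f ts : code_t (Func f ts) = cpair 1 (cpair f (code_list (map code_t ts))).
Proof. by rewrite /=; congr (cpair _ (cpair _ _)); elim: ts => //= t ts ->. Qed.

Lemma code_t_inj : injective code_t.
Proof.
move=> t; elim/term_nested_ind: t => [n|f ts H] [m|g us]; rewrite ?code_tE.
- by move=> /cpair_inj[_ ->].
- by move=> /cpair_inj[].
- by move=> /cpair_inj[].
- move=> /cpair_inj[_ /cpair_inj[-> /code_list_inj E]]; congr Func.
  elim: ts us H E => [|t ts IH] [|u us] //= [h1 h2] [/h1-> E2].
  by rewrite (IH us).
Qed.

Lemma code_ts_inj : injective (fun ts => code_list (map code_t ts)).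
Proof. by move=> ts us /code_list_inj; apply: inj_map; apply: code_t_inj. Qed.

Lemma code_f_inj : injective code_f.
Proof.
elim=> [|t u|r ts|a IHa b IHb|a IHa] [|t' u'|r' ts'|a' b'|a'] //= [] /cpair_inj[] //= _.
- by move=> /cpair_inj[/code_t_inj-> /code_t_inj->].
- by move=> /cpair_inj[-> /code_ts_inj->].
- by move=> /cpair_inj[/IHa-> /IHb->].
- by move=> /IHa->.
Qed.

Lemma codes_code T a : codes T (code_f a) <-> T a.
Proof. by split=> [[b [/code_f_inj-> ]]|]; last by exists a. Qed.

(** * Completeness *)

Section Henkin.
Variable T : form -> Prop.
Hypothesis Tclosed : forall a, T a -> fbound 0 a.

Section MaximalTheory.
Variable G : form -> Prop.
Local Notation "|- a" := (der T G a) (at level 70).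
Hypothesis Gcons : ~ |- Fal.
Hypothesis Gcomplete : forall a, |- a \/ |- Neg a.
Hypothesis Ghenkin : forall a, exists t, |- Imp (inst t a) (All a).

Lemma der_Neg a : |- Neg a <-> ~ |- a.
Proof.
split=> [h1 h2|]; first by apply: Gcons; apply: der_mp h1 h2.
by case: (Gcomplete a).
Qed.

Lemma der_Imp a b : |- Imp a b <-> (|- a -> |- b).
Proof.
split=> [h1 h2|h]; first exact: der_mp h1 h2.
have [ha|/der_Neg hna] := EM (|- a); first by apply: der_K; apply: h.
apply: deduction; apply: der_exfalso; apply: der_mp (der_ext1 _ _ _).
exact: der_ext.
Qed.

Lemma der_All a : |- All a <-> forall t, |- inst t a.
Proof.
split=> [h t|h]; first by apply: der_mp h; apply/der_thm/pr_inst.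
by have [t ht] := Ghenkin a; apply: der_mp ht (h t).
Qed.

Definition teq (t u : term) : Prop := |- Eq t u.

Lemma teq_refl t : teq t t.
Proof. exact/der_thm/pr_refl. Qed.

Lemma teq_leib t u a : teq t u -> |- inst t a -> |- inst u a.
Proof. by move=> h; apply: der_mp; apply: der_mp h; apply/der_thm/pr_leib. Qed.

Lemma inst_wk t u : subst_t (t .: Var) (subst_t (fun k => Var k.+1) u) = u.
Proof. by rewrite subst_t_comp subst_t_Var. Qed.

Lemma teq_sym t u : teq t u -> teq u t.
Proof.
move=> h; have := @teq_leib t u (Eq (Var 0) (subst_t (fun k => Var k.+1) t)) h.
by rewrite !inst_scons /= !inst_wk; apply; apply: teq_refl.
Qed.

Lemma teq_trans t u v : teq t u -> teq u v -> teq t v.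
Proof.
move=> h1 h2; have := @teq_leib u v (Eq (subst_t (fun k => Var k.+1) t) (Var 0)) h2.
by rewrite !inst_scons /= !inst_wk; apply.
Qed.

Fixpoint teqs (ts us : seq term) : Prop :=
  match ts, us with
  | [::], [::] => True
  | t :: ts', u :: us' => teq t u /\ teqs ts' us'
  | _, _ => False
  end.

Lemma map_inst_wk t ts :
  map (subst_t (t .: Var)) (map (subst_t (fun k => Var k.+1)) ts) = ts.
Proof. by rewrite -map_comp -[RHS]map_id; apply: eq_map => u; apply: inst_wk. Qed.

(** [pr_leib] replaces a single term, so the arguments are exchanged one by one from the left; [pre]
    collects those already exchanged. *)
Lemma teqs_ctx (c : seq term -> form) :
  (forall pre post, exists a, forall t, inst t a = c (pre ++ t :: post)) ->
  forall ts us, teqs ts us -> |- c ts -> |- c us.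
Proof.
move=> hc ts us h; suff gen pre : |- c (pre ++ ts) -> |- c (pre ++ us) by apply: (gen [::]).
elim: ts us h pre => [|t ts IH] [|u us] //= [h1 h2] pre h.
rewrite -cat_rcons; apply: IH => //; rewrite cat_rcons.
have [a ha] := hc pre ts; rewrite -ha; apply: teq_leib h1 _.
by rewrite ha.
Qed.

Lemma teqs_Func f ts us : teqs ts us -> teq (Func f ts) (Func f us).
Proof.
move=> h; apply: (@teqs_ctx (fun vs => Eq (Func f ts) (Func f vs)) _ ts us h).
  move=> pre post; pose w := subst_t (fun k => Var k.+1).
  exists (Eq (w (Func f ts)) (Func f (map w pre ++ Var 0 :: map w post))) => t.
  by rewrite inst_scons /= map_cat /= !map_inst_wk.
exact: teq_refl.
Qed.

Lemma teqs_Rel r ts us : teqs ts us -> |- Rel r ts -> |- Rel r us.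
Proof.
apply: teqs_ctx => pre post; pose w := subst_t (fun k => Var k.+1).
exists (Rel r (map w pre ++ Var 0 :: map w post)) => t.
by rewrite inst_scons /= map_cat /= !map_inst_wk.
Qed.

(** Chosen representatives replace the quotient of the terms by provable equality: the domain [tdom]
    consists of the terms that represent themselves. *)
Definition rep (t : term) : term := epsilon (inhabits t) (teq t).

Lemma teq_rep t : teq t (rep t).
Proof. by apply: epsilon_spec; exists t; apply: teq_refl. Qed.

Lemma rep_eq t u : teq t u -> rep t = rep u.
Proof.
move=> h; have E : teq t = teq u.
  apply: funext => v; apply: propext.
  by split; apply: teq_trans => //; apply: teq_sym.
by rewrite /rep E; apply: epsilon_inh_irrelevance; exists u; apply: teq_refl.
Qed.

Definition tdom : Type := {t : term | rep t = t}.

Lemma rep_rep t : rep (rep t) = rep t.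
Proof. by apply/esym/rep_eq/teq_rep. Qed.

Definition cls (t : term) : tdom := exist _ (rep t) (rep_rep t).

Lemma cls_eq t u : cls t = cls u <-> teq t u.
Proof.
split=> [[E]|/rep_eq E].
  by apply: teq_trans (teq_rep t) _; rewrite E; apply/teq_sym/teq_rep.
by apply: eq_exist.
Qed.

Lemma cls_surj (d : tdom) : exists t, d = cls t.
Proof. by case: d => t h; exists t; apply: eq_exist. Qed.

Definition term_model : structure :=
  @Structure tdom (fun f ds => cls (Func f (map sval ds)))
                  (fun r ds => |- Rel r (map sval ds)).

Lemma teqs_rep ts : teqs ts (map (fun t => sval (cls t)) ts).
Proof. by elim: ts => //= t ts IH; split=> //; apply: teq_rep. Qed.

Lemma teqs_sym ts us : teqs ts us -> teqs us ts.
Proof. by elim: ts us => [|t ts IH] [|u us] //= [/teq_sym h /IH]. Qed.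

Lemma teval_term_model s t :
  @teval term_model (fun n => cls (s n)) t = cls (subst_t s t).
Proof.
elim/term_nested_ind: t => //= f ts H; rewrite (map_Forall H); apply/cls_eq.
by rewrite -map_comp; apply/teqs_Func/teqs_sym; have := teqs_rep (map (subst_t s) ts); rewrite -map_comp.
Qed.

(** The truth lemma. It is stated for all assignments of classes of terms, because the quantifier
    case extends [s] by the term of a new element. *)
Lemma sat_term_model a s :
  @sat term_model (fun n => cls (s n)) a <-> |- subst_f s a.
Proof.
elim: a s => [|t u|r ts|a IHa b IHb|a IH] s /=.
- by split=> // /Gcons.
- by rewrite !teval_term_model cls_eq.
- rewrite (eq_map (teval_term_model s)) -map_comp.
  have := teqs_rep (map (subst_t s) ts); rewrite -map_comp => h.
  by split; apply: teqs_Rel => //; apply: teqs_sym.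
- by rewrite IHa IHb der_Imp.
- rewrite der_All; split=> [h t|h d].
    have := h (cls t).
    have -> : cls t .: (fun n => cls (s n)) = fun n => cls ((t .: s) n).
      by apply: funext => -[].
    rewrite IH /inst subst_f_comp.
    set r := (X in _ -> |- subst_f X a); suff -> : t .: s = r by [].
    by apply: funext => -[|n] //=; rewrite /r /= subst_t_comp subst_t_Var.
  have [t ->] := cls_surj d.
  have -> : cls t .: (fun n => cls (s n)) = fun n => cls ((t .: s) n).
    by apply: funext => -[].
  rewrite IH; have := h t; rewrite /inst subst_f_comp.
  set r := (X in |- subst_f X a -> _); suff -> : t .: s = r by [].
  by apply: funext => -[|n] //=; rewrite /r /= subst_t_comp subst_t_Var.
Qed.

End MaximalTheory.

Definition mem (l : seq form) : form -> Prop := fun a => List.In a l.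

(** Values at numbers that code no formula are arbitrary; the chain below only has to meet every
    formula at some stage. *)
Definition decode (n : nat) : form := epsilon (inhabits Fal) (fun a => code_f a = n).

Lemma decode_code a : decode (code_f a) = a.
Proof.
apply: code_f_inj.
exact: (epsilon_spec _ (fun b => code_f b = code_f a) (ex_intro _ a erefl)).
Qed.

(** Besides the closed theory [T] there are only finitely many hypotheses at each stage, so some
    variable is always fresh. *)
Definition list_bound (l : seq form) : nat :=
  epsilon (inhabits 0) (fun k => forall a, mem l a -> fbound k a).

Lemma list_boundP l a : mem l a -> fbound (list_bound l) a.
Proof.
apply: (epsilon_spec _ (fun k => forall a, mem l a -> fbound k a)).
elim: l => [|b l [k hk]]; first by exists 0.
have [m hm] := fbound_ex b; exists (maxn k m) => c [<-|/hk h].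
  by apply: fbound_mono hm; rewrite leq_maxr.
by apply: fbound_mono h; rewrite leq_maxl.
Qed.

Definition con (l : seq form) : Prop := ~ der T (mem l) Fal.

Definition henkin (l : seq form) (a : form) : form :=
  Imp (inst (Var (list_bound (a :: l))) a) (All a).

(** The Henkin formula of [a] is added whether or not [a] itself is accepted, so every formula
    receives a witness. *)
Definition henkin_step (l : seq form) (a : form) : seq form :=
  let l' := if pselect (con (a :: l)) then a :: l else l in
  henkin l' a :: l'.

Fixpoint henkin_chain (l : seq form) (n : nat) : seq form :=
  if n is m.+1 then henkin_step (henkin_chain l m) (decode m) else l.

Lemma mem_cons a l : mem (a :: l) = ext (mem l) a.
Proof.
apply: funext => b; apply: propext; split=> [[->|]|[->|]]; by [left|right].
Qed.

Lemma henkin_con l a : con l -> con (henkin l a :: l).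
Proof.
move=> h; rewrite /con mem_cons => /(henkin_consistent Tclosed) H; apply/h/H.
  by move=> g hg; apply: list_boundP; right.
apply: fbound_mono (leqnSn _) _; apply: list_boundP; exact: or_introl.
Qed.

Lemma henkin_step_con l a : con l -> con (henkin_step l a).
Proof. by move=> h; apply: henkin_con; case: pselect. Qed.

Lemma lindenbaum l : con l -> exists G : form -> Prop,
  [/\ forall a, mem l a -> G a, ~ der T G Fal, (forall a, der T G a \/ der T G (Neg a))
    & forall a, exists t, der T G (Imp (inst t a) (All a))].
Proof.
move=> cl; pose C := henkin_chain l; pose G a := exists n, mem (C n) a.
have conC n : con (C n) by elim: n => //= n IH; apply: henkin_step_con.
have CS n a : mem (C n) a -> mem (C n.+1) a.
  by move=> h; right; case: pselect => // ?; right.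
have Cmono m n a : m <= n -> mem (C m) a -> mem (C n) a.
  elim: n => [|n IH]; first by case: m.
  by rewrite leq_eqVlt => /orP[/eqP-> //|/IH h {}/h h]; apply: CS.
have derG a : der T G a -> exists n, der T (mem (C n)) a.
  elim=> {a}; first by move=> a h; exists 0; apply: der_thm.
    by move=> a [n h]; exists n; apply: der_hyp.
  move=> a b _ [n hn] _ [m hm]; exists (maxn n m); apply: (@der_mp _ _ a b).
    by apply: der_mono hn => c; apply: Cmono; rewrite leq_maxl.
  by apply: der_mono hm => c; apply: Cmono; rewrite leq_maxr.
have GC n a : der T (mem (C n)) a -> der T G a.
  by apply: der_mono => b h; exists n.
exists G; split.
- by move=> a h; exists 0.
- by move=> /derG[n /conC].
- move=> a; have : mem (C (code_f a).+1) a \/ ~ con (a :: C (code_f a)).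
    rewrite /= /henkin_step decode_code -/(C _).
    by case: pselect => h; [left; right; left|right].
  case=> [h|/contrapT]; first by left; apply: der_hyp; exists (code_f a).+1.
  by rewrite mem_cons => /deduction /GC h; right.
- move=> a; pose l' := if pselect (con (a :: C (code_f a))) then a :: C (code_f a) else C (code_f a).
  exists (Var (list_bound (a :: l'))); apply: der_hyp; exists (code_f a).+1.
  by left; rewrite decode_code.
Qed.

Lemma completeness a :
  (forall M, models M T -> forall e : nat -> dom M, sat e a) -> prov T a.
Proof.
move=> valid; apply: contrapT => np.
(* [a] may have free variables: its negation enters as a hypothesis of [der], which is never
   generalized. *)
have /lindenbaum[G [sub Gcons Gcomp Ghen]] : con [:: Neg a].
  rewrite /con mem_cons => /der_contra h; apply: np; apply: der_empty.
  by apply: der_mono h.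
have hM := sat_term_model Gcons Gcomp Ghen.
have MT : models (term_model G) T.
  move=> b Tb e; rewrite (@sat_closed (term_model G) _ (fun n => cls G (Var n))); last exact: Tclosed.
  by rewrite hM subst_f_Var; apply/der_thm/pr_ax.
have := valid _ MT (fun n => cls G (Var n)); rewrite hM subst_f_Var => h.
by apply: Gcons; apply: der_mp h; apply: der_hyp; apply: sub; left.
Qed.

End Henkin.

(** * Computable functions *)

Section Computable.
Variable O : nat -> Prop.

(** Programs run on lists of any length, but only inputs of length [k] are specified. The oracle
    stays a parameter, so the same closure lemmas serve computability and Turing reducibility. *)
Definition Comp (k : nat) (F : seq nat -> nat) : Prop :=
  exists p, forall xs, size xs = k -> eval O p xs (F xs).

Lemma Comp_ext k F G : (forall xs, size xs = k -> F xs = G xs) -> Comp k F -> Comp k G.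
Proof. by move=> E [p hp]; exists p => xs h; rewrite -E //; apply: hp. Qed.

Lemma Comp_proj k i : Comp k (fun xs => nth 0 xs i).
Proof. by exists (PProj i) => xs _; constructor. Qed.

Lemma Comp_comp m k F (Gs : seq (seq nat -> nat)) :
  Comp m F -> size Gs = m -> Forall (Comp k) Gs ->
  Comp k (fun xs => F (map (fun G => G xs) Gs)).
Proof.
move=> [p hp] sz hG.
have [ps hps] : exists ps, forall xs, size xs = k ->
    evals O ps xs (map (fun G => G xs) Gs).
  elim: Gs hG {sz} => [|G Gs IH] /=; first by exists [::] => xs _; constructor.
  by move=> [[q hq] /IH[qs hqs]]; exists (q :: qs) => xs h; constructor; auto.
exists (PComp p ps) => xs h; apply: ev_comp; first exact: hps.
by apply: hp; rewrite size_map.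
Qed.

Lemma Comp_app1 k (f : nat -> nat) G :
  Comp 1 (fun xs => f (nth 0 xs 0)) -> Comp k G -> Comp k (fun xs => f (G xs)).
Proof. by move=> hf hG; apply: (Comp_comp (Gs := [:: G]) hf). Qed.

Lemma Comp_app2 k (f : nat -> nat -> nat) G H :
  Comp 2 (fun xs => f (nth 0 xs 0) (nth 0 xs 1)) -> Comp k G -> Comp k H ->
  Comp k (fun xs => f (G xs) (H xs)).
Proof. by move=> hf hG hH; apply: (Comp_comp (Gs := [:: G; H]) hf). Qed.

Lemma Comp_app3 k (f : nat -> nat -> nat -> nat) G H J :
  Comp 3 (fun xs => f (nth 0 xs 0) (nth 0 xs 1) (nth 0 xs 2)) ->
  Comp k G -> Comp k H -> Comp k J -> Comp k (fun xs => f (G xs) (H xs) (J xs)).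
Proof. by move=> hf hG hH hJ; apply: (Comp_comp (Gs := [:: G; H; J]) hf). Qed.

Lemma Comp_S k G : Comp k G -> Comp k (fun xs => (G xs).+1).
Proof. by move=> h; apply: Comp_app1 h; exists PSucc => xs _; constructor. Qed.

Lemma Comp_const k n : Comp k (fun _ => n).
Proof.
elim: n => [|n IH]; last exact: Comp_S.
by exists PZero => xs _; constructor.
Qed.

Lemma Comp_reindex m k F (js : seq nat) :
  Comp m F -> size js = m -> Comp k (fun xs => F (map (nth 0 xs) js)).
Proof.
move=> hF sz.
apply: (@Comp_ext _ (fun xs => F (map (fun G => G xs) (map (fun j xs => nth 0 xs j) js)))).
  by move=> xs _; rewrite -map_comp.
apply: Comp_comp hF _ _; first by rewrite size_map.
by elim: js {sz} => //= j js IH; split=> //; apply: Comp_proj.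
Qed.

Lemma map_nth_from (xs : seq nat) m k : size xs = m + k ->
  map (nth 0 xs) (iota m k) = drop m xs.
Proof.
move=> sz; rewrite -[in RHS](mkseq_nth 0 xs) /mkseq sz -map_drop; congr map.
by rewrite drop_iota add0n addKn.
Qed.

Lemma Comp_rec k F G N : Comp k F -> Comp k.+2 G -> Comp k N ->
  Comp k (fun xs => nat_rect (fun=> nat) (F xs) (fun n r => G (n :: r :: xs)) (N xs)).
Proof.
move=> [pf hf] [pg hg] hN.
(* [PRec] recurs on the head of its input, so the number of rounds [N xs] is put there by
   composition. *)
suff [p hp] : Comp k.+1 (fun ys => nat_rect (fun=> nat) (F (behead ys))
    (fun n r => G (n :: r :: behead ys)) (head 0 ys)).
  have := @Comp_comp k.+1 k _ (N :: map (fun j xs => nth 0 xs j) (iota 0 k))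
    (ex_intro _ p hp).
  rewrite /= size_map size_iota => /(_ erefl) h.
  apply: Comp_ext (h _) => [xs sz|].
    by rewrite -map_comp (map_nth_from (m := 0)) ?drop0.
  split=> //; elim: (iota _ _) => //= j js IH; split=> //; exact: Comp_proj.
exists (PRec pf pg) => -[//|n xs] [sz] /=.
elim: n => [|n IH]; first by constructor; apply: hf.
by apply: ev_recS IH _; apply: hg; rewrite /= sz.
Qed.

Lemma Comp_rec2 (f : nat -> nat) (g : nat -> nat -> nat -> nat) :
  Comp 1 (fun xs => f (nth 0 xs 0)) ->
  Comp 3 (fun xs => g (nth 0 xs 0) (nth 0 xs 1) (nth 0 xs 2)) ->
  Comp 2 (fun xs => nat_rect (fun=> nat) (f (nth 0 xs 1))
                      (fun n r => g n r (nth 0 xs 1)) (nth 0 xs 0)).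
Proof.
move=> hf hg.
apply: (@Comp_rec 2 (fun xs => f (nth 0 xs 1)) (fun ys => g (nth 0 ys 0) (nth 0 ys 1) (nth 0 ys 3))).
- by apply: Comp_app1 hf _; apply: Comp_proj.
- by apply: Comp_app3 hg _ _ _; apply: Comp_proj.
- exact: Comp_proj.
Qed.

Lemma Comp_add k F G : Comp k F -> Comp k G -> Comp k (fun xs => F xs + G xs).
Proof.
apply: Comp_app2.
apply: Comp_ext (Comp_rec2 (f := id) (g := fun _ r _ => r.+1) _ _).
- by move=> xs _; elim: (nth 0 xs 0) => //= n ->.
- exact: Comp_proj.
- by apply: Comp_S; apply: Comp_proj.
Qed.

Lemma Comp_mul k F G : Comp k F -> Comp k G -> Comp k (fun xs => F xs * G xs).
Proof.
apply: Comp_app2.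
apply: Comp_ext (Comp_rec2 (f := fun=> 0) (g := fun _ r y => y + r) _ _).
- by move=> xs _; elim: (nth 0 xs 0) => //= n ->; rewrite mulSn.
- exact: Comp_const.
- by apply: Comp_add; apply: Comp_proj.
Qed.

Lemma Comp_pred k F : Comp k F -> Comp k (fun xs => (F xs).-1).
Proof.
apply: Comp_app1.
apply: Comp_ext (@Comp_rec 1 (fun=> 0) (fun ys => nth 0 ys 0) (fun xs => nth 0 xs 0) _ _ _).
- by move=> xs _; case: (nth 0 xs 0).
- exact: Comp_const.
- exact: Comp_proj.
- exact: Comp_proj.
Qed.

Lemma Comp_sub k F G : Comp k F -> Comp k G -> Comp k (fun xs => F xs - G xs).
Proof.
move=> hF hG.
apply: (@Comp_app2 k (fun x y => y - x) _ _ _ hG hF).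
apply: Comp_ext (Comp_rec2 (f := id) (g := fun _ r _ => r.-1) _ _).
- by move=> xs _; elim: (nth 0 xs 0) => /= [|n ->]; rewrite ?subn0 ?subnS.
- exact: Comp_proj.
- by apply: Comp_pred; apply: Comp_proj.
Qed.

Lemma Comp_cpair k F G : Comp k F -> Comp k G -> Comp k (fun xs => cpair (F xs) (G xs)).
Proof.
(* [T] gives the triangular numbers by recursion, in place of the division in [cpair]. *)
move=> hF hG; pose T n := nat_rect (fun=> nat) 0 (fun n r => r + n.+1) n.
apply: (@Comp_ext _ (fun xs => T (F xs + G xs) + G xs)).
  move=> xs _; have H n : 2 * T n = n * n.+1 by elim: n => //= n; nia.
  by have := cpairE (F xs) (G xs); have := H (F xs + G xs); lia.
apply: Comp_add => //; apply: (@Comp_app1 _ T); last exact: Comp_add.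
apply: (@Comp_rec 1 (fun=> 0) (fun ys => nth 0 ys 1 + (nth 0 ys 0).+1) (fun xs => nth 0 xs 0)).
- exact: Comp_const.
- by apply: Comp_add; [|apply: Comp_S]; apply: Comp_proj.
- exact: Comp_proj.
Qed.

Definition CompB k (P : seq nat -> bool) : Prop := Comp k (fun xs => P xs).

Lemma CompB_neg k P : CompB k P -> CompB k (fun xs => ~~ P xs).
Proof.
move=> h; apply: (@Comp_ext _ (fun xs => 1 - P xs)); first by move=> xs _; case: (P xs).
by apply: Comp_sub h; apply: Comp_const.
Qed.

Lemma CompB_and k P Q : CompB k P -> CompB k Q -> CompB k (fun xs => P xs && Q xs).
Proof.
move=> h1 h2; apply: Comp_ext (Comp_mul h1 h2) => xs _.
by case: (P xs); case: (Q xs).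
Qed.

Lemma CompB_or k P Q : CompB k P -> CompB k Q -> CompB k (fun xs => P xs || Q xs).
Proof.
move=> h1 h2.
apply: Comp_ext (CompB_neg (CompB_and (CompB_neg h1) (CompB_neg h2))) => xs _.
by case: (P xs); case: (Q xs).
Qed.

Lemma CompB_imp k P Q : CompB k P -> CompB k Q -> CompB k (fun xs => P xs ==> Q xs).
Proof.
move=> h1 h2; apply: Comp_ext (CompB_or (CompB_neg h1) h2) => xs _.
by case: (P xs).
Qed.

Lemma CompB_le k F G : Comp k F -> Comp k G -> CompB k (fun xs => F xs <= G xs).
Proof.
move=> h1 h2; apply: (@Comp_ext _ (fun xs => 1 - (F xs - G xs))).
  by move=> xs _; case: leqP; lia.
by apply: Comp_sub; [apply: Comp_const | apply: Comp_sub].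
Qed.

Lemma CompB_eq k F G : Comp k F -> Comp k G -> CompB k (fun xs => F xs == G xs).
Proof.
move=> h1 h2; apply: Comp_ext (CompB_and (CompB_le h1 h2) (CompB_le h2 h1)) => xs _.
by rewrite -eqn_leq.
Qed.

Lemma Comp_if k P F G : CompB k P -> Comp k F -> Comp k G ->
  Comp k (fun xs => if P xs then F xs else G xs).
Proof.
move=> hP hF hG.
apply: Comp_ext (Comp_add (Comp_mul hP hF) (Comp_mul (CompB_neg hP) hG)) => xs _.
by case: (P xs); rewrite ?mul1n ?mul0n ?addn0.
Qed.

Lemma CompB_all k P N : CompB k.+1 P -> Comp k N ->
  CompB k (fun xs => all (fun i => P (i :: xs)) (iota 0 (N xs))).
Proof.
move=> hP hN.
(* The step function sees the index, the accumulated conjunction and then [xs]; the positions 0, 2,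
   3, ... skip the accumulator. *)
apply: Comp_ext (@Comp_rec k (fun=> 1)
  (fun ys => nth 0 ys 1 * P (map (nth 0 ys) (0 :: iota 2 k))) N _ _ hN).
- move=> xs sz; elim: (N xs) => // n IH.
  have -> : iota 0 n.+1 = rcons (iota 0 n) n by rewrite -addn1 iotaD cats1.
  rewrite all_rcons /= IH (map_nth_from (xs := [:: n, _ & xs])) /= ?sz ?drop0 //.
  by case: (all _ _); case: (P _).
- exact: Comp_const.
- apply: Comp_mul; first exact: Comp_proj.
  by apply: Comp_reindex hP _; rewrite /= size_iota.
Qed.

Lemma CompB_has k P N : CompB k.+1 P -> Comp k N ->
  CompB k (fun xs => has (fun i => P (i :: xs)) (iota 0 (N xs))).
Proof.
move=> hP hN; apply: Comp_ext (CompB_neg (CompB_all (CompB_neg hP) hN)) => xs _.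
by rewrite -has_predC /=; congr (nat_of_bool _); apply: eq_has => i /=; rewrite negbK.
Qed.

Lemma Comp_mu k P : CompB k.+1 P ->
  (forall xs, size xs = k -> exists n, P (n :: xs)) ->
  exists2 G, Comp k G & forall xs, size xs = k -> P (G xs :: xs).
Proof.
move=> /CompB_neg[p hp] tot.
(* On lists of other lengths the search may fail; the default 0 merely makes [G] total. [PMu] looks
   for a zero, hence the negation of [P] above. *)
pose G xs := if pselect (exists n, P (n :: xs)) is left h then ex_minn h else 0.
exists G => [|xs sz]; last first.
  by rewrite /G; case: pselect => [h|[]]; [case: ex_minnP | apply: tot].
exists (PMu p) => xs sz; rewrite /G; case: pselect => [h|[]]; last exact: tot.
case: ex_minnP => m Pm min; constructor.
  by have := hp (m :: xs); rewrite /= Pm sz; apply.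
move=> n lt; exists 0; have := hp (n :: xs); rewrite /= sz => /(_ erefl).
by case E: (P _) => //; have := min _ E; lia.
Qed.

Lemma Comp_oracle k F : Comp k F -> CompB k (fun xs => `[< O (F xs) >]).
Proof.
move=> hF; apply: (@Comp_app1 _ (fun x => nat_of_bool `[< O x >])) => //.
exists POrc => xs _; case: (asboolP (O _)) => h; first exact: ev_orc1.
exact: ev_orc0.
Qed.

Lemma Treducible_Comp A : Treducible A O <-> CompB 1 (fun xs => `[< A (nth 0 xs 0) >]).
Proof.
split=> -[p hp]; exists p.
  move=> [|n [|? ?]] // _ /=; have [h1 h2] := hp n.
  by case: asboolP => h; auto.
by move=> n; have := hp [:: n] erefl => /=; case: asboolP => h; split.
Qed.

End Computable.

(* [BAll t a] quantifies over [i <= t]. *)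
Inductive bterm : Type :=
| BV : nat -> bterm
| BC : nat -> bterm
| BAdd : bterm -> bterm -> bterm
| BMul : bterm -> bterm -> bterm.

Inductive bform : Type :=
| BFal : bform
| BEq : bterm -> bterm -> bform
| BLe : bterm -> bterm -> bform
| BImp : bform -> bform -> bform
| BAll : bterm -> bform -> bform.

Fixpoint btev (xs : seq nat) (t : bterm) : nat :=
  match t with
  | BV i => nth 0 xs i
  | BC n => n
  | BAdd t u => btev xs t + btev xs u
  | BMul t u => btev xs t * btev xs u
  end.

Fixpoint bev (xs : seq nat) (a : bform) : bool :=
  match a with
  | BFal => false
  | BEq t u => btev xs t == btev xs u
  | BLe t u => btev xs t <= btev xs u
  | BImp a b => bev xs a ==> bev xs b
  | BAll t a => all (fun i => bev (i :: xs) a) (iota 0 (btev xs t).+1)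
  end.

Lemma Comp_btev O k t : Comp O k (fun xs => btev xs t).
Proof.
elim: t => /= [i|n|t IHt u IHu|t IHt u IHu].
- exact: Comp_proj.
- exact: Comp_const.
- exact: Comp_add.
- exact: Comp_mul.
Qed.

Lemma CompB_bev O a k : CompB O k (fun xs => bev xs a).
Proof.
elim: a k => [|t u|t u|a IHa b IHb|t a IH] k.
- exact: (Comp_const _ _ 0).
- by apply: CompB_eq; apply: Comp_btev.
- by apply: CompB_le; apply: Comp_btev.
- exact: (CompB_imp (IHa k) (IHb k)).
- by apply: (CompB_all (IH k.+1) (N := fun xs => (btev xs t).+1)); apply: Comp_S; apply: Comp_btev.
Qed.

Definition BNeg a := BImp a BFal.
Definition BAnd a b := BNeg (BImp a (BNeg b)).
Definition BOr a b := BImp (BNeg a) b.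
Definition BEx t a := BNeg (BAll t (BNeg a)).
Definition BTru := BNeg BFal.
(** [/=] would break the derived connectives into implications; evaluation goes through the
    rewriting lemmas below instead. *)
Arguments bev : simpl never.

Lemma bev_Fal xs : bev xs BFal = false.
Proof. by []. Qed.

Lemma bev_Eq xs t u : bev xs (BEq t u) = (btev xs t == btev xs u).
Proof. by []. Qed.

Lemma bev_Le xs t u : bev xs (BLe t u) = (btev xs t <= btev xs u).
Proof. by []. Qed.

Lemma bev_Imp xs a b : bev xs (BImp a b) = (bev xs a ==> bev xs b).
Proof. by []. Qed.

Lemma bev_Neg xs a : bev xs (BNeg a) = ~~ bev xs a.
Proof. by rewrite bev_Imp bev_Fal; case: bev. Qed.

Lemma bev_And xs a b : bev xs (BAnd a b) = bev xs a && bev xs b.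
Proof. by rewrite /BAnd bev_Neg bev_Imp bev_Neg; case: bev; case: bev. Qed.

Lemma bev_Or xs a b : bev xs (BOr a b) = bev xs a || bev xs b.
Proof. by rewrite /BOr bev_Imp bev_Neg; case: bev. Qed.

Lemma bev_AllP xs t a :
  reflect (forall i, i <= btev xs t -> bev (i :: xs) a) (bev xs (BAll t a)).
Proof.
apply: (iffP allP) => h i hi; apply: h; move: hi; rewrite mem_iota //.
Qed.

Lemma bev_ExP xs t a :
  reflect (exists2 i, i <= btev xs t & bev (i :: xs) a) (bev xs (BEx t a)).
Proof.
rewrite bev_Neg; apply: (iffP negP) => [h|[i hi h1] /bev_AllP/(_ i hi)]; last first.
  by rewrite bev_Neg h1.
apply: contrapT => h1; apply: h; apply/bev_AllP => i hi; rewrite bev_Neg.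
by apply/negP => h2; apply: h1; exists i.
Qed.

(* Coded finite sets of pairs: [(z, t)] belongs to the set coded by [(a, b)] iff [1 + ((z+t)^2+t+1) a] divides [b]. *)
Definition pcode (z t : nat) : nat := (z + t) * (z + t) + t.

Definition inset (a b u : nat) : bool := (u.+1 * a).+1 %| b.

(** The value lies between the squares of z + t and z + t + 1, which determines first the sum and
    then t. *)
Lemma pcode_inj z t z' t' : pcode z t = pcode z' t' -> z = z' /\ t = t'.
Proof.
rewrite /pcode => E; have : z + t = z' + t' by nia.
by nia.
Qed.

(** With a = (N + 1)!, the moduli for u <= N are pairwise coprime, and b is the product of those
    with u in the list. Since a > 0 and u is shifted by one, every modulus exceeds 1, so the empty
    product 1 codes the empty set. *)
Lemma inset_exists (l : seq nat) N : (forall u, u \in l -> u <= N) ->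
  exists a b, forall u, u <= N -> inset a b u = (u \in l).
Proof.
move=> bnd; pose a := N.+1`!.
have cop u v : u <= N -> v <= N -> u != v -> coprime (u.+1 * a).+1 (v.+1 * a).+1.
  wlog lt : u v / u < v => [H hu hv ne|hu hv _].
    have [h|h|h] := ltngtP u v; [exact: H | by rewrite coprime_sym; apply: H; rewrite // eq_sym|].
    by rewrite h eqxx in ne.
  apply: contraT => /negP nc.
  have g1 : 1 < gcdn (u.+1 * a).+1 (v.+1 * a).+1.
    by rewrite ltn_neqAle gcdn_gt0 andbT eq_sym; apply/negP.
  (* A common prime p cannot divide a, but divides the difference (v - u) * a. Then p <= v - u <= N,
     so p divides (N + 1)! = a after all. *)
  have := prime.pdiv_prime g1; set p := prime.pdiv _ => pp.
  have := prime.pdiv_dvd (gcdn (u.+1 * a).+1 (v.+1 * a).+1); rewrite -/p dvdn_gcd => /andP[d1 d2].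
  have na : ~~ (p %| a).
    apply/negP => da; have := dvdn_sub d1 (dvdn_mull u.+1 da).
    by rewrite subSnn dvdn1 => /eqP E; rewrite E in pp.
  have : p %| (v - u) * a.
    have -> : (v - u) * a = (v.+1 * a).+1 - (u.+1 * a).+1 by rewrite subSS -mulnBl subSS.
    exact: dvdn_sub.
  rewrite prime.Euclid_dvdM // (negbTE na) orbF => h.
  move: na; rewrite /a dvdn_fact //; apply/andP; split; first exact: prime.prime_gt0.
  by apply: leq_trans (dvdn_leq _ h) _; lia.
exists a, (foldr (fun u b => (u.+1 * a).+1 * b) 1 l) => u hu; rewrite /inset.
have ag : 0 < a by rewrite fact_gt0.
elim: l bnd => [|v l IH] bnd /=.
  by rewrite in_nil dvdn1 eqSS muln_eq0 /=; lia.
have {}IH := IH (fun w hw => bnd w (mem_behead (s := v :: l) hw)).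
rewrite in_cons; have [->|ne] := eqVneq u v; first by rewrite dvdn_mulr.
by rewrite Gauss_dvdr // cop // bnd // in_cons eqxx.
Qed.

(** * Horn systems *)

Inductive pat : Type :=
| PatV : nat -> pat
| PatC : nat -> pat
| PatS : pat -> pat
| PatP : pat -> pat -> pat.

Fixpoint peval (e : seq nat) (p : pat) : nat :=
  match p with
  | PatV i => nth 0 e i
  | PatC n => n
  | PatS p => (peval e p).+1
  | PatP p q => cpair (peval e p) (peval e q)
  end.

Fixpoint pbound (m : nat) (p : pat) : bool :=
  match p with
  | PatV i => i < m
  | PatC _ => true
  | PatS p => pbound m p
  | PatP p q => pbound m p && pbound m q
  end.

Definition clause : Type := pat * seq pat.

(** All clauses share the number m of variables, so a single block of m bounded quantifiers serves
    each of them. *)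
Inductive horn (P : seq clause) (m : nat) : nat -> Prop :=
| horn_intro c e : List.In c P -> size e = m ->
    (forall b, List.In b c.2 -> horn P m (peval e b)) -> horn P m (peval e c.1).

(* [patF d p v] says that [p] evaluates to variable [v], the environment of [p] starting at variable [d]. *)
Fixpoint patF (d : nat) (p : pat) (v : nat) : bform :=
  match p with
  | PatV i => BEq (BV (d + i)) (BV v)
  | PatC n => BEq (BC n) (BV v)
  | PatS p => BEx (BV v) (BAnd (BEq (BAdd (BV 0) (BC 1)) (BV v.+1)) (patF d.+1 p 0))
  | PatP p q => BEx (BV v) (BEx (BV v.+1) (BAnd
      (BEq (BMul (BC 2) (BV v.+2))
           (BAdd (BMul (BAdd (BV 1) (BV 0)) (BAdd (BAdd (BV 1) (BV 0)) (BC 1)))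
                 (BMul (BC 2) (BV 0))))
      (BAnd (patF d.+2 p 1) (patF d.+2 q 0))))
  end.

(** The quantifiers in [patF] may be bounded by the value, because predecessors and components of
    pairs never exceed it. *)
Lemma patFP p e ys xs v : pbound (size e) p ->
  bev (ys ++ e ++ xs) (patF (size ys) p v) = (peval e p == nth 0 (ys ++ e ++ xs) v).
Proof.
elim: p ys v => [i|n|p IH|p IHp q IHq] ys v.
- move=> /= h; rewrite bev_Eq /= nth_cat ltnNge leq_addr /= addKn.
  by rewrite nth_cat h.
- by [].
- move=> h; have {}IH u := IH (u :: ys) 0 h.
  rewrite [patF _ _ _]/=; apply/bev_ExP/eqP => [[i hi]|E].
    by rewrite bev_And (IH i) bev_Eq /= => /andP[/eqP<- /eqP<-]; rewrite addn1.
  exists (peval e p); first by rewrite /= -E.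
  by rewrite bev_And (IH (peval e p)) bev_Eq /= eqxx andbT -E addn1.
- move=> /= /andP[h1 h2]; have {}IHp u w := IHp (u :: w :: ys) 1 h1.
  have {}IHq u w := IHq (u :: w :: ys) 0 h2.
  apply/bev_ExP/eqP => [[i hi /bev_ExP[j hj]]|E].
    rewrite !bev_And (IHp j i) (IHq j i) bev_Eq /= => /andP[/eqP E /andP[/eqP-> /eqP->]].
    by have := cpairE i j; lia.
  exists (peval e p); first by rewrite /= -E /= cpair_gel.
  apply/bev_ExP; exists (peval e q); first by rewrite /= -E /= cpair_ger.
  rewrite !bev_And (IHp (peval e q) (peval e p)) (IHq (peval e q) (peval e p)) bev_Eq /=.
  by rewrite !eqxx !andbT -E /=; have := cpairE (peval e p) (peval e q); lia.
Qed.

Fixpoint BExs (n j : nat) (a : bform) : bform :=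
  if n is n'.+1 then BEx (BV j) (BExs n' j.+1 a) else a.

Lemma bev_Exs n j a xs :
  bev xs (BExs n j a) <->
  exists e, [/\ size e = n, all (fun i => i <= nth 0 xs j) e & bev (e ++ xs) a].
Proof.
elim: n j xs => [|n IH] j xs; first by split=> [h|[[|i e] [] //]]; exists [::].
split=> [/bev_ExP[i hi /IH[e [sz he h]]]|[e [sz he h]]].
  exists (rcons e i); rewrite size_rcons sz all_rcons hi cat_rcons; split=> //.
case/lastP: e sz he h => [//|e i]; rewrite size_rcons all_rcons cat_rcons.
move=> [sz] /andP[hi he] h; apply/bev_ExP; exists i => //.
by apply/IH; exists e.
Qed.

Definition inF (a b z t : nat) : bform :=
  let u := BAdd (BMul (BAdd (BV z.+1) (BV t.+1)) (BAdd (BV z.+1) (BV t.+1))) (BV t.+1) in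
  BEx (BV b) (BEq (BMul (BV 0) (BAdd (BMul (BAdd u (BC 1)) (BV a.+1)) (BC 1))) (BV b.+1)).

Lemma inFP a b z t xs : bev xs (inF a b z t) =
  inset (nth 0 xs a) (nth 0 xs b) (pcode (nth 0 xs z) (nth 0 xs t)).
Proof.
apply/bev_ExP/dvdnP => [[i _]|[q E]].
  by rewrite bev_Eq /= => /eqP<-; exists i; rewrite /pcode !addn1.
have [b0|bpos] := posnP (nth 0 xs b).
  by exists 0 => //; rewrite bev_Eq /= b0 mul0n.
by exists q; rewrite ?bev_Eq /= E /pcode ?addn1 // leq_pmulr.
Qed.

Section HornFormula.
Variables (P : seq clause) (m : nat).
Hypothesis Pbound : all (fun c => pbound m c.1 && all (pbound m) c.2) P.

(* Read in an environment [e ++ [:: t, z, _, N, b, a & _]]: values of the clause variables, time,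
   number derived at that time, bound, code of the set of derived pairs. *)
Definition bodyF (b : pat) : bform :=
  BEx (BV (m + 3)) (BEx (BV (m + 0).+1) (BAnd (BLe (BAdd (BV 0) (BC 1)) (BV (m + 0).+2))
    (BAnd (patF 2 b 1) (inF (m + 5).+2 (m + 4).+2 1 0)))).

Definition clauseF (c : clause) : bform :=
  BExs m 3 (BAnd (patF 0 c.1 (m + 1)) (foldr (fun b => BAnd (bodyF b)) BTru c.2)).

(** In an environment [[:: x, w & _]] the number w bounds the code of a derivation of x.
    Derivability is the projection along w, and w may be enlarged freely. *)
Definition theta : bform :=
  BEx (BV 1) (BEx (BV 2) (BEx (BV 3) (BEx (BV 0)
    (BAnd (BLe (BV 4) (BV 1)) (BAnd (inF 3 2 4 0)
      (BAll (BV 1) (BAll (BV 2) (BImp (inF 5 4 1 0)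
         (foldr (fun c => BOr (clauseF c)) BFal P))))))))).

Lemma bev_bigAnd T (f : T -> bform) l xs :
  bev xs (foldr (fun x => BAnd (f x)) BTru l) <-> (forall x, List.In x l -> bev xs (f x)).
Proof.
elim: l => [|y l IH] /=; first by split.
rewrite -/(BAnd _ _) bev_And; split=> [/andP[h /IH h2] x [<- //|]|h]; first exact: h2.
by apply/andP; split; [apply: h; left | apply/IH => x hx; apply: h; right].
Qed.

Lemma bev_bigOr T (f : T -> bform) l xs :
  bev xs (foldr (fun x => BOr (f x)) BFal l) <-> (exists2 x, List.In x l & bev xs (f x)).
Proof.
elim: l => [|y l IH] /=; first by split=> [|[]].
rewrite -/(BOr _ _) bev_Or; split=> [/orP[h|/IH[x hx h]]|[x [->|hx] h]].
- by exists y => //; left.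
- by exists x => //; right.
- by rewrite h.
- by apply/orP; right; apply/IH; exists x.
Qed.

(* One step of a derivation, where [S z t] means that z was derived at time t. *)
Definition justified (S : nat -> nat -> Prop) (N z t : nat) : Prop :=
  exists c e, [/\ List.In c P, size e = m, all (fun i => i <= N) e, peval e c.1 = z &
    forall b, List.In b c.2 -> exists2 t', t' < t & peval e b <= N /\ S (peval e b) t'].

Lemma nth_shift (e xs : seq nat) k : size e = m -> nth 0 (e ++ xs) (m + k) = nth 0 xs k.
Proof. by move=> <-; rewrite nth_cat ltnNge leq_addr /= addKn. Qed.

Lemma bodyFP e t z u N b a xs p : size e = m -> pbound m p ->
  bev (e ++ [:: t, z, u, N, b, a & xs]) (bodyF p) <->
  exists2 t', t' < t & peval e p <= N /\ inset a b (pcode (peval e p) t').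
Proof.
move=> sz hp; set ctx := e ++ _.
have E y t' : bev [:: t', y & ctx] (BAnd (BLe (BAdd (BV 0) (BC 1)) (BV (m + 0).+2))
    (BAnd (patF 2 p 1) (inF (m + 5).+2 (m + 4).+2 1 0))) =
    [&& t' < t, peval e p == y & inset a b (pcode y t')].
  rewrite !bev_And bev_Le inFP (@patFP p e [:: t'; y] _ 1) ?sz //= !nth_shift //=.
  by rewrite addn1.
split=> [/bev_ExP[y hy /bev_ExP[t' ht]]|[t' lt [le h]]].
  rewrite E => /and3P[lt /eqP-> h]; exists t' => //; split=> //.
  by move: hy; rewrite /= nth_shift.
apply/bev_ExP; exists (peval e p); first by rewrite /= nth_shift.
apply/bev_ExP; exists t'; first by rewrite /= nth_shift // ltnW.
by rewrite E lt eqxx.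
Qed.

Lemma clausesFP t z u N b a xs :
  bev [:: t, z, u, N, b, a & xs] (foldr (fun c => BOr (clauseF c)) BFal P) <->
  justified (fun z t => inset a b (pcode z t)) N z t.
Proof.
have bnd c : List.In c P -> pbound m c.1 /\ forall b, List.In b c.2 -> pbound m b.
  elim: P Pbound => //= c0 P' IH /andP[/andP[h1 h2] h3] [<-|]; last exact: IH.
  split=> //; elim: c0.2 h2 => //= b0 bs IH' /andP[h4 h5] b' [<-//|]; exact: IH'.
have head c e : List.In c P -> size e = m ->
    bev (e ++ [:: t, z, u, N, b, a & xs]) (patF 0 c.1 (m + 1)) = (peval e c.1 == z).
  move=> /bnd[b1 _] sz; have := @patFP c.1 e [::] [:: t, z, u, N, b, a & xs] (m + 1).
  by rewrite sz => -> //=; rewrite nth_shift.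
rewrite bev_bigOr; split=> [[c hc /bev_Exs[e [sz he]]]|[c [e [hc sz he Ez hb]]]].
  rewrite bev_And (head c) // => /andP[/eqP Ez /bev_bigAnd h].
  exists c, e; split=> // b' hb'; have [_ b2] := bnd c hc.
  by apply/(bodyFP _ _ _ _ _ _ _ sz (b2 _ hb')); apply: h.
exists c => //; apply/bev_Exs; exists e; split=> //.
rewrite bev_And (head c) // Ez eqxx /=; apply/bev_bigAnd => b' hb'.
have [_ b2] := bnd c hc.
by apply/(bodyFP _ _ _ _ _ _ _ sz (b2 _ hb')); apply: hb.
Qed.

Lemma thetaP x w xs : bev [:: x, w & xs] theta <-> exists a b N t,
  [/\ a <= w, b <= w, N <= w, t <= N & [/\ x <= N, inset a b (pcode x t) &
   forall z t', z <= N -> t' <= N -> inset a b (pcode z t') ->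
     justified (fun z t => inset a b (pcode z t)) N z t']].
Proof.
split=> [/bev_ExP[a ha /bev_ExP[b hb /bev_ExP[N hN /bev_ExP[t ht]]]]|].
  rewrite !bev_And inFP bev_Le => /and3P[/= hx hi /bev_AllP h].
  exists a, b, N, t; split=> //; split=> // z t' hz ht'.
  have /bev_AllP/(_ t' ht') := h z hz.
  by rewrite bev_Imp inFP /= => /implyP h2 /h2 /clausesFP.
move=> [a [b [N [t [ha hb hN ht [hx hi h]]]]]].
apply/bev_ExP; exists a => //; apply/bev_ExP; exists b => //.
apply/bev_ExP; exists N => //; apply/bev_ExP; exists t => //.
rewrite !bev_And inFP bev_Le /= hx hi /=.
apply/bev_AllP => z hz; apply/bev_AllP => t' ht'.
by rewrite bev_Imp inFP /=; apply/implyP => /(h _ _ hz ht') /clausesFP; apply.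
Qed.

(** Induction on the time: premises carry earlier times than their conclusion, so facts cannot
    justify one another in a circle. *)
Lemma theta_sound x w xs : bev [:: x, w & xs] theta -> horn P m x.
Proof.
move=> /thetaP[a [b [N [t [_ _ _ ht [hx hi h]]]]]].
elim/ltn_ind: t x ht hx hi => t IH x ht hx /(h _ _ hx ht).
move=> [c [e [hc sz he <- hb]]]; apply: horn_intro => // b' /hb[t' lt [le hin]].
by apply: (IH _ lt _ _ le hin); apply: leq_trans ht; apply: ltnW.
Qed.

Definition derivation (F : seq (nat * nat)) (N : nat) : Prop :=
  forall z t, (z, t) \in F ->
    [/\ z <= N, t <= N & justified (fun z t => (z, t) \in F) N z t].

Lemma justified_mono (S S' : nat -> nat -> Prop) N N' z t :
  (forall z t, S z t -> S' z t) -> N <= N' -> justified S N z t -> justified S' N' z t.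
Proof.
move=> hS hN [c [e [hc sz he hz hb]]]; exists c, e; split=> //.
  by apply: sub_all he => i h; apply: leq_trans h hN.
move=> b /hb[t' lt [le h]]; exists t' => //; split; last exact: hS.
exact: leq_trans le hN.
Qed.

Lemma derivation_cat F N F' N' : derivation F N -> derivation F' N' ->
  derivation (F ++ F') (maxn N N').
Proof.
move=> h h' z t; rewrite mem_cat => /orP[/h|/h'] [h1 h2 h3].
all: split; try by rewrite leq_max ?h1 ?h2 ?orbT.
all: apply: justified_mono h3; rewrite ?leq_maxl ?leq_maxr // => z' t'.
all: by rewrite mem_cat => ->; rewrite ?orbT.
Qed.

Lemma horn_derivation x : horn P m x -> exists F N t, derivation F N /\ (x, t) \in F.
Proof.
elim=> c e hc sz _ IH.
(* [T] exceeds the times of all premises and becomes the time of the conclusion; the derivations of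
   the premises are simply concatenated. *)
have [F [N [T [hF hb]]]] : exists F N T, derivation F N /\
    forall b, List.In b c.2 -> exists2 t, t < T & (peval e b, t) \in F.
  elim: c.2 IH => [|b bs IH2] IH; first by exists [::], 0, 0.
  have [F [N [T [hF hb]]]] := IH2 (fun b' h => IH b' (or_intror h)).
  have [F' [N' [t [hF' hb']]]] := IH b (or_introl erefl).
  exists (F ++ F'), (maxn N N'), (maxn T t.+1); split; first exact: derivation_cat.
  move=> b0 [<-|/hb[t0 lt h]].
    by exists t; rewrite ?leq_max ?ltnSn ?orbT // mem_cat hb' orbT.
  by exists t0; rewrite ?leq_max ?lt // mem_cat h.
pose M := \max_(i <- peval e c.1 :: T :: e) i.
have leM i : i \in peval e c.1 :: T :: e -> i <= M.
  by move=> h; apply: (leq_bigmax_seq (F := id)).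
exists ((peval e c.1, T) :: F), (maxn N M), T; split; last by rewrite in_cons eqxx.
have sub z t : (z, t) \in F -> (z, t) \in (peval e c.1, T) :: F.
  by rewrite in_cons => ->; rewrite orbT.
move=> z t; rewrite in_cons => /orP[/eqP[-> ->]|/[dup] hzt /hF[h1 h2 h3]].
  split; try by rewrite leq_max leM ?orbT // !in_cons eqxx ?orbT.
  exists c, e; split=> //.
    apply/allP => i hi; rewrite leq_max leM ?orbT // !in_cons hi !orbT //.
  move=> b /hb[t' lt h]; exists t' => //; split; last exact: sub.
  by have [h1 _ _] := hF _ _ h; rewrite leq_max h1.
split; try by rewrite leq_max ?h1 ?h2.
by apply: justified_mono h3; rewrite ?leq_maxl.
Qed.

Lemma theta_complete x : horn P m x ->
  exists w0, forall w xs, w0 <= w -> bev [:: x, w & xs] theta.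
Proof.
move=> /horn_derivation[F [N [T [hF hx]]]].
(* The code a, b is controlled up to [pcode N N] only. This covers all pairs with entries up to N,
   and [theta] inspects no others. *)
have bnd u : u \in map (fun zt => pcode zt.1 zt.2) F -> u <= pcode N N.
  move=> /mapP[[z t] /hF[h1 h2 _] ->] /=; rewrite /pcode.
  by apply: leq_add => //; apply: leq_mul; apply: leq_add.
have [a [b hab]] := inset_exists bnd.
have hin z t : z <= N -> t <= N -> inset a b (pcode z t) = ((z, t) \in F).
  move=> hz ht; rewrite hab; last first.
    by rewrite /pcode; apply: leq_add => //; apply: leq_mul; apply: leq_add.
  apply/mapP/idP => [[[z' t'] h /pcode_inj[-> ->]] //|h]; by exists (z, t).
have hF' z t : (z, t) \in F -> inset a b (pcode z t).
  by move=> /[dup] h /hF[h1 h2 _]; rewrite hin.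
exists (maxn a (maxn b N)) => w xs; rewrite !geq_max => /and3P[ha hb hN].
have [hx1 hx2 _] := hF _ _ hx.
apply/thetaP; exists a, b, N, T; split=> //; split=> //; first exact: hF'.
move=> z t hz ht; rewrite hin // => /hF[_ _]; apply: justified_mono => //.
Qed.

End HornFormula.

(** * A Horn system for evaluation, substitution and provability *)

Definition atom : Type := nat * seq pat.

Definition plist (ps : seq pat) : pat := foldr (fun p c => PatS (PatP p c)) (PatC 0) ps.
Definition patom (a : atom) : pat := PatP (PatC a.1) (plist a.2).
Definition fact (r : nat) (l : seq nat) : nat := cpair r (code_list l).

Lemma peval_patom e a : peval e (patom a) = fact a.1 (map (peval e) a.2).
Proof. by rewrite /= /fact; congr cpair; elim: a.2 => //= p ps ->. Qed.

Lemma fact_inj r l r' l' : fact r l = fact r' l' -> r = r' /\ l = l'.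
Proof. by move=> /cpair_inj[-> /code_list_inj->]. Qed.

Definition compile (rs : seq (atom * seq atom)) : seq clause :=
  map (fun c => (patom c.1, map patom c.2)) rs.

Lemma horn_sound rs m (J : nat -> seq nat -> Prop) :
  Forall (fun c : atom * seq atom => forall e, size e = m ->
    Forall (fun b : atom => J b.1 (map (peval e) b.2)) c.2 -> J c.1.1 (map (peval e) c.1.2)) rs ->
  forall r l, horn (compile rs) m (fact r l) -> J r l.
Proof.
move=> ok r l; move Ex: (fact r l) => x h; move/esym: Ex => Ex.
elim: h r l Ex => {x} c e hc sz _ IH r l; case: c hc IH => ch cb hc IH.
have [c' hc' [E1 E2]] : exists2 c', List.In c' rs & patom c'.1 = ch /\ map patom c'.2 = cb.
  elim: rs hc {ok IH} => //= c1 rs IH [[<- <-]|/IH[c' h1 h2]]; first by exists c1; [left|].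
  by exists c' => //; right.
move=> /=; rewrite -E1 peval_patom => /fact_inj[<- <-].
have okc : forall e, size e = m -> Forall (fun b : atom => J b.1 (map (peval e) b.2)) c'.2 ->
    J c'.1.1 (map (peval e) c'.1.2).
  by elim: rs ok hc' {hc IH} => //= c1 rs IH [h1 h2] [<- //|]; apply: IH.
apply: okc => //; move: IH => /=; rewrite -E2; elim: c'.2 => //= b bs IHb IH; split.
  by apply: (IH (patom b)); [left | rewrite peval_patom].
by apply: IHb => b' hb'; apply: IH; right.
Qed.

(** Every clause formally has m variables; those beyond the given values [e] are set to 0. *)
Lemma horn_rule rs m k e : k < size rs -> size e <= m ->
  let c := nth ((0, [::]), [::]) rs k in let e' := e ++ nseq (m - size e) 0 in
  Forall (fun b : atom => horn (compile rs) m (fact b.1 (map (peval e') b.2))) c.2 ->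
  horn (compile rs) m (fact c.1.1 (map (peval e') c.1.2)).
Proof.
move=> lt le c e' h; rewrite -peval_patom.
apply: (@horn_intro _ _ (patom c.1, map patom c.2) e').
- rewrite /c; elim: rs k lt {c h} => // c0 rs IH [|k] lt; first by left.
  by right; apply: IH.
- by rewrite /e' size_cat size_nseq subnKC.
- move=> b /=; elim: c.2 h => //= b0 bs IH [h1 h2] [<-|]; last exact: IH.
  by rewrite peval_patom.
Qed.

Section Rules.
Local Notation x0 := (PatV 0). Local Notation x1 := (PatV 1). Local Notation x2 := (PatV 2).
Local Notation x3 := (PatV 3). Local Notation x4 := (PatV 4). Local Notation x5 := (PatV 5).
Local Notation x6 := (PatV 6). Local Notation x7 := (PatV 7). Local Notation x8 := (PatV 8).
Local Notation C := PatC.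
Local Notation S' := PatS.
Local Notation P := PatP.
Let cons x l := S' (P x l).
Let Feq s t := S' (P (C 0) (P s t)).
Let Frel r l := S' (P (C 1) (P r l)).
Let Fimp a b := S' (P (C 2) (P a b)).
Let Fall a := S' (P (C 3) a).
Let Fneg a := Fimp a (C 0).

Local Notation Lt i j := (0, [:: i; j]).
Local Notation Nth l i v := (1, [:: l; i; v]).
Local Notation Ev p xs v := (2, [:: p; xs; v]).
Local Notation Evs ps xs vs := (3, [:: ps; xs; vs]).
Local Notation Pos p xs n := (4, [:: p; xs; n]).
Local Notation SubV m d u n t := (5, [:: m; d; u; n; t]).
Local Notation SubT m d u s t := (6, [:: m; d; u; s; t]).
Local Notation SubTs m d u s t := (7, [:: m; d; u; s; t]).
Local Notation SubF m d u a b := (8, [:: m; d; u; a; b]).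
Local Notation Prov p a := (9, [:: p; a]).
Local Notation Frm d a := (10, [:: d; a]).
Local Notation NFrm d a := (11, [:: d; a]).
Local Notation NVar d t := (12, [:: d; t]).
(** A number codes a term or a formula exactly when lifting it succeeds, so being well formed needs
    no rules of its own. *)
Local Notation IsT t w := (SubT (C 0) (C 0) (C 0) t w).
Local Notation IsF a w := (SubF (C 0) (C 0) (C 0) a w).
Local Notation "h :- b" := (@pair atom (seq atom) h b) (at level 90).

Definition lt_rules : seq (atom * seq atom) := [::
  Lt (C 0) (S' x0) :- [::];
  Lt (S' x0) (S' x1) :- [:: Lt x0 x1]].

(** The oracle is empty, so [POrc] returns 0. [Pos p xs n] records that p takes positive values at
    all arguments below n, as minimization demands. *)
Definition eval_rules : seq (atom * seq atom) := [::
  Nth (C 0) x0 (C 0) :- [::];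
  Nth (cons x0 x1) (C 0) x0 :- [::];
  Nth (cons x0 x1) (S' x2) x3 :- [:: Nth x1 x2 x3];
  Ev (P (C 0) (C 0)) x0 (C 0) :- [::];
  Ev (P (C 1) (C 0)) x0 (S' x1) :- [:: Nth x0 (C 0) x1];
  Ev (P (C 2) x0) x1 x2 :- [:: Nth x1 x0 x2];
  Ev (P (C 3) (C 0)) x0 (C 0) :- [::];
  Ev (P (C 4) (P x0 x1)) x2 x3 :- [:: Evs x1 x2 x4; Ev x0 x4 x3];
  Ev (P (C 5) (P x0 x1)) (cons (C 0) x2) x3 :- [:: Ev x0 x2 x3];
  Ev (P (C 5) (P x0 x1)) (cons (S' x4) x2) x3 :-
    [:: Ev (P (C 5) (P x0 x1)) (cons x4 x2) x5; Ev x1 (cons x4 (cons x5 x2)) x3];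
  Ev (P (C 6) x0) x1 x2 :- [:: Ev x0 (cons x2 x1) (C 0); Pos x0 x1 x2];
  Evs (C 0) x0 (C 0) :- [::];
  Evs (cons x0 x1) x2 (cons x3 x4) :- [:: Ev x0 x2 x3; Evs x1 x2 x4];
  Pos x0 x1 (C 0) :- [::];
  Pos x0 x1 (S' x2) :- [:: Pos x0 x1 x2; Ev x0 (cons x2 x1) (S' x3)]].

(** Horn clauses have no negation, so the case distinctions for variables are made by [Lt] in both
    directions. *)
Definition subst_rules : seq (atom * seq atom) := [::
  SubV (C 0) x0 x1 x2 (P (C 0) x2) :- [:: Lt x2 x0];
  SubV (C 0) x0 x1 x2 (P (C 0) (S' x2)) :- [:: Lt x0 (S' x2)];
  SubV (C 1) x0 x1 x2 (P (C 0) x2) :- [:: Lt x2 x0];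
  SubV (C 1) x0 x1 x0 x1 :- [::];
  SubV (C 1) x0 x1 (S' x2) (P (C 0) x2) :- [:: Lt x0 (S' x2)];
  SubT x0 x1 x2 (P (C 0) x3) x4 :- [:: SubV x0 x1 x2 x3 x4];
  SubT x0 x1 x2 (P (C 1) (P x3 x4)) (P (C 1) (P x3 x5)) :- [:: SubTs x0 x1 x2 x4 x5];
  SubTs x0 x1 x2 (C 0) (C 0) :- [::];
  SubTs x0 x1 x2 (cons x3 x4) (cons x5 x6) :- [:: SubT x0 x1 x2 x3 x5; SubTs x0 x1 x2 x4 x6];
  SubF x0 x1 x2 (C 0) (C 0) :- [::];
  SubF x0 x1 x2 (Feq x3 x4) (Feq x5 x6) :- [:: SubT x0 x1 x2 x3 x5; SubT x0 x1 x2 x4 x6];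
  SubF x0 x1 x2 (Frel x3 x4) (Frel x3 x5) :- [:: SubTs x0 x1 x2 x4 x5];
  SubF x0 x1 x2 (Fimp x3 x4) (Fimp x5 x6) :- [:: SubF x0 x1 x2 x3 x5; SubF x0 x1 x2 x4 x6];
  SubF x0 x1 x2 (Fall x3) (Fall x4) :- [:: IsT x2 x5; SubF x0 (S' x1) x5 x3 x4]].

(** The first argument codes a program that accepts the axioms with value 1, so one system covers
    all decidable sets of axioms. *)
Definition prov_rules : seq (atom * seq atom) := [::
  Prov x0 x1 :- [:: Ev x0 (cons x1 (C 0)) (C 1)];
  Prov x0 (Fimp x1 (Fimp x2 x1)) :- [:: IsF x1 x3; IsF x2 x4];
  Prov x0 (Fimp (Fimp x1 (Fimp x2 x3)) (Fimp (Fimp x1 x2) (Fimp x1 x3))) :-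
    [:: IsF x1 x4; IsF x2 x5; IsF x3 x6];
  Prov x0 (Fimp (Fneg (Fneg x1)) x1) :- [:: IsF x1 x2];
  Prov x0 (Fimp (Fall x1) x2) :- [:: SubF (C 1) (C 0) x3 x1 x2; IsT x3 x4];
  Prov x0 (Fimp (Fall (Fimp x1 x2)) (Fimp x3 (Fall x2))) :- [:: IsF x3 x1; IsF x2 x4];
  Prov x0 (Feq x1 x1) :- [:: IsT x1 x2];
  Prov x0 (Fimp (Feq x1 x2) (Fimp x3 x4)) :-
    [:: SubF (C 1) (C 0) x1 x5 x3; SubF (C 1) (C 0) x2 x5 x4; IsT x1 x6; IsT x2 x7];
  Prov x0 x1 :- [:: Prov x0 (Fimp x2 x1); Prov x0 x2];
  Prov x0 (Fall x1) :- [:: Prov x0 x1]].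

(** [Frm] and [NFrm] enumerate complementary sets: derivable facts can only be enumerated, and
    deciding whether a number codes a formula takes both enumerations. *)
Definition form_rules : seq (atom * seq atom) := [::
  Frm x0 (C 0) :- [::];
  Frm x0 (Feq (P (C 0) x1) (P (C 0) x2)) :- [:: Lt x1 x0; Lt x2 x0];
  Frm x0 (Frel (C 0) (cons (P (C 0) x1) (cons (P (C 0) x2) (C 0)))) :- [:: Lt x1 x0; Lt x2 x0];
  Frm x0 (Fimp x1 x2) :- [:: Frm x0 x1; Frm x0 x2];
  Frm x0 (Fall x1) :- [:: Frm (S' x0) x1];
  NVar x0 (P (C 0) x1) :- [:: Lt x0 (S' x1)];
  NVar x0 (P (S' x1) x2) :- [::];
  NFrm x0 (Feq x1 x2) :- [:: NVar x0 x1];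
  NFrm x0 (Feq x1 x2) :- [:: NVar x0 x2];
  NFrm x0 (Frel (S' x1) x2) :- [::];
  NFrm x0 (Frel x1 (C 0)) :- [::];
  NFrm x0 (Frel x1 (cons x2 (C 0))) :- [::];
  NFrm x0 (Frel x1 (cons x2 (cons x3 (S' x4)))) :- [::];
  NFrm x0 (Frel x1 (cons x2 x3)) :- [:: NVar x0 x2];
  NFrm x0 (Frel x1 (cons x2 (cons x3 x4))) :- [:: NVar x0 x3];
  NFrm x0 (Fimp x1 x2) :- [:: NFrm x0 x1];
  NFrm x0 (Fimp x1 x2) :- [:: NFrm x0 x2];
  NFrm x0 (Fall x1) :- [:: NFrm (S' x0) x1];
  NFrm x0 (S' (P (S' (S' (S' (S' x1)))) x2)) :- [::]].

Definition rules := lt_rules ++ eval_rules ++ subst_rules ++ prov_rules ++ form_rules.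

End Rules.

(** 8 is the largest number of variables in a rule, reached by Leibniz's law. *)
Definition H (r : nat) (l : seq nat) : Prop := horn (compile rules) 8 (fact r l).

Definition Theta : bform := theta (compile rules) 8.

Lemma Theta_sound r l w xs : bev [:: fact r l, w & xs] Theta -> H r l.
Proof. exact: theta_sound. Qed.

Lemma Theta_complete r l : H r l ->
  exists w0, forall w xs, w0 <= w -> bev [:: fact r l, w & xs] Theta.
Proof. exact: theta_complete. Qed.

Lemma rule k e : k < size rules -> size e <= 8 ->
  let c := nth ((0, [::]), [::]) rules k in let e' := e ++ nseq (8 - size e) 0 in
  Forall (fun b : atom => H b.1 (map (peval e') b.2)) c.2 ->
  H c.1.1 (map (peval e') c.1.2).
Proof. exact: horn_rule. Qed.

(** * Soundness of the rules *)

Definition LE : lang := Lang (fun _ _ => false) (fun r k => (r == 0) && (k == 2)).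

Definition dl (n : nat) : seq nat := epsilon (inhabits [::]) (fun l => code_list l = n).

Lemma dlK n : code_list (dl n) = n.
Proof. exact: (epsilon_spec _ (fun l => code_list l = n) (code_list_surj n)). Qed.

Lemma dl_code l : dl (code_list l) = l.
Proof. by apply: code_list_inj; rewrite dlK. Qed.

Lemma dl_cons x l : dl (cpair x l).+1 = x :: dl l.
Proof. by apply: code_list_inj; rewrite dlK /= dlK. Qed.

Lemma dl0 : dl 0 = [::].
Proof. exact: (dl_code [::]). Qed.

(* [sub 0 d u] lifts the variables from [d] on; [sub 1 d u] substitutes [u] for variable [d]. *)
Definition sub (m d : nat) (u : term) (n : nat) : term :=
  if n < d then Var n else
  if m is 0 then Var n.+1 else if n == d then u else Var n.-1.

(** Below a quantifier the threshold d grows by one and u is lifted: this is the rule for [Fall]. *)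
Lemma up_sub m d u : up (sub m d u) = sub m d.+1 (subst_t (sub 0 0 (Var 0)) u).
Proof.
apply: funext => -[|n] //=; rewrite /sub ltnS eqSS.
case: ltnP => //= h; case: m => //= m; case: eqP => // ne /=.
by case: n h ne => //=; case: d.
Qed.

(** The evaluation rules never check that a number codes a program, so their meaning is conditional
    on a decoding. Substitution and provability do assert that their formula argument decodes. *)
Definition J (r : nat) (l : seq nat) : Prop :=
  match r, l with
  | 0, [:: i; j] => i < j
  | 1, [:: xs; i; v] => nth 0 (dl xs) i = v
  | 2, [:: c; xs; v] => forall p, code_prog p = c -> eval emptyset p (dl xs) v
  | 3, [:: c; xs; ys] => forall ps, code_list (map code_prog ps) = c ->
      evals emptyset ps (dl xs) (dl ys)
  | 4, [:: c; xs; n] => forall p, code_prog p = c ->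
      forall m, m < n -> exists k, eval emptyset p (m :: dl xs) k.+1
  | 5, [:: m; d; u; n; t] => forall u', code_t u' = u -> t = code_t (sub m d u' n)
  | 6, [:: m; d; u; s; t] => forall u', code_t u' = u ->
      exists2 s', code_t s' = s & t = code_t (subst_t (sub m d u') s')
  | 7, [:: m; d; u; s; t] => forall u', code_t u' = u ->
      exists2 s', code_list (map code_t s') = s &
        t = code_list (map code_t (map (subst_t (sub m d u')) s'))
  | 8, [:: m; d; u; a; b] => forall u', code_t u' = u ->
      exists2 a', code_f a' = a & b = code_f (subst_f (sub m d u') a')
  | 9, [:: c; x] => forall p A, code_prog p = c ->
      (forall n, eval emptyset p [:: n] 1 -> codes A n) -> exists2 a, code_f a = x & prov A a
  | 10, [:: d; x] => exists2 a, code_f a = x & form_in LE a /\ fbound d a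
  | 11, [:: d; x] => forall a, code_f a = x -> ~ (form_in LE a /\ fbound d a)
  | 12, [:: d; t] => forall i, t = cpair 0 i -> d <= i
  | _, _ => False
  end.

Lemma code_prog_comp f gs :
  code_prog (PComp f gs) = cpair 4 (cpair (code_prog f) (code_list (map code_prog gs))).
Proof. by rewrite /=; congr (cpair _ (cpair _ _)); elim: gs => //= g gs ->. Qed.

Lemma Forall_cat (T : Type) (Q : T -> Prop) l1 l2 :
  Forall Q (l1 ++ l2) <-> Forall Q l1 /\ Forall Q l2.
Proof. elim: l1 => //= [|x l1 ->]; tauto. Qed.

Definition rule_ok (c : atom * seq atom) : Prop :=
  forall e, size e = 8 ->
    Forall (fun b : atom => J b.1 (map (peval e) b.2)) c.2 -> J c.1.1 (map (peval e) c.1.2).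

Ltac sound_start :=
  repeat (split; [move=> [|y0 [|y1 [|y2 [|y3 [|y4 [|y5 [|y6 [|y7 [|y8 e]]]]]]]]] //= _|]);
  last by [].

Ltac tag := let h := fresh in move=> /cpair_inj[h]; discriminate h.

Lemma lt_rules_ok : Forall rule_ok lt_rules.
Proof. by sound_start; case. Qed.

Ltac prog_cases p := case: p => [| |i| |f gs|f g|f]; rewrite ?code_prog_comp; try by tag.

Lemma eval_rules_ok : Forall rule_ok eval_rules.
Proof.
rewrite /eval_rules /=; sound_start.
- by rewrite dl0 nth_nil.
- by rewrite dl_cons.
- by rewrite dl_cons => -[].
- by move=> _ p; prog_cases p; constructor.
- by move=> [<- _] p; prog_cases p; constructor.
- by move=> [<- _] p; prog_cases p => /cpair_inj[_ ->]; constructor.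
- by move=> _ p; prog_cases p; constructor.
- move=> [h1 [h2 _]] p; prog_cases p => /cpair_inj[_ /cpair_inj[E1 E2]].
  by apply: ev_comp; [apply: h1 E2 | apply: h2 E1].
- move=> [h _] p; prog_cases p => /cpair_inj[_ /cpair_inj[E1 E2]].
  by rewrite dl_cons; constructor; apply: h E1.
- move=> [h1 [h2 _]] p; prog_cases p => /[dup] E /cpair_inj[_ /cpair_inj[E1 E2]].
  move: (h1 _ E) (h2 _ E2); rewrite !dl_cons => h3 h4; exact: ev_recS h3 h4.
- move=> [h1 [h2 _]] p; prog_cases p => /cpair_inj[_ E].
  by apply: ev_mu; [move: (h1 _ E); rewrite dl_cons | apply: h2].
- by move=> _ [|? ?] //; rewrite dl0; constructor.
- move=> [h1 [h2 _]] [|p ps] //= [] /cpair_inj[E1 E2].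
  by rewrite dl_cons; constructor; [apply: h1 | apply: h2].
- move=> [h1 [h2 _]] p E m; rewrite ltnS leq_eqVlt => /orP[/eqP->|]; last exact: h1.
  by exists y3; move: (h2 _ E); rewrite dl_cons.
Qed.

Lemma subst_rules_ok : Forall rule_ok subst_rules.
Proof.
rewrite /subst_rules /=; sound_start.
- by move=> [h _] u _; rewrite /sub h.
- by move=> [h _] u _; rewrite /sub ltnNge -ltnS h.
- by move=> [h _] u _; rewrite /sub h.
- by move=> _ u <-; rewrite /sub ltnn eqxx.
- move=> [h _] u _; rewrite /sub ltnNge -ltnS ltnS ltnW //=.
  by have -> : y2.+1 == y0 = false by lia.
- by move=> [h _] u /h ->; exists (Var y3).
- by move=> [h _] u /h[s E1 E2]; exists (Func y3 s); rewrite /= -!/(code_t (Func _ _)) code_tE ?E1 ?E2.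
- by move=> _ u _; exists [::].
- move=> [h1 [h2 _]] u E; have [s E1 E2] := h1 u E; have [ss E3 E4] := h2 u E.
  by exists (s :: ss); rewrite /= ?E1 ?E2 ?E3 ?E4.
- by move=> _ u _; exists Fal.
- move=> [h1 [h2 _]] u E; have [s E1 E2] := h1 u E; have [t E3 E4] := h2 u E.
  by exists (Eq s t); rewrite /= ?E1 ?E2 ?E3 ?E4.
- by move=> [h _] u /h[s E1 E2]; exists (Rel y3 s); rewrite /= ?E1 ?E2.
- move=> [h1 [h2 _]] u E; have [s E1 E2] := h1 u E; have [t E3 E4] := h2 u E.
  by exists (Imp s t); rewrite /= ?E1 ?E2 ?E3 ?E4.
- move=> [h1 [h2 _]] u E; have [s Es Ey] := h1 (Var 0) erefl.
  have Eu : s = u by apply: code_t_inj; rewrite Es.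
  have [a E1 E2] := h2 _ (esym Ey).
  by exists (All a); rewrite /= ?E1 ?E2 // Eu up_sub.
Qed.

Lemma sub10 t : sub 1 0 t = t .: Var.
Proof. by apply: funext => -[|n]. Qed.

Lemma prov_rules_ok : Forall rule_ok prov_rules.
Proof.
have V0 : code_t (Var 0) = 0 by [].
rewrite /prov_rules /=; sound_start.
- move=> [h _] p A /h; rewrite dl_cons dl0 => ev hA.
  by have [a [E h1]] := hA _ ev; exists a => //; apply: pr_ax.
- move=> [h1 [h2 _]] p A _ _; have [a <- _] := h1 _ V0; have [b <- _] := h2 _ V0.
  by exists (Imp a (Imp b a)) => //; apply: pr_K.
- move=> [h1 [h2 [h3 _]]] p A _ _.
  have [a <- _] := h1 _ V0; have [b <- _] := h2 _ V0; have [c <- _] := h3 _ V0.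
  by exists (Imp (Imp a (Imp b c)) (Imp (Imp a b) (Imp a c))) => //; apply: pr_S.
- move=> [h1 _] p A _ _; have [a <- _] := h1 _ V0.
  by exists (Imp (Neg (Neg a)) a) => //; apply: pr_DN.
- move=> [h1 [h2 _]] p A _ _; have [t Et _] := h2 _ V0; have [a <- ->] := h1 _ Et.
  by exists (Imp (All a) (inst t a)); [rewrite sub10 | apply: pr_inst].
- move=> [h1 [h2 _]] p A _ _; have [a <- ->] := h1 _ V0; have [b <- _] := h2 _ V0.
  by exists (Imp (All (Imp (lift a) b)) (Imp a (All b))) => //; apply: pr_allimp.
- move=> [h1 _] p A _ _; have [t <- _] := h1 _ V0.
  by exists (Eq t t) => //; apply: pr_refl.
- move=> [h1 [h2 [h3 [h4 _]]]] p A _ _.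
  have [s Es _] := h3 _ V0; have [t Et _] := h4 _ V0.
  have [a Ea Ey3] := h1 _ Es; have [a' Ea' Ey4] := h2 _ Et.
  have E : a' = a by apply: code_f_inj; rewrite Ea.
  exists (Imp (Eq s t) (Imp (inst s a) (inst t a))); last exact: pr_leib.
  by rewrite /= Es Et Ey3 Ey4 E !sub10.
- move=> [h1 [h2 _]] p A Ep hA; have [c Ec hc] := h1 p A Ep hA.
  have [a Ea ha] := h2 p A Ep hA.
  case: c Ec hc => [|t u|r ts|a' b|b] //= [] /cpair_inj[] // _ /cpair_inj[E1 E2] hc.
  have E : a' = a by apply: code_f_inj; rewrite E1.
  by exists b => //; apply: pr_mp hc _; rewrite E.
- move=> [h1 _] p A Ep hA; have [a Ea ha] := h1 p A Ep hA.
  by exists (All a); [rewrite /= Ea | apply: pr_gen].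
Qed.

(** Without function symbols all terms are variables. Inductions over formulas of [LE] thus have
    only these five cases, and keep track of the bound on the variables. *)
Inductive LEform : nat -> form -> Prop :=
| LE_Fal d : LEform d Fal
| LE_Eq d i j : i < d -> j < d -> LEform d (Eq (Var i) (Var j))
| LE_Rel d i j : i < d -> j < d -> LEform d (Rel 0 [:: Var i; Var j])
| LE_Imp d a b : LEform d a -> LEform d b -> LEform d (Imp a b)
| LE_All d a : LEform d.+1 a -> LEform d (All a).

Lemma LEformP d a : LEform d a <-> form_in LE a /\ fbound d a.
Proof.
split; first by elim=> {d a} //= [d i j -> ->|d i j -> ->|d a b _ [-> ->] _ [-> ->]].
elim: a d => [|[i|f ts] [j|g us]|[|r] [|[i|f ts] [|[j|g us] [|v vs]]]|a IHa b IHb|a IH] d /=;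
  try by move=> [].
- by move=> _; constructor.
- by move=> [_ /andP[h1 h2]]; constructor.
- by move=> [_ /and3P[h1 h2 _]]; constructor.
- by move=> [/andP[h1 h2] /andP[h3 h4]]; constructor; [apply: IHa | apply: IHb].
- by move=> [h1 h2]; constructor; apply: IH.
Qed.

Lemma form_rules_ok : Forall rule_ok form_rules.
Proof.
rewrite /form_rules /=; sound_start.
- by move=> _; exists Fal.
- by move=> [h1 [h2 _]]; exists (Eq (Var y1) (Var y2)) => //=; rewrite h1 h2.
- by move=> [h1 [h2 _]]; exists (Rel 0 [:: Var y1; Var y2]) => //=; rewrite h1 h2.
- move=> [[a <- [h1 h2]] [[b <- [h3 h4]] _]].
  by exists (Imp a b) => //=; rewrite h1 h2 h3 h4.
- by move=> [[a <- [h1 h2]] _]; exists (All a).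
- by move=> [h _] i /cpair_inj[_ <-].
- by move=> _ i /cpair_inj[].
all: move=> h a E /LEformP h1; move: h E; case: h1 => {a} [d|d i j hi hj|d i j hi hj|d a b ha hb|d a ha] h.
all: try by case.
all: case=> /cpair_inj[] // ?; try by [].
- by move=> /cpair_inj[E _]; move: h => [/(_ i) h _]; have := h (esym E); lia.
- by move=> /cpair_inj[_ E]; move: h => [/(_ j) h _]; have := h (esym E); lia.
- by move=> /cpair_inj[].
- by move=> /cpair_inj[].
- by move=> /cpair_inj[_ [/cpair_inj[]]].
- by move=> /cpair_inj[_ [/cpair_inj[_ [/cpair_inj[]]]]].
- move=> /cpair_inj[_ [/cpair_inj[E _]]]; move: h => [/(_ i) h _]; have := h (esym E); lia.
- move=> /cpair_inj[_ [/cpair_inj[_ [/cpair_inj[E _]]]]]; move: h => [/(_ j) h _]; have := h (esym E); lia.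
- by move=> /cpair_inj[E _]; case: h => /(_ _ E); rewrite -LEformP.
- by move=> /cpair_inj[_ E]; case: h => /(_ _ E); rewrite -LEformP.
- by move=> E; case: h => /(_ _ E); rewrite -LEformP.
Qed.

Lemma H_sound r l : H r l -> J r l.
Proof.
apply: horn_sound.
rewrite /rules; do ![apply/Forall_cat; split].
- exact: lt_rules_ok.
- exact: eval_rules_ok.
- exact: subst_rules_ok.
- exact: prov_rules_ok.
- exact: form_rules_ok.
Qed.

(** * Completeness of the rules *)

Ltac by_rule k e := refine (@rule k e isT isT _); simpl.

Lemma H_lt i j : i < j -> H 0 [:: i; j].
Proof.
(* Here and below, the number is the position of the rule in [rules] and the list gives its
   variables in order. *)
elim: i j => [|i IH] [|j] // lt; first by by_rule 0 [:: j].
by by_rule 1 [:: i; j]; split=> //; apply: IH.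
Qed.

Lemma H_nth l i : H 1 [:: code_list l; i; nth 0 l i].
Proof.
elim: l i => [|x l IH] [|i]; first by by_rule 2 [:: 0].
- by by_rule 2 [:: i.+1].
- by by_rule 3 [:: x; code_list l].
- by by_rule 4 [:: x; code_list l; i; nth 0 l i].
Qed.

Fixpoint prog_nested_ind (Q : prog -> Prop) (h0 : Q PZero) (hS : Q PSucc)
  (hP : forall i, Q (PProj i)) (hO : Q POrc)
  (hC : forall f gs, Q f -> Forall Q gs -> Q (PComp f gs))
  (hR : forall f g, Q f -> Q g -> Q (PRec f g)) (hM : forall f, Q f -> Q (PMu f))
  (p : prog) : Q p :=
  let ind := prog_nested_ind h0 hS hP hO hC hR hM in
  match p with
  | PZero => h0
  | PSucc => hS
  | PProj i => hP i
  | POrc => hO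
  | PComp f gs => hC f gs (ind f)
      ((fix go (l : seq prog) : Forall Q l :=
          match l return Forall Q l with
          | [::] => I
          | u :: l' => conj (ind u) (go l')
          end) gs)
  | PRec f g => hR f g (ind f) (ind g)
  | PMu f => hM f (ind f)
  end.

Lemma eval_Mu_inv O f xs n : eval O (PMu f) xs n ->
  eval O f (n :: xs) 0 /\ forall m, m < n -> exists k, eval O f (m :: xs) k.+1.
Proof. by move=> h; inversion h. Qed.

Lemma eval_Comp_inv O f gs xs v : eval O (PComp f gs) xs v ->
  exists2 ys, evals O gs xs ys & eval O f ys v.
Proof. by move=> h; inversion h; exists ys. Qed.

Lemma evals_det O ps : Forall (fun p => forall xs v v', eval O p xs v -> eval O p xs v' -> v = v') ps ->
  forall xs ys ys', evals O ps xs ys -> evals O ps xs ys' -> ys = ys'.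
Proof.
elim: ps => [|p ps IH] /=.
  by move=> _ xs ys ys' h1 h2; inversion h1; inversion h2.
move=> [hp hps] xs ys ys' h1 h2; inversion h1; inversion h2; subst.
by congr cons; [apply: hp; eassumption | apply: IH; eassumption].
Qed.

Lemma eval_det O p xs v v' : eval O p xs v -> eval O p xs v' -> v = v'.
Proof.
elim/prog_nested_ind: p xs v v' => [||i||f gs IHf IHgs|f g IHf IHg|f IH] xs v v' h1 h2.
- by inversion h1; inversion h2.
- by inversion h1; inversion h2.
- by inversion h1; inversion h2.
- by inversion h1; inversion h2.
- move: h1 h2 => /eval_Comp_inv[ys h1 h3] /eval_Comp_inv[ys' h2 h4].
  by move: h4; rewrite -(evals_det IHgs h1 h2); apply: IHf.
- have [n [l E]] : exists n l, xs = n :: l by inversion h1; do 2 eexists.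
  subst; elim: n v v' h1 h2 => [|n IHn] v v' h1 h2; inversion h1; inversion h2; subst.
    by apply: IHf; eassumption.
  have E : r = r0 by apply: IHn; eassumption.
  by subst; apply: IHg; eassumption.
- move: h1 h2 => /eval_Mu_inv[h1 h3] /eval_Mu_inv[h2 h4].
  have [lt|lt|//] := ltngtP v v'.
    by have [k hk] := h4 _ lt; have := IH _ _ _ h1 hk.
  by have [k hk] := h3 _ lt; have := IH _ _ _ h2 hk.
Qed.

Lemma H_ev p xs v : eval emptyset p xs v -> H 2 [:: code_prog p; code_list xs; v].
Proof.
elim/prog_nested_ind: p xs v => [||i||f gs IHf IHgs|f g IHf IHg|f IH] xs v ev.
- by inversion ev; by_rule 5 [:: code_list xs].
- inversion ev; by_rule 6 [:: code_list xs; nth 0 xs 0]; split=> //; exact: H_nth.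
- inversion ev; by_rule 7 [:: i; code_list xs; nth 0 xs i]; split=> //; exact: H_nth.
- by inversion ev => //; by_rule 8 [:: code_list xs].
- move: ev => /eval_Comp_inv[ys hs hv]; rewrite code_prog_comp.
  by_rule 9 [:: code_prog f; code_list (map code_prog gs); code_list xs; v; code_list ys].
  split; last by split=> //; apply: IHf.
  elim: gs IHgs ys hs {IHf hv} => [|g gs IH] /= h ys hs; inversion hs; subst.
    by by_rule 13 [:: code_list xs].
  have [h1 h2] := h.
  by_rule 14 [:: code_prog g; code_list (map code_prog gs); code_list xs; y; code_list ys0].
  by split; [apply: h1 | split=> //; apply: IH].
- have [n [l E]] : exists n l, xs = n :: l by inversion ev; do 2 eexists.
  subst; elim: n v ev => [|n IHn] v ev; inversion ev; subst.
    by by_rule 10 [:: code_prog f; code_prog g; code_list l; v]; split=> //; apply: IHf.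
  by_rule 11 [:: code_prog f; code_prog g; code_list l; v; n; r].
  split; first exact: IHn.
  by split=> //; apply: (IHg [:: n, r & l]).
- move: ev => /eval_Mu_inv[h1 h2].
  by_rule 12 [:: code_prog f; code_list xs; v]; split; first exact: (IH (v :: xs)).
  split=> //; elim: v h2 {h1} => [|v IHv] h.
    by by_rule 15 [:: code_prog f; code_list xs].
  have [k hk] := h v (ltnSn v).
  by_rule 16 [:: code_prog f; code_list xs; v; k]; split.
    by apply: IHv => m lt; apply: h; apply: leq_trans lt _.
  by split=> //; apply: (IH (v :: xs)).
Qed.

Section Subst.
Variables (m : nat).
Hypothesis m2 : m < 2.

Lemma H_subV d u n : H 5 [:: m; d; code_t u; n; code_t (sub m d u n)].
Proof.
case: m m2 => [|[|//]] _; rewrite /sub.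
  case: ltnP => h.
    by by_rule 17 [:: d; code_t u; n]; split=> //; apply: H_lt.
  by by_rule 18 [:: d; code_t u; n]; split=> //; apply: H_lt.
case: ltnP => h; first by by_rule 19 [:: d; code_t u; n]; split=> //; apply: H_lt.
case: eqP => [->|ne]; first by by_rule 20 [:: d; code_t u].
case: n h ne => [|n] h ne; first by case: ne; lia.
by by_rule 21 [:: d; code_t u; n]; split=> //; apply: H_lt; lia.
Qed.

Lemma H_subTs d u ts :
  Forall (fun t => H 6 [:: m; d; code_t u; code_t t; code_t (subst_t (sub m d u) t)]) ts ->
  H 7 [:: m; d; code_t u; code_list (map code_t ts);
          code_list (map code_t (map (subst_t (sub m d u)) ts))].
Proof.
elim: ts => [|t ts IH] /=; first by move=> _; by_rule 24 [:: m; d; code_t u].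
move=> [h1 h2].
by by_rule 25 [:: m; d; code_t u; code_t t; code_list (map code_t ts);
  code_t (subst_t (sub m d u) t); code_list (map code_t (map (subst_t (sub m d u)) ts))];
  split=> //; split=> //; apply: IH.
Qed.

Lemma H_subT d u t : H 6 [:: m; d; code_t u; code_t t; code_t (subst_t (sub m d u) t)].
Proof.
elim/term_nested_ind: t => [n|f ts IH].
  by by_rule 22 [:: m; d; code_t u; n; code_t (sub m d u n)]; split=> //; apply: H_subV.
rewrite [subst_t _ _]/= !code_tE.
by by_rule 23 [:: m; d; code_t u; f; code_list (map code_t ts);
  code_list (map code_t (map (subst_t (sub m d u)) ts))]; split=> //; apply: H_subTs.
Qed.

End Subst.

Lemma H_subF m d u a : m < 2 -> H 8 [:: m; d; code_t u; code_f a; code_f (subst_f (sub m d u) a)].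
Proof.
move=> m2; elim: a d u => [|t s|r ts|a IHa b IHb|a IH] d u.
- by by_rule 26 [:: m; d; code_t u].
- by by_rule 27 [:: m; d; code_t u; code_t t; code_t s; code_t (subst_t (sub m d u) t);
    code_t (subst_t (sub m d u) s)]; split; [|split=> //]; apply: H_subT.
- by_rule 28 [:: m; d; code_t u; r; code_list (map code_t ts);
    code_list (map code_t (map (subst_t (sub m d u)) ts))]; split=> //; apply: H_subTs => //.
  by elim: ts => //= t ts IH; split=> //; apply: H_subT.
- by by_rule 29 [:: m; d; code_t u; code_f a; code_f b; code_f (subst_f (sub m d u) a);
    code_f (subst_f (sub m d u) b)].
- rewrite [subst_f _ _]/= up_sub; pose u' := subst_t (sub 0 0 (Var 0)) u.
  by_rule 30 [:: m; d; code_t u; code_f a; code_f (subst_f (sub m d.+1 u') a); code_t u'].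
  by split; [exact: (@H_subT 0 isT 0 (Var 0)) | split].
Qed.

Lemma H_isT t : H 6 [:: 0; 0; 0; code_t t; code_t (subst_t (sub 0 0 (Var 0)) t)].
Proof. exact: (@H_subT 0 isT 0 (Var 0)). Qed.

Lemma H_isF a : H 8 [:: 0; 0; 0; code_f a; code_f (lift a)].
Proof. exact: (@H_subF 0 0 (Var 0)). Qed.

Lemma H_inst t a : H 8 [:: 1; 0; code_t t; code_f a; code_f (inst t a)].
Proof. by have := @H_subF 1 0 t a isT; rewrite sub10. Qed.

Lemma H_prov p A a : (forall b, A b -> eval emptyset p [:: code_f b] 1) ->
  prov A a -> H 9 [:: code_prog p; code_f a].
Proof.
move=> hA; set c := code_prog p; have F := H_isF; have T := H_isT.
elim=> {a}.
- move=> a /hA h; by_rule 31 [:: c; code_f a]; split=> //.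
  exact: (H_ev h).
- by move=> a b; by_rule 32 [:: c; code_f a; code_f b; code_f (lift a); code_f (lift b)].
- by move=> a b d; by_rule 33 [:: c; code_f a; code_f b; code_f d; code_f (lift a);
    code_f (lift b); code_f (lift d)].
- by move=> a; by_rule 34 [:: c; code_f a; code_f (lift a)].
- move=> a t; by_rule 35 [:: c; code_f a; code_f (inst t a); code_t t;
    code_t (subst_t (sub 0 0 (Var 0)) t)].
  by split; [apply: H_inst | split].
- by move=> a b; by_rule 36 [:: c; code_f (lift a); code_f b; code_f a; code_f (lift b)].
- by move=> t; by_rule 37 [:: c; code_t t; code_t (subst_t (sub 0 0 (Var 0)) t)].
- move=> s t a; by_rule 38 [:: c; code_t s; code_t t; code_f (inst s a); code_f (inst t a);
    code_f a; code_t (subst_t (sub 0 0 (Var 0)) s); code_t (subst_t (sub 0 0 (Var 0)) t)].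
  by split; [apply: H_inst | split; [apply: H_inst | split]].
- by move=> a b _ h1 _ h2; by_rule 39 [:: c; code_f b; code_f a].
- by move=> a _ h; by_rule 40 [:: c; code_f a].
Qed.

Lemma H_NVar d t : (exists2 i, i < d & t = cpair 0 i) \/ H 12 [:: d; t].
Proof.
have [[|k] [i ->]] := cpair_surj t; last by right; by_rule 47 [:: d; k; i].
case: (ltnP i d) => h; first by left; exists i.
by right; by_rule 46 [:: d; i]; split=> //; apply: H_lt.
Qed.

Lemma H_form_dec d x : H 10 [:: d; x] \/ H 11 [:: d; x].
Proof.
elim/ltn_ind: x d => -[|x] IH d; first by left; by_rule 41 [:: d].
have [k [y E]] := cpair_surj x; subst x.
have ly := cpair_ger k y.
have [a [b Ey]] := cpair_surj y.
have la := cpair_gel a b; have lb := cpair_ger a b.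
case: k IH ly => [|[|[|[|k]]]] IH ly; last by right; by_rule 59 [:: d; k; y].
- subst y; case: (H_NVar d a) => [[i hi Ea]|h]; last by right; by_rule 48 [:: d; a; b].
  case: (H_NVar d b) => [[j hj Eb]|h]; last by right; by_rule 49 [:: d; a; b].
  by subst; left; by_rule 42 [:: d; i; j]; split; [|split=> //]; apply: H_lt.
- subst y; case: a {IH ly la lb} => [|a]; last by right; by_rule 50 [:: d; a; b].
  case: b => [|b]; first by right; by_rule 51 [:: d; 0].
  have [t [l ->]] := cpair_surj b.
  case: l => [|l]; first by right; by_rule 52 [:: d; 0; t].
  have [s [w ->]] := cpair_surj l.
  case: w => [|w]; last by right; by_rule 53 [:: d; 0; t; s; w].
  case: (H_NVar d t) => [[i hi Ea]|h]; last by right; by_rule 54 [:: d; 0; t; (cpair s 0).+1].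
  case: (H_NVar d s) => [[j hj Eb]|h]; last by right; by_rule 55 [:: d; 0; t; s; 0].
  by subst; left; by_rule 43 [:: d; i; j]; split; [|split=> //]; apply: H_lt.
- subst y; have [|h|h] := IH a _ d; first by lia.
    have [|h'|h'] := IH b _ d; first by lia.
      by left; by_rule 44 [:: d; a; b].
    by right; by_rule 57 [:: d; a; b].
  by right; by_rule 56 [:: d; a; b].
- have [|h|h] := IH y _ d.+1; first by lia.
    by left; by_rule 45 [:: d; y].
  by right; by_rule 58 [:: d; y].
Qed.

(** * An inseparable pair *)

Lemma rules_bound : all (fun c => pbound 8 c.1 && all (pbound 8) c.2) (compile rules).
Proof. by []. Qed.

Lemma Theta_ctx x w xs : bev [:: x, w & xs] Theta = bev [:: x; w] Theta.
Proof.
by apply/idP/idP => /(thetaP rules_bound) h; apply/(thetaP rules_bound).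
Qed.

(* [step y s]: the fact coded by y has a derivation of size at most s. *)
Definition step (y s : nat) : bool :=
  (y <= s) && has (fun k => bev [:: y; k] Theta) (iota 0 s.+1).

Lemma stepP y s : reflect (y <= s /\ exists2 k, k <= s & bev [:: y; k] Theta) (step y s).
Proof.
apply: (iffP andP) => -[h1 h2]; split=> //.
  by move/hasP: h2 => [k hk h]; exists k => //; move: hk; rewrite mem_iota.
by case: h2 => k hk h; apply/hasP; exists k; rewrite ?mem_iota.
Qed.

Lemma step_mono y s t : s <= t -> step y s -> step y t.
Proof.
move=> le /stepP[h1 [k hk h]]; apply/stepP; split; first exact: leq_trans le.
by exists k => //; apply: leq_trans le.
Qed.

Lemma step_H r l : H r l <-> exists s, step (fact r l) s.
Proof.
split=> [/Theta_complete[w h]|[s /stepP[_ [k _ /Theta_sound]] //]].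
exists (maxn w (fact r l)); apply/stepP; rewrite leq_maxr; split=> //.
by exists w; [rewrite leq_maxl | apply: h].
Qed.

(** The fact is named by a bounded quantifier, which is why [step] also asks for y <= s. *)
Definition stepF (p : pat) (j : nat) : bform :=
  BEx (BV j) (BEx (BV j.+1) (BAnd (patF 2 p 0) Theta)).

Lemma stepFP p j xs : pbound (size xs) p -> bev xs (stepF p j) = step (peval xs p) (nth 0 xs j).
Proof.
move=> hp; have E z k : bev [:: z, k & xs] (BAnd (patF 2 p 0) Theta) =
    (peval xs p == z) && bev [:: z; k] Theta.
  have := @patFP p xs [:: z; k] [::] 0 hp; rewrite cats0 /= => h.
  by rewrite bev_And h Theta_ctx.
apply/bev_ExP/stepP => [[k hk /bev_ExP[z hz]]|[h1 [k hk h]]].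
  by rewrite E => /andP[/eqP-> h]; split=> //; exists k.
exists k => //; apply/bev_ExP; exists (peval xs p) => //.
by rewrite E eqxx.
Qed.

Lemma Comp_bev2 O k a F G : Comp O k F -> Comp O k G -> CompB O k (fun xs => bev [:: F xs; G xs] a).
Proof.
apply: (@Comp_app2 O k (fun x y => nat_of_bool (bev [:: x; y] a))).
by apply: Comp_ext (CompB_bev O a 2) => -[|x [|y [|]]].
Qed.

Section Pair.
Variable q : prog.
Let D (x : nat) : Prop := exists v, eval emptyset q [:: x] v.

Definition evpat (c x v : pat) : pat := patom (2, [:: c; plist [:: x]; v]).

Definition ev_step (c n v s : nat) : bool := step (fact 2 [:: c; code_list [:: n]; v]) s.

Definition DF (x j : nat) : bform :=
  BEx (BV j) (stepF (evpat (PatC (code_prog q)) (PatV x.+1) (PatV 0)) j.+1).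

Definition inD (x s : nat) : bool := bev [:: x; s] (DF 0 1).

Lemma inDP x s : reflect (exists2 v, v <= s & ev_step (code_prog q) x v s) (inD x s).
Proof.
have E v : bev [:: v; x; s] (stepF (evpat (PatC (code_prog q)) (PatV 1) (PatV 0)) 2) =
    ev_step (code_prog q) x v s by rewrite stepFP.
by apply: (iffP (bev_ExP _ _ _)) => -[v hv h]; exists v => //; move: h; rewrite E.
Qed.

Lemma DFP x j xs : x < size xs -> bev xs (DF x j) = inD (nth 0 xs x) (nth 0 xs j).
Proof.
move=> hx.
have E v : bev (v :: xs) (stepF (evpat (PatC (code_prog q)) (PatV x.+1) (PatV 0)) j.+1) =
    ev_step (code_prog q) (nth 0 xs x) v (nth 0 xs j).
  by rewrite stepFP; [ | rewrite /= !andbT].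
by rewrite /DF; apply/bev_ExP/inDP => -[v hv h]; exists v => //; move: h; rewrite E.
Qed.

Lemma inD_mono x s t : s <= t -> inD x s -> inD x t.
Proof.
move=> le /inDP[v hv h]; apply/inDP; exists v; first exact: leq_trans le.
exact: step_mono h.
Qed.

Lemma inD_D x : D x <-> exists s, inD x s.
Proof.
split=> [[v /H_ev /step_H[s h]]|[s /inDP[v _ h]]].
  exists (maxn v s); apply/inDP; exists v; rewrite ?leq_maxl //.
  by apply: step_mono h; rewrite leq_maxr.
have /step_H/H_sound : exists s, step (fact 2 [:: code_prog q; code_list [:: x]; v]) s by exists s.
by move=> /(_ q erefl); rewrite dl_code; exists v.
Qed.

(** The stage at which x enters D is unique. Outside row 1, <e, x> can join A or B at this stage
    only, which makes the pair disjoint and decidable from D. *)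
Definition firstF (x j : nat) : bform :=
  BAnd (DF x j) (BAll (BV j) (BImp (BLe (BAdd (BV 0) (BC 1)) (BV j.+1)) (BNeg (DF x.+1 0)))).

Definition first (x s : nat) : bool := bev [:: x; s] (firstF 0 1).

Lemma firstFP x j xs : x < size xs ->
  reflect (inD (nth 0 xs x) (nth 0 xs j) /\ forall s, s < nth 0 xs j -> ~~ inD (nth 0 xs x) s)
    (bev xs (firstF x j)).
Proof.
move=> hx; rewrite bev_And DFP //; apply: (iffP andP) => -[-> h]; split=> //.
  move=> s lt; move/bev_AllP/(_ s (ltnW lt)): h; rewrite bev_Imp bev_Le bev_Neg DFP //=.
  by rewrite addn1 lt.
apply/bev_AllP => s _; rewrite bev_Imp bev_Le bev_Neg DFP //= addn1; apply/implyP; exact: h.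
Qed.

Lemma firstP x s : reflect (inD x s /\ forall t, t < s -> ~~ inD x t) (first x s).
Proof. exact: (@firstFP 0 1 [:: x; s] isT). Qed.

Lemma firstE x j xs : x < size xs -> bev xs (firstF x j) = first (nth 0 xs x) (nth 0 xs j).
Proof. by move=> hx; apply/firstFP/firstP => //. Qed.

Lemma first_D x s : first x s -> D x.
Proof. by move=> /firstP[h _]; apply/inD_D; exists s. Qed.

Lemma first_exists x : D x -> exists s, first x s.
Proof.
move=> /inD_D h; exists (ex_minn h); apply/firstP; case: ex_minnP => m hm min.
by split=> // t lt; apply/negP => /min; rewrite leqNgt lt.
Qed.

Lemma first_uniq x s t : first x s -> first x t -> s = t.
Proof.
move=> /firstP[h1 h2] /firstP[h3 h4]; have [lt|lt|//] := ltngtP s t.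
  by move: (h4 _ lt); rewrite h1.
by move: (h2 _ lt); rewrite h3.
Qed.

(* n = <e, x>. Row 0 copies D, row 1 lies in A, and row c + 2 diagonalizes against program c:
   when x enters D, <c + 2, x> goes to the side on which c has not put it. *)
Definition diagF (v : nat) : bform :=
  BEx (BV 1) (BAnd (BEq (BV 2) (BAdd (BV 0) (BC 2)))
                   (stepF (evpat (PatV 0) (PatV 3) (PatC v)) 4)).

Definition unpairF (a : bform) : bform :=
  BEx (BV 0) (BEx (BV 1) (BAnd (patF 0 (PatP (PatV 1) (PatV 0)) 2) a)).

Definition alphaF : bform := unpairF (BOr (BEq (BV 1) (BC 1))
  (BAnd (firstF 0 3) (BOr (BEq (BV 1) (BC 0)) (diagF 0)))).

(** The last conjunct makes B disjoint from A by its very form, with no appeal to uniqueness of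
    values: e - 2 is an arbitrary number and need not code a program. *)
Definition betaF : bform := unpairF (BAnd (firstF 0 3) (BAnd (diagF 1) (BNeg (diagF 0)))).

Lemma unpairFP a e x s : bev [:: cpair e x; s] (unpairF a) = bev [:: x; e; cpair e x; s] a.
Proof.
have E e' x' n : bev [:: x'; e'; n; s] (patF 0 (PatP (PatV 1) (PatV 0)) 2) = (cpair e' x' == n).
  by have := @patFP (PatP (PatV 1) (PatV 0)) [:: x'; e'; n; s] [::] [::] 2 isT.
apply/bev_ExP/idP => [[e' _ /bev_ExP[x' _]]|h].
  by rewrite bev_And E => /andP[/eqP/cpair_inj[-> ->]].
exists e; first exact: cpair_gel.
apply/bev_ExP; exists x; first exact: cpair_ger.
by rewrite bev_And E eqxx.
Qed.

Lemma diagFP v x e n s :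
  bev [:: x; e; n; s] (diagF v) = (1 < e) && ev_step (e - 2) n v s.
Proof.
apply/bev_ExP/andP => [[c _]|[h1 h2]].
  rewrite bev_And bev_Eq stepFP //= => /andP[/eqP-> h].
  by rewrite addnK; split=> //; rewrite addn2.
exists (e - 2); first by rewrite /= leq_subr.
by rewrite bev_And bev_Eq stepFP //= subnK // eqxx.
Qed.

Lemma alphaFP e x s : bev [:: cpair e x; s] alphaF =
  (e == 1) || first x s && ((e == 0) || (1 < e) && ev_step (e - 2) (cpair e x) 0 s).
Proof. by rewrite unpairFP bev_Or bev_And firstE // bev_Or diagFP !bev_Eq. Qed.

Lemma betaFP e x s : bev [:: cpair e x; s] betaF =
  [&& first x s, (1 < e) && ev_step (e - 2) (cpair e x) 1 s
    & ~~ ((1 < e) && ev_step (e - 2) (cpair e x) 0 s)].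
Proof. by rewrite unpairFP bev_And firstE // bev_And bev_Neg !diagFP. Qed.

Definition inA (n : nat) : Prop := exists s, bev [:: n; s] alphaF.
Definition inB (n : nat) : Prop := exists s, bev [:: n; s] betaF.

Lemma ev_stepP p n v s : ev_step (code_prog p) n v s -> eval emptyset p [:: n] v.
Proof.
move=> h; have /step_H/H_sound : exists s, step (fact 2 [:: code_prog p; code_list [:: n]; v]) s.
  by exists s.
by move=> /(_ p erefl); rewrite dl_code.
Qed.

Lemma inA_row1 x : inA (cpair 1 x).
Proof. by exists 0; rewrite alphaFP. Qed.

Lemma inA_row0 x : inA (cpair 0 x) <-> D x.
Proof.
split=> [[s]|/first_exists[s h]]; first by rewrite alphaFP => /andP[/first_D].
by exists s; rewrite alphaFP h.
Qed.

(** B has no members in rows 0 and 1. In the other rows s and t are both the entry stage of x, where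
    [betaF] excludes what [alphaF] asks for. *)
Lemma alpha_beta n s t : bev [:: n; s] alphaF -> ~~ bev [:: n; t] betaF.
Proof.
have [e [x ->]] := cpair_surj n; rewrite alphaFP betaFP => h.
apply/negP => /and3P[h1 /andP[lt _] h3].
move: h; have -> : e == 1 = false by lia.
have -> : e == 0 = false by lia.
by move=> /andP[/(first_uniq h1) E]; rewrite -E (negbTE h3).
Qed.

Lemma inseparable C : (forall n, inA n -> C n) -> (forall n, inB n -> ~ C n) ->
  computable C -> computable D.
Proof.
move=> AC BC [p hp]; pose c := (code_prog p).+2.
pose n x := cpair c x.
have dec x : exists2 v, eval emptyset p [:: n x] v & (v = 0 /\ ~ C (n x)) \/ (v = 1 /\ C (n x)).
  by have [h1 h2] := hp (n x); have [h|h] := EM (C (n x)); [exists 1|exists 0]; auto.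
pose F v := stepF (evpat (PatC (code_prog p)) (PatP (PatC c) (PatV 1)) (PatC v)) 0.
have FP v k x : bev [:: k; x] (F v) = ev_step (code_prog p) (n x) v k by rewrite stepFP.
(* [G] finds a stage k by which the value of p at [n x] is visible. *)
have [|G cG hG] := @Comp_mu emptyset 1 _ (CompB_bev emptyset (BOr (F 0) (F 1)) 2).
  move=> [|x [|? ?]] // _; have [v ev hv] := dec x.
  have [s hs] := (step_H 2 _).1 (H_ev ev); exists s; rewrite bev_Or !FP.
  by case: hv hs => -[-> _]; rewrite /ev_step => ->; rewrite ?orbT.
apply/Treducible_Comp.
apply: (@Comp_ext _ _ (fun xs => inD (nth 0 xs 0) (G xs))); last first.
  by apply: Comp_bev2 => //; apply: Comp_proj.
move=> [|x [|? ?]] // _; have /= := hG [:: x] erefl; set k := G _ => hk.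
congr nat_of_bool; apply/idP/asboolP => [h|]; first by apply/inD_D; exists k.
move=> /first_exists[s hs]; have [hD _] := firstP _ _ hs.
(* If x entered D at a stage s > k, the value of p would be visible at s, and [n x] would have gone
   to the side that refutes it. So D can be read off at stage k. *)
case: (leqP s k) => [le|lt]; first exact: inD_mono hD.
have mono v : bev [:: k; x] (F v) -> ev_step (c - 2) (n x) v s.
  by rewrite FP /c subn2 /=; apply: step_mono; apply: ltnW.
have sound v : ev_step (c - 2) (n x) v s -> eval emptyset p [:: n x] v.
  by rewrite /c subn2 /=; apply: ev_stepP.
have cA : ev_step (c - 2) (n x) 0 s -> C (n x).
  by move=> h; apply: AC; exists s; rewrite alphaFP hs h orbT.
have [v ev [[E nC]|[E inC]]] := dec x; subst v; move: hk; rewrite bev_Or => /orP[] /mono h.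
- by case: nC; apply: cA.
- by have := eval_det ev (sound _ h).
- by have := eval_det ev (sound _ h).
- case: (BC (n x)) => //; exists s; rewrite betaFP hs h /=.
  by apply/negP => /sound h'; have := eval_det ev h'.
Qed.

(** The oracle tells whether the entry stage of x exists; once it is found, [alphaF] and [betaF]
    need to be evaluated at this stage only. *)
Lemma inA_inB_computable :
  CompB D 1 (fun xs => `[< inA (nth 0 xs 0) >]) /\ CompB D 1 (fun xs => `[< inB (nth 0 xs 0) >]).
Proof.
have [|X cX hX] := @Comp_mu D 1 _
    (CompB_bev D (BEx (BV 1) (patF 0 (PatP (PatV 0) (PatV 1)) 2)) 2).
  move=> [|n [|? ?]] // _; have [e [x ->]] := cpair_surj n; exists x.
  apply/bev_ExP; exists e; first exact: cpair_gel.
  have := @patFP (PatP (PatV 0) (PatV 1)) [:: e; x; cpair e x] [::] [::] 2 isT.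
  by rewrite /= => ->.
have XE e x : X [:: cpair e x] = x.
  have /bev_ExP[e' _] := hX [:: cpair e x] erefl.
  have := @patFP (PatP (PatV 0) (PatV 1)) [:: e'; X [:: cpair e x]; cpair e x] [::] [::] 2 isT.
  by rewrite /= => -> /eqP/cpair_inj[].
(* This search stops at 0 if x is not in D, and at the entry stage of x otherwise. *)
have cP : CompB D 2 (fun xs => ~~ `[< D (X [:: nth 0 xs 1]) >] || first (X [:: nth 0 xs 1]) (nth 0 xs 0)).
  have cX' : Comp D 2 (fun xs => X [:: nth 0 xs 1]).
    apply: (@Comp_app1 D 2 (fun x => X [:: x])); last exact: Comp_proj.
    by apply: Comp_ext cX => -[|? [|? ?]].
  apply: CompB_or; first by apply/CompB_neg/Comp_oracle.
  by apply: Comp_bev2 => //; apply: Comp_proj.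
have [|S cS hS] := @Comp_mu D 1 _ cP.
  move=> [|n [|? ?]] // _ /=; have [h|h] := EM (D (X [:: n])).
    by have [s hs] := first_exists h; exists s; rewrite hs orbT.
  by exists 0; case: asboolP.
split.
- apply: (@Comp_ext _ _ (fun xs => bev [:: nth 0 xs 0; S xs] alphaF)); last first.
    by apply: Comp_bev2 => //; apply: Comp_proj.
  move=> [|n [|? ?]] sz; [discriminate sz | | discriminate sz].
  congr nat_of_bool; rewrite [nth _ _ _]/=; apply/idP/asboolP; first by exists (S [:: n]).
  have [e [x E]] := cpair_surj n; subst n.
  have := hS [:: cpair e x] erefl; rewrite /= XE; set s := S _ => hs [t].
  rewrite !alphaFP; case: eqP => //= _ /andP[ht]; move: hs.
  case: asboolP => [_ /= hs|nD]; last by case: nD; apply: first_D ht.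
  by rewrite (first_uniq hs ht) ht.
- apply: (@Comp_ext _ _ (fun xs => bev [:: nth 0 xs 0; S xs] betaF)); last first.
    by apply: Comp_bev2 => //; apply: Comp_proj.
  move=> [|n [|? ?]] sz; [discriminate sz | | discriminate sz].
  congr nat_of_bool; rewrite [nth _ _ _]/=; apply/idP/asboolP; first by exists (S [:: n]).
  have [e [x E]] := cpair_surj n; subst n.
  have := hS [:: cpair e x] erefl; rewrite /= XE; set s := S _ => hs [t].
  rewrite !betaFP => /andP[ht]; move: hs.
  case: asboolP => [_ /= hs|nD]; last by case: nD; apply: first_D ht.
  by rewrite (first_uniq hs ht) ht.
Qed.

End Pair.

(** * Sizes of equivalence classes *)

(* The sentences are built from an abstract existential quantifier [X] and abstract atoms [e], [q], so that their translations under an interpretation have the same shape. *)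
Section SizeFormulas.
Variables (X : form -> form) (e q : nat -> nat -> form).

Fixpoint distinctF (i j : nat) : form :=
  if j is j'.+1 then And (Neg (q i j')) (distinctF i j') else Tru.

Fixpoint familyF (m i : nat) : form :=
  if i is i'.+1 then And (And (e i' m) (distinctF i' i')) (familyF m i') else Tru.

(** The k new quantifiers bind variables 0 to k - 1 and shift v to k + v. *)
Definition geF (k v : nat) : form := iter k X (familyF (k + v) k).
Definition sizeF (k v : nat) : form := And (geF k v) (Neg (geF k.+1 v)).
Definition existsF (n : nat) : form := X (sizeF n.+1 0).
End SizeFormulas.

Definition EF (i j : nat) : form := Rel 0 [:: Var i; Var j].
Definition QF (i j : nat) : form := Eq (Var i) (Var j).
Definition phi : nat -> form := existsF Ex EF QF.

Section Semantics.
Variable M : structure.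
Implicit Types x y : dom M.

Definition ER x y : Prop := rI 0 [:: x; y].

Definition Ge (k : nat) x : Prop := exists g : nat -> dom M,
  (forall i, i < k -> ER (g i) x) /\ forall i j, j < i -> i < k -> g i <> g j.

Definition Sz (k : nat) x : Prop := Ge k x /\ ~ Ge k.+1 x.

Lemma sat_Exs k a (e : nat -> dom M) : sat e (iter k Ex a) <->
  exists g : nat -> dom M, sat (fun n => if n < k then g n else e (n - k)) a.
Proof.
elim: k e => [|k IH] e.
  have E (g : nat -> dom M) : (fun n => if n < 0 then g n else e (n - 0)) = e.
    by apply: funext => n; rewrite subn0.
  by split=> [h|[g]]; [exists e|]; rewrite E.
rewrite iterS sat_Ex; split=> [[x /IH[g h]]|[g h]].
  exists (fun n => if n < k then g n else x).
  rewrite (_ : (fun n => _) = (fun n => if n < k then g n else (x .: e) (n - k))) //.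
  apply: funext => n; case: (ltngtP n k) => [lt|lt|->].
  - by rewrite ltnS (ltnW lt).
  - by rewrite ltnS leqNgt lt /= -(subnSK lt).
  - by rewrite ltnSn subnn.
exists (g k); apply/IH; exists g.
rewrite (_ : (fun n => _) = (fun n => if n < k.+1 then g n else e (n - k.+1))) //.
apply: funext => n; case: (ltngtP n k) => [lt|lt|->].
- by rewrite ltnS (ltnW lt).
- by rewrite ltnS leqNgt lt /= -(subnSK lt).
- by rewrite ltnSn subnn.
Qed.

Lemma sat_distinctF (e : nat -> dom M) i j :
  sat e (distinctF QF i j) <-> forall j', j' < j -> e i <> e j'.
Proof.
elim: j => [|j IH]; first by split=> // _; apply/sat_Tru.
rewrite [distinctF _ _ _]/= sat_And sat_Neg IH; split=> [[h1 h2] j'|h].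
  by rewrite ltnS leq_eqVlt => /orP[/eqP-> //|/h2].
by split=> [|j' lt]; apply: h => //; apply: ltnW.
Qed.

Lemma sat_familyF (e : nat -> dom M) m k : sat e (familyF EF QF m k) <->
  (forall i, i < k -> ER (e i) (e m)) /\ forall i j, j < i -> i < k -> e i <> e j.
Proof.
elim: k => [|k IH]; first by split=> // _; apply/sat_Tru.
rewrite [familyF _ _ _ _]/= !sat_And sat_distinctF IH.
split=> [[[h1 h2] [h3 h4]]|[h1 h2]]; split.
- by move=> i; rewrite ltnS leq_eqVlt => /orP[/eqP->|/h3].
- move=> i j lt; rewrite ltnS leq_eqVlt => /orP[/eqP Ei|]; last exact: h4.
  by rewrite Ei; apply: h2; rewrite -Ei.
- by split; [apply: (h1 k) | move=> j lt; apply: h2].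
- by split=> [i lt|i j lt lt']; [apply: h1 | apply: h2 => //]; apply: ltnW.
Qed.

Lemma sat_geF (e : nat -> dom M) k v : sat e (geF Ex EF QF k v) <-> Ge k (e v).
Proof.
rewrite sat_Exs; split=> -[g].
  move=> /sat_familyF; rewrite ltnNge leq_addr /= addKn => -[h1 h2]; exists g; split.
    by move=> i lt; have := h1 i lt; rewrite lt.
  by move=> i j lt lt'; have := h2 i j lt lt'; rewrite lt' (ltn_trans lt lt').
move=> [h1 h2]; exists g; apply/sat_familyF; rewrite ltnNge leq_addr /= addKn; split.
  by move=> i lt; rewrite lt; apply: h1.
by move=> i j lt lt'; rewrite lt' (ltn_trans lt lt'); apply: h2.
Qed.

Lemma sat_sizeF (e : nat -> dom M) k v : sat e (sizeF Ex EF QF k v) <-> Sz k (e v).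
Proof. by rewrite sat_And sat_Neg !sat_geF. Qed.

Lemma sat_phi (e : nat -> dom M) n : sat e (phi n) <-> exists x, Sz n.+1 x.
Proof. by rewrite sat_Ex; split=> -[x h]; exists x; apply/(sat_sizeF (x .: e) n.+1 0). Qed.

Lemma Ge_mono k l x : k <= l -> Ge l x -> Ge k x.
Proof.
move=> le [g [h1 h2]]; exists g; split=> [i lt|i j lt lt']; first by apply: h1; apply: leq_trans le.
by apply: h2 => //; apply: leq_trans le.
Qed.

Lemma Sz_uniq k l x : Sz k x -> Sz l x -> k = l.
Proof.
move=> [h1 h2] [h3 h4]; have [lt|lt|//] := ltngtP k l.
  by case: h2; apply: Ge_mono h3.
by case: h4; apply: Ge_mono h1.
Qed.

Lemma Sz_Ge k x l : Sz k x -> Ge l x <-> l <= k.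
Proof.
move=> [h1 h2]; split=> [h|le]; last exact: Ge_mono h1.
by rewrite leqNgt; apply/negP => lt; apply: h2; apply: Ge_mono h.
Qed.

Lemma Sz_exists l x : ~ Ge l x -> exists2 k, k < l & Sz k x.
Proof.
elim: l => [|l IH] h; first by case: h; exists (fun=> x).
have [hl|/IH[k lt hk]] := EM (Ge l x); first by exists l.
by exists k => //; apply: ltnW.
Qed.

Definition equivalence : Prop :=
  [/\ forall x, ER x x, forall x y, ER x y -> ER y x &
      forall x y z, ER x y -> ER y z -> ER x z].

Hypothesis eqM : equivalence.

Lemma Ge_ER k x y : ER x y -> Ge k x -> Ge k y.
Proof.
move: eqM => [_ _ tr] h [g [h1 h2]]; exists g; split=> // i lt.
exact: tr (h1 _ lt) h.
Qed.

Lemma Sz_ER k x y : ER x y -> Sz k x -> Sz k y.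
Proof.
move: eqM => [_ sy _] h [h1 h2]; split; first exact: Ge_ER h1.
by move=> h3; apply: h2; apply: Ge_ER h3; apply: sy.
Qed.

End Semantics.

(** The last clause supplies finite classes that the game cannot tell from infinite ones; for models
    of U it comes from row 1 of A. *)
Definition sized (M : structure) : Prop :=
  [/\ equivalence M, forall n (x y : dom M), Sz n.+1 x -> Sz n.+1 y -> ER x y &
      forall b, exists2 n, b <= n & exists x : dom M, Sz n.+1 x].

(** * Elementary equivalence *)

Fixpoint rank (a : form) : nat :=
  match a with
  | Imp a b => maxn (rank a) (rank b)
  | All a => (rank a).+1
  | _ => 0
  end.

Section Game.
Variable q : nat.

(** A partial isomorphism that remembers class sizes only up to q, where q bounds the number of
    elements ever chosen. *)
Definition Inv (M N : structure) (d : nat) (e : nat -> dom M) (e' : nat -> dom N) : Prop :=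
  (forall i j, i < d -> j < d ->
     (e i = e j <-> e' i = e' j) /\ (ER (e i) (e j) <-> ER (e' i) (e' j))) /\
  (forall i k, i < d -> k <= q -> Ge k (e i) <-> Ge k (e' i)).

Lemma Inv_sym M N d (e : nat -> dom M) (e' : nat -> dom N) : Inv d e e' -> Inv d e' e.
Proof. by move=> [h1 h2]; split=> [i j hi hj|i k hi hk]; [have := h1 i j hi hj | have := h2 i k hi hk]; tauto. Qed.

Section Step.
Variables M N : structure.
Hypotheses (sM : sized M) (sN : sized N).
Hypothesis agree : forall n, n < q -> (exists x : dom M, Sz n.+1 x) -> exists y : dom N, Sz n.+1 y.
Variables (d : nat) (e : nat -> dom M) (e' : nat -> dom N).
Hypothesis inv : Inv d e e'.
Hypothesis dq : d < q.

Lemma Inv_extend x y :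
  (forall j, j < d -> (x = e j <-> y = e' j) /\ (ER x (e j) <-> ER y (e' j))) ->
  (forall k, k <= q -> Ge k x <-> Ge k y) -> Inv d.+1 (x .: e) (y .: e').
Proof.
move: sM sN inv => [[rM yM tM] _ _] [[rN yN tN] _ _] [i1 i2] h1 h2; split.
  move=> [|i] [|j] /=; rewrite ?ltnS => hi hj.
  - by split=> //; split=> _.
  - exact: h1.
  - have [a1 a2] := h1 i hi; split; first by split=> /esym/a1/esym.
    by split=> [/yM/a2/yN|/yN/a2/yM].
  - exact: i1.
by move=> [|i] k hi hk; [apply: h2 | apply: i2].
Qed.

(** [J] lists the chosen members of the class once each, by least index. With x the class has at
    least |J| + 1 <= q elements, and so does its partner by [Inv]; but if the partner had only old
    members, they would be at most |J| many. *)
Lemma new_in_class i x : i < d -> ER x (e i) -> (forall j, j < d -> x <> e j) ->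
  exists2 y, ER y (e' i) & forall j, j < d -> y <> e' j.
Proof.
move: sM sN inv => [[rM yM tM] _ _] [[rN yN tN] _ _] [i1 i2] hi hx new.
apply: contrapT => none.
have all_old y : ER y (e' i) -> exists2 j, j < d & y = e' j.
  move=> hy; apply: contrapT => h; apply: none; exists y => // j hj E.
  by apply: h; exists j.
pose J := [seq j <- iota 0 d | `[< ER (e j) (e i) /\ forall j', j' < j -> e j' <> e j >]].
have memJ j : j \in J <-> j < d /\ ER (e j) (e i) /\ forall j', j' < j -> e j' <> e j.
  rewrite mem_filter mem_iota /=; split=> [/andP[/asboolP]|[h1 h2]] //.
  by apply/andP; split=> //; apply/asboolP.
have uJ : uniq J by rewrite filter_uniq // iota_uniq.
have ge : Ge (size J).+1 (e i).
  exists (fun n => if n is n'.+1 then e (nth 0 J n') else x); split.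
    by move=> [|n] //; rewrite ltnS => /(mem_nth 0)/memJ[_ []].
  move=> [//|n] j lt; rewrite ltnS => hn; have /memJ[h1 [h2 h3]] := mem_nth 0 hn.
  case: j lt => [|j] lt; first by move=> /esym; apply: new.
  have hj : j < size J by apply: ltn_trans hn.
  have /memJ[h4 [h5 h6]] := mem_nth 0 hj.
  have [lt'|lt'|/eqP] := ltngtP (nth 0 J n) (nth 0 J j).
  - exact: h6.
  - by move=> /esym; apply: h3.
  - by rewrite nth_uniq // => /eqP E; move: lt; rewrite E ltnn.
have {ge} [g [g1 g2]] : Ge (size J).+1 (e' i).
  rewrite -i2 //; apply: leq_trans dq; rewrite ltnS -[leqRHS](size_iota 0).
  by rewrite size_filter count_size.
have hf a : a < (size J).+1 -> exists2 j, j \in J & g a = e' j.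
  move=> ha; have ex : exists j, `[< j < d /\ g a = e' j >].
    by have [j h1 h2] := all_old _ (g1 _ ha); exists j; apply/asboolP.
  have [j /asboolP[h1 h2] min] := ex_minnP ex; exists j => //; apply/memJ; split=> //.
  split; first by apply/(i1 j i h1 hi).2; rewrite -h2; apply: g1.
  move=> j' lt E; have lt' := ltn_trans lt h1.
  suff : j <= j' by rewrite leqNgt lt.
  by apply: min; apply/asboolP; split=> //; rewrite h2; apply/esym/(i1 j' j lt' h1).1.
have [f hf'] : exists f : nat -> nat, forall a, a < (size J).+1 -> f a \in J /\ g a = e' (f a).
  have : forall a, exists j, a < (size J).+1 -> j \in J /\ g a = e' j.
    move=> a; case: (ltnP a (size J).+1) => [/hf[j h1 h2]|h]; last by exists 0.
    by exists j.
  by move=> /choice.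
have : size (map f (iota 0 (size J).+1)) <= size J.
  apply: uniq_leq_size.
    rewrite map_inj_in_uniq ?iota_uniq // => a b; rewrite !mem_iota /= => ha hb E.
    have Eg : g a = g b by rewrite (hf' a ha).2 (hf' b hb).2 E.
    by have [lt|lt|//] := ltngtP a b; [case: (g2 b a lt hb) | case: (g2 a b lt ha)].
  by move=> j /mapP[a]; rewrite mem_iota /= => ha ->; apply: (hf' a ha).1.
by rewrite size_map size_iota ltnn.
Qed.

(** A class with at least q elements is answered by a finite one that is larger than q and than
    every finite class met so far. A smaller class is answered by the one of equal size; that one
    has not been met, since a finite size determines its class. *)
Lemma new_class x : (forall j, j < d -> ~ ER x (e j)) ->
  exists2 y, (forall k, k <= q -> Ge k x <-> Ge k y) & forall j, j < d -> ~ ER y (e' j).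
Proof.
move: (sM) (sN) => [eM amM _] [eN amN infN] new.
have [big|/Sz_exists[[|n] lt hn]] := EM (Ge q x).
- have [b hb] : exists b, forall j s, j < d -> Sz s (e' j) -> s <= b.
    elim: d => [|d' [b hb]]; first by exists 0.
    have [[s hs]|no] := EM (exists s, Sz s (e' d')).
      exists (maxn b s) => j s'; rewrite ltnS leq_eqVlt => /orP[/eqP->|lt] h.
        by rewrite (Sz_uniq h hs) leq_maxr.
      by rewrite leq_max (hb _ _ lt h).
    exists b => j s; rewrite ltnS leq_eqVlt => /orP[/eqP->|lt] h; last exact: hb h.
    by case: no; exists s.
  have [n hn [y hy]] := infN (maxn b q); exists y => [k hk|j lt h].
    rewrite (Sz_Ge _ hy); split=> [_|_]; last exact: Ge_mono big.
    by apply: leq_trans hk _; apply: leq_trans (leqnSn _); apply: leq_trans hn; rewrite leq_maxr.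
  have := hb _ _ lt (Sz_ER eN h hy); rewrite geq_max in hn; move/andP: hn => [h1 _].
  by rewrite leqNgt ltnS h1.
- by case: hn => _ []; exists (fun=> x); split=> [|[]] //; case: eM.
- have [y hy] := agree (ltnW lt) (ex_intro _ x hn).
  exists y => [k _|j hj h]; first by rewrite (Sz_Ge _ hn) (Sz_Ge _ hy).
  apply: (new j hj); apply: amM hn _.
  have [h1 h2] := Sz_ER eN h hy; case: inv => _ i2.
  by split; [apply/(i2 j) => //; apply: ltnW | move=> h3; apply: h2; apply/(i2 j)].
Qed.

Lemma forth x : exists y, Inv d.+1 (x .: e) (y .: e').
Proof.
move: (sM) (sN) (inv) => [[rM yM tM] _ _] [[rN yN tN] _ _] [i1 i2].
have [[i hi ->]|new] := EM (exists2 i, i < d & x = e i).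
  by exists (e' i); apply: Inv_extend => [j hj|k hk]; [apply: i1 | apply: i2].
have {}new j : j < d -> x <> e j by move=> hj E; apply: new; exists j.
have [[i hi hx]|out] := EM (exists2 i, i < d & ER x (e i)).
  have [y hy newy] := new_in_class hi hx new.
  exists y; apply: Inv_extend => [j hj|k hk].
    split; first by split=> E; [case: (new j hj) | case: (newy j hj)].
    have [_ h] := i1 i j hi hj.
    split=> h'; [apply: (tN _ (e' i)) => // | apply: (tM _ (e i)) => //].
      by apply/h; apply: tM h'; apply: yM.
    by apply/h; apply: tN h'; apply: yN.
  have [to from] := i2 i k hi hk; split=> h.
    by apply: (Ge_ER _ (yN _ _ hy) (to _)); [case: sN | apply: Ge_ER hx h; case: sM].
  by apply: (Ge_ER _ (yM _ _ hx) (from _)); [case: sM | apply: Ge_ER hy h; case: sN].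
have {}out j : j < d -> ~ ER x (e j) by move=> hj E; apply: out; exists j.
have [y hy outy] := new_class out; exists y; apply: Inv_extend => // j hj.
split; split=> h.
- by case: (new j hj).
- by case: (outy j hj); rewrite h; apply: rN.
- by case: (out j hj).
- by case: (outy j hj).
Qed.

End Step.

Lemma elementary M N : sized M -> sized N ->
  (forall n, n < q -> (exists x : dom M, Sz n.+1 x) <-> exists y : dom N, Sz n.+1 y) ->
  forall d a, LEform d a -> rank a + d <= q ->
  forall (e : nat -> dom M) (e' : nat -> dom N), Inv d e e' -> sat e a <-> sat e' a.
Proof.
move=> sM sN agree d a; elim=> {d a} /=.
- by [].
- by move=> d i j hi hj _ e e' [h _]; apply: (h i j hi hj).1.
- by move=> d i j hi hj _ e e' [h _]; apply: (h i j hi hj).2.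
- move=> d a b _ IHa _ IHb; rewrite addn_maxl geq_max => /andP[ra rb] e e' h.
  by rewrite (IHa ra e e') // (IHb rb e e').
- move=> d a _ IH; rewrite addSnnS => hr e e' h.
  have dq : d < q by apply: leq_trans hr; rewrite leq_addl.
  split=> H x.
    have [y hy] := forth sN sM (fun n lt => (agree n lt).2) (Inv_sym h) dq x.
    by apply/(IH hr _ _ (Inv_sym hy)).
  have [y hy] := forth sM sN (fun n lt => (agree n lt).1) h dq x.
  by apply/(IH hr _ _ hy).
Qed.

End Game.

(** * The theory *)

Definition pad (p : nat) (a : form) : form := iter p (Imp Tru) a.

Definition reflF : form := All (EF 0 0).
Definition symF : form := All (All (Imp (EF 0 1) (EF 1 0))).
Definition transF : form := All (All (All (Imp (EF 0 1) (Imp (EF 1 2) (EF 0 2))))).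
Definition uniqF (n : nat) : form :=
  All (All (Imp (sizeF Ex EF QF n.+1 0) (Imp (sizeF Ex EF QF n.+1 1) (EF 0 1)))).

Lemma sat_pad M (e : nat -> dom M) p a : sat e (pad p a) <-> sat e a.
Proof. elim: p => //= p IH; rewrite IH; split=> [h|h _] //; exact: h. Qed.

Lemma LE_Neg d a : LEform d a -> LEform d (Neg a).
Proof. by move=> h; constructor => //; constructor. Qed.

Lemma LE_And d a b : LEform d a -> LEform d b -> LEform d (And a b).
Proof. by move=> ha hb; apply/LE_Neg/LE_Imp/LE_Neg. Qed.

Lemma LE_Tru d : LEform d Tru.
Proof. by apply: LE_Neg; constructor. Qed.

Lemma LE_Exs d k a : LEform (k + d) a -> LEform d (iter k Ex a).
Proof.
elim: k d => [|k IH] d // h; apply/LE_Neg/LE_All/LE_Neg/IH.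
by rewrite addnS.
Qed.

Lemma LE_distinctF d i j : i < d -> j <= d -> LEform d (distinctF QF i j).
Proof.
move=> hi; elim: j => [|j IH] hj; first exact: LE_Tru.
by apply: LE_And; [apply/LE_Neg/LE_Eq | apply/IH/ltnW].
Qed.

Lemma LE_familyF d m k : m < d -> k <= d -> LEform d (familyF EF QF m k).
Proof.
move=> hm; elim: k => [|k IH] hk; first exact: LE_Tru.
apply: LE_And; last by apply/IH/ltnW.
by apply: LE_And; [apply: LE_Rel | apply: LE_distinctF => //; apply: ltnW].
Qed.

Lemma LE_sizeF d k v : v < d -> LEform d (sizeF Ex EF QF k v).
Proof.
move=> hv; apply: LE_And; [|apply: LE_Neg]; apply/LE_Exs/LE_familyF;
  by rewrite ?ltn_add2l ?leq_addr.
Qed.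

Lemma LE_phi n : LEform 0 (phi n).
Proof. by apply/LE_Neg/LE_All/LE_Neg/LE_sizeF. Qed.

Lemma LE_pad d p a : LEform d a -> LEform d (pad p a).
Proof. by move=> h; elim: p => //= p IH; apply: LE_Imp => //; apply: LE_Tru. Qed.

Lemma sval_inj (T : Type) (P : T -> Prop) : injective (@sval T P).
Proof. by move=> [x hx] [y hy] /= E; apply: eq_exist. Qed.

Section Theory.
Variable q : prog.
Let A := inA q.
Let B := inB q.
Let D (x : nat) : Prop := exists v, eval emptyset q [:: x] v.

(* Padding by the witness makes the set of axioms decidable. *)
Inductive UAx : form -> Prop :=
| U_refl : UAx reflF
| U_sym : UAx symF
| U_trans : UAx transF
| U_uniq n : UAx (pad n (uniqF n))
| U_pos n s : bev [:: n; s] (alphaF q) -> UAx (pad (cpair n s) (phi n))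
| U_neg n s : bev [:: n; s] (betaF q) -> UAx (pad (cpair n s) (Neg (phi n))).

Lemma UAx_sentence a : UAx a -> sentence LE a.
Proof.
move=> h; apply/LEformP; case: h => {a}.
- by repeat constructor.
- by repeat constructor.
- by repeat constructor.
- move=> n; apply/LE_pad/LE_All/LE_All/LE_Imp; first exact: LE_sizeF.
  by apply: LE_Imp; [apply: LE_sizeF | apply: LE_Rel].
- by move=> n s _; apply/LE_pad/LE_phi.
- by move=> n s _; apply/LE_pad/LE_Neg/LE_phi.
Qed.

Lemma UAx_closed a : UAx a -> fbound 0 a.
Proof. by move=> /UAx_sentence[]. Qed.

Definition Utheory : theory := Theory LE (fun a => sentence LE a /\ prov UAx a).

Lemma is_theory_axioms L T : is_theory (Theory L (fun a => sentence L a /\ prov T a)).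
Proof.
move=> a /=; split=> [[h1 h2]|[h1 h2]]; split=> //; first by apply: pr_ax.
by apply: prov_mono h2 => b [].
Qed.

Definition Umodel (M : structure) : Prop :=
  [/\ equivalence M, forall n (x y : dom M), Sz n.+1 x -> Sz n.+1 y -> ER x y,
      forall n, A n -> exists x : dom M, Sz n.+1 x &
      forall n, B n -> ~ exists x : dom M, Sz n.+1 x].

Lemma UmodelP M : inhabited (dom M) -> models M UAx <-> Umodel M.
Proof.
move=> [x0]; split=> [h|[[r s t] am hA hB]].
  have h' a := h a ^~ (fun=> x0); split.
  - split=> [x|x y|x y z]; first exact: (h' _ U_refl).
      exact: (h' _ U_sym).
    exact: (h' _ U_trans).
  - move=> n x y hx hy; have := h' _ (U_uniq n); rewrite sat_pad => /(_ y x) H.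
    pose e := x .: (y .: (fun=> x0)).
    exact: H ((sat_sizeF e n.+1 0).2 hx) ((sat_sizeF e n.+1 1).2 hy).
  - by move=> n [s hs]; have := h' _ (U_pos hs); rewrite sat_pad sat_phi.
  - by move=> n [s hs]; have := h' _ (U_neg hs); rewrite sat_pad sat_Neg sat_phi.
move=> a; case=> {a}.
- by move=> e x; apply: r.
- by move=> e x y; apply: s.
- by move=> e x y z; apply: t.
- move=> n e; rewrite sat_pad => y x h1 h2; pose e2 := x .: (y .: e).
  exact: am ((sat_sizeF e2 n.+1 0).1 h1) ((sat_sizeF e2 n.+1 1).1 h2).
- by move=> n s' h e; rewrite sat_pad sat_phi; apply: hA; exists s'.
- by move=> n s' h e; rewrite sat_pad sat_Neg sat_phi; apply: hB; exists s'.
Qed.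

Lemma Umodel_sized M : Umodel M -> sized M.
Proof.
move=> [eq am hA _]; split=> // b; exists (cpair 1 b); first exact: cpair_ger.
by apply: hA; apply: inA_row1.
Qed.

(** * Canonical models *)

Section CanonicalModel.
Variable C : nat -> Prop.
Variable x0 : {p : nat * nat | C p.1 /\ p.2 <= p.1}.

(** One class {(n, i) : i <= n} for each n in C and no further classes. The point [x0] supplies
    values for the function symbols, which every structure interprets. *)
Definition canon : structure :=
  @Structure {p : nat * nat | C p.1 /\ p.2 <= p.1} (fun _ _ => x0)
    (fun _ l => if l is [:: x; y] then (sval x).1 = (sval y).1 else True).

Lemma canon_Ge (x : dom canon) k : Ge k x <-> k <= (sval x).1.+1.
Proof.
split=> [[g [h1 h2]]|hk].
  have : size (map (fun i => (sval (g i)).2) (iota 0 k)) <= size (iota 0 (sval x).1.+1).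
    apply: uniq_leq_size.
      rewrite map_inj_in_uniq ?iota_uniq // => i j; rewrite !mem_iota /= => hi hj E.
      have Eg : g i = g j.
        apply: sval_inj; move: (h1 i hi) (h1 j hj) => /= E1 E2.
        by move: E1 E2 E; case: (sval (g i)) => ? ?; case: (sval (g j)) => ? ? /= -> -> ->.
      by have [lt|lt|//] := ltngtP i j; [case: (h2 j i lt hj) | case: (h2 i j lt hi)].
    move=> j /mapP[i]; rewrite !mem_iota /= => hi ->; rewrite add0n ltnS -(h1 i hi).
    by case: (svalP (g i)).
  by rewrite size_map !size_iota.
have [Cx _] := svalP x.
pose g i : dom canon := if pselect (i <= (sval x).1) is left h
  then exist _ ((sval x).1, i) (conj Cx h) else x.
have gE i : i < k -> sval (g i) = ((sval x).1, i).
  by move=> lt; rewrite /g; case: pselect => // -[]; rewrite -ltnS; apply: leq_trans hk.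
exists g; split=> [i hi|i j lt hi E]; first by rewrite /ER /= gE.
by have := gE i hi; rewrite E gE ?(ltn_trans lt) // => -[E']; rewrite E' ltnn in lt.
Qed.

Lemma canon_Sz (x : dom canon) n : Sz n.+1 x <-> (sval x).1 = n.
Proof.
rewrite /Sz !canon_Ge; split=> [[h1 h2]|->]; last by rewrite ltnn ltnSn.
by move/negP: h2; lia.
Qed.

Lemma canon_exists n : (exists x : dom canon, Sz n.+1 x) <-> C n.
Proof.
split=> [[x /canon_Sz <-]|h]; first by case: (svalP x).
by exists (exist _ (n, 0) (conj h (leq0n n))); apply/canon_Sz.
Qed.

Lemma canon_model : (forall n, A n -> C n) -> (forall n, B n -> ~ C n) -> models canon UAx.
Proof.
move=> AC BC; apply/UmodelP; first exact: inhabits x0.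
split.
- by split=> [x|x y|x y z] //; rewrite /ER /= => ->.
- by move=> n x y /canon_Sz h1 /canon_Sz h2; rewrite /ER /= h1 h2.
- by move=> n /AC h; apply/canon_exists.
- by move=> n /BC h; rewrite canon_exists.
Qed.
End CanonicalModel.

Lemma canon_intro (C : nat -> Prop) : (forall n, A n -> C n) -> (forall n, B n -> ~ C n) ->
  exists2 M, models M UAx /\ inhabited (dom M) & forall n, (exists x : dom M, Sz n.+1 x) <-> C n.
Proof.
move=> AC BC; have h := AC _ (inA_row1 q 0).
pose x0 : {p : nat * nat | C p.1 /\ p.2 <= p.1} := exist _ (cpair 1 0, 0) (conj h (leq0n _)).
exists (canon x0); last exact: canon_exists.
by split; [apply: canon_model | exact: inhabits x0].
Qed.

(** The canonical model for C = A realizes precisely the sizes that U is forced to have. *)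
Lemma prov_phi n : prov UAx (phi n) <-> A n.
Proof.
split=> [h|An].
  have [|M [hM [x]] hC] := @canon_intro A (fun n h => h).
    by move=> m [t ht] [s hs]; have := alpha_beta t hs; rewrite ht.
  by apply/hC; apply/(sat_phi (fun=> x)); apply: soundness h _.
apply: (completeness UAx_closed) => M hM e.
have [_ _ hA _] := (UmodelP (inhabits (e 0))).1 hM.
by apply/sat_phi/hA.
Qed.

Lemma prov_Neg_phi n : B n -> prov UAx (Neg (phi n)).
Proof.
move=> Bn; apply: (completeness UAx_closed) => M hM e.
have [_ _ _ hB] := (UmodelP (inhabits (e 0))).1 hM.
by apply/sat_Neg; rewrite sat_phi; apply: hB.
Qed.

Lemma Utheory_consistent : consistent Utheory.
Proof.
have [|M [hM hx] _] := @canon_intro A (fun n h => h).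
  by move=> m [t ht] [s hs]; have := alpha_beta t hs; rewrite ht.
by move=> [_]; apply: models_consistent hM.
Qed.

(* [X] is a guess at the set of the n < r such that a class of size n + 1 exists. *)
Fixpoint chiF (r : nat) (X : nat -> bool) (a : form) : form :=
  if r is r'.+1 then Imp (if X r' then phi r' else Neg (phi r')) (chiF r' X a) else Neg a.

Definition admissible (r : nat) (X : nat -> bool) : Prop :=
  forall i, i < r -> if X i then ~ B i else ~ A i.

Lemma sat_chiF M (e : nat -> dom M) r X a : sat e (chiF r X a) <->
  ((forall i, i < r -> X i <-> exists x : dom M, Sz i.+1 x) -> ~ sat e a).
Proof.
elim: r => [|r IH] /=; first by split=> [h _ //|h]; apply: h.
rewrite -/(phi r) IH.
have E : sat e (if X r then phi r else Neg (phi r)) <-> (X r <-> exists x : dom M, Sz r.+1 x).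
  case: (X r); first by rewrite sat_phi; split=> [h|[h _]]; [split | apply: h].
  by rewrite sat_Neg sat_phi; split=> [h|[_ h] /h].
rewrite E; split=> [h1 h2|h1 h2 h3].
  by apply: h1 => [|i lt]; apply: h2; rewrite // ltnW.
by apply: h1 => i; rewrite ltnS leq_eqVlt => /orP[/eqP->|/h3].
Qed.

(** The canonical model for the guess X below r and for A from r on is a model of U, by
    admissibility, and the guess is correct in it. *)
Lemma refute_sound r X a : admissible r X -> prov UAx (chiF r X a) -> ~ prov UAx a.
Proof.
move=> adm h1 h2; pose C i := if i < r then X i : Prop else A i.
have [||M [hM [x]] hC] := @canon_intro C.
- move=> n hn; rewrite /C; case: ifP => // /adm; by case: (X n).
- move=> n hn; rewrite /C; case: ifP => [/adm|_]; first by case: (X n).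
  by move: hn => [s hs] [t ht]; have := alpha_beta s ht; rewrite hs.
have /sat_chiF := soundness hM h1 (fun=> x); apply; last exact: soundness h2 _.
by move=> i lt; rewrite hC /C lt.
Qed.

(** The guess is read off a countermodel of [a], up to the rank of [a]. By [elementary], every model
    of U with the same pattern then fails [a] as well. *)
Lemma refute_complete a : sentence LE a -> ~ prov UAx a ->
  exists r X, admissible r X /\ prov UAx (chiF r X a).
Proof.
move=> /LEformP ha np; apply: contrapT => none; apply: np.
apply: (completeness UAx_closed) => M hM e; apply: contrapT => nsat.
have uM := (UmodelP (inhabits (e 0))).1 hM.
apply: none; exists (rank a), (fun i => `[< exists x : dom M, Sz i.+1 x >]); split.
  move=> i lt; have [_ _ hA hB] := uM; case: asboolP => h hi; first exact: hB hi h.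
  exact: h (hA _ hi).
apply: (completeness UAx_closed) => N hN e'; apply/sat_chiF => h h'.
have uN := (UmodelP (inhabits (e' 0))).1 hN.
apply: nsat; apply/(@elementary (rank a) N M _ _ _ 0 a ha _ e' e) => //.
- exact: Umodel_sized.
- exact: Umodel_sized.
- by move=> n /h <-; split=> /asboolP.
- by rewrite addn0.
Qed.

End Theory.

(** * Decision procedures *)

(** The constructors on codes: they turn recursions that build formulas into recursions on
    numbers. *)
Definition cImp (a b : nat) : nat := (cpair 2 (cpair a b)).+1.
Definition cAll (a : nat) : nat := (cpair 3 a).+1.
Definition cEq (t u : nat) : nat := (cpair 0 (cpair t u)).+1.
Definition cNeg (a : nat) : nat := cImp a 0.
Definition cAnd (a b : nat) : nat := cNeg (cImp a (cNeg b)).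
Definition cEx (a : nat) : nat := cNeg (cAll (cNeg a)).
Definition cTru : nat := cNeg 0.

Section CompCode.
Variable O : nat -> Prop.

Lemma Comp_cImp k F G : Comp O k F -> Comp O k G -> Comp O k (fun xs => cImp (F xs) (G xs)).
Proof. by move=> hF hG; apply/Comp_S/Comp_cpair; [apply: Comp_const | apply: Comp_cpair]. Qed.

Lemma Comp_cEq k F G : Comp O k F -> Comp O k G -> Comp O k (fun xs => cEq (F xs) (G xs)).
Proof. by move=> hF hG; apply/Comp_S/Comp_cpair; [apply: Comp_const | apply: Comp_cpair]. Qed.

Lemma Comp_cAll k F : Comp O k F -> Comp O k (fun xs => cAll (F xs)).
Proof. by move=> hF; apply/Comp_S/Comp_cpair => //; apply: Comp_const. Qed.

Lemma Comp_cNeg k F : Comp O k F -> Comp O k (fun xs => cNeg (F xs)).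
Proof. by move=> hF; apply: Comp_cImp => //; apply: Comp_const. Qed.

Lemma Comp_cAnd k F G : Comp O k F -> Comp O k G -> Comp O k (fun xs => cAnd (F xs) (G xs)).
Proof. by move=> hF hG; apply/Comp_cNeg/Comp_cImp => //; apply: Comp_cNeg. Qed.

Lemma Comp_cEx k F : Comp O k F -> Comp O k (fun xs => cEx (F xs)).
Proof. by move=> hF; apply/Comp_cNeg/Comp_cAll/Comp_cNeg. Qed.

Section Sizes.
Variables (X : form -> form) (e q : nat -> nat -> form) (cX : nat -> nat) (ce cq : nat -> nat -> nat).
Hypothesis XE : forall a, code_f (X a) = cX (code_f a).
Hypothesis eE : forall i j, code_f (e i j) = ce i j.
Hypothesis qE : forall i j, code_f (q i j) = cq i j.
Hypothesis hX : Comp O 1 (fun xs => cX (nth 0 xs 0)).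
Hypothesis he : Comp O 2 (fun xs => ce (nth 0 xs 0) (nth 0 xs 1)).
Hypothesis hq : Comp O 2 (fun xs => cq (nth 0 xs 0) (nth 0 xs 1)).

Lemma Comp_distinctF k F G : Comp O k F -> Comp O k G ->
  Comp O k (fun xs => code_f (distinctF q (F xs) (G xs))).
Proof.
apply: (@Comp_app2 O k (fun i j => code_f (distinctF q i j))).
apply: Comp_ext (@Comp_rec O 2 (fun _ => cTru)
  (fun ys => cAnd (cNeg (cq (nth 0 ys 2) (nth 0 ys 0))) (nth 0 ys 1)) (fun xs => nth 0 xs 1) _ _ _).
- by move=> xs _; elim: (nth 0 xs 1) => // j /= ->; rewrite -qE.
- exact: Comp_const.
- by apply: Comp_cAnd; [apply/Comp_cNeg/(Comp_app2 hq)|]; apply: Comp_proj.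
- exact: Comp_proj.
Qed.

Lemma Comp_familyF k F G : Comp O k F -> Comp O k G ->
  Comp O k (fun xs => code_f (familyF e q (F xs) (G xs))).
Proof.
apply: (@Comp_app2 O k (fun i j => code_f (familyF e q i j))).
apply: Comp_ext (@Comp_rec O 2 (fun _ => cTru)
  (fun ys => cAnd (cAnd (ce (nth 0 ys 0) (nth 0 ys 2))
                        (code_f (distinctF q (nth 0 ys 0) (nth 0 ys 0)))) (nth 0 ys 1))
  (fun xs => nth 0 xs 1) _ _ _).
- by move=> xs _; elim: (nth 0 xs 1) => // j /= ->; rewrite -eE.
- exact: Comp_const.
- by apply: Comp_cAnd; [apply: Comp_cAnd; [apply: (Comp_app2 he)|apply: Comp_distinctF]|]; apply: Comp_proj.
- exact: Comp_proj.
Qed.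

Lemma Comp_geF k F G : Comp O k F -> Comp O k G ->
  Comp O k (fun xs => code_f (geF X e q (F xs) (G xs))).
Proof.
apply: (@Comp_app2 O k (fun i j => code_f (geF X e q i j))).
apply: Comp_ext (@Comp_rec O 2
  (fun xs => code_f (familyF e q (nth 0 xs 0 + nth 0 xs 1) (nth 0 xs 0)))
  (fun ys => cX (nth 0 ys 1)) (fun xs => nth 0 xs 0) _ _ _).
- move=> xs _; rewrite /geF; move: (familyF _ _ _ _) => a.
  by elim: (nth 0 xs 0) => // j /= ->.
- by apply: Comp_familyF; [apply: Comp_add|]; apply: Comp_proj.
- by apply: (Comp_app1 hX); apply: Comp_proj.
- exact: Comp_proj.
Qed.

Lemma Comp_sizeF k F G : Comp O k F -> Comp O k G ->
  Comp O k (fun xs => code_f (sizeF X e q (F xs) (G xs))).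
Proof.
move=> hF hG; apply: (@Comp_cAnd k (fun xs => code_f (geF X e q (F xs) (G xs)))
  (fun xs => cNeg (code_f (geF X e q (F xs).+1 (G xs))))).
  exact: Comp_geF.
by apply/Comp_cNeg/Comp_geF => //; apply: Comp_S.
Qed.

Lemma Comp_existsF k F : Comp O k F -> Comp O k (fun xs => code_f (existsF X e q (F xs))).
Proof.
move=> hF; apply: (@Comp_ext O k (fun xs => cX (code_f (sizeF X e q (F xs).+1 0)))).
  by move=> xs _; rewrite /existsF XE.
by apply: (Comp_app1 hX); apply: Comp_sizeF; [apply: Comp_S | apply: Comp_const].
Qed.

End Sizes.

Definition cVar (i : nat) : nat := cpair 0 i.

Definition cEF (i j : nat) : nat :=
  (cpair 1 (cpair 0 (cpair (cVar i) (cpair (cVar j) 0).+1).+1)).+1.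
Definition cQF (i j : nat) : nat := cEq (cVar i) (cVar j).

Lemma Comp_cVar k F : Comp O k F -> Comp O k (fun xs => cVar (F xs)).
Proof. by apply: Comp_cpair; apply: Comp_const. Qed.

Lemma Comp_cEF : Comp O 2 (fun xs => cEF (nth 0 xs 0) (nth 0 xs 1)).
Proof.
by apply/Comp_S/Comp_cpair; [|apply: Comp_cpair; [|apply/Comp_S/Comp_cpair;
  [|apply/Comp_S/Comp_cpair]]]; do ?[apply: Comp_cVar]; by [apply: Comp_const | apply: Comp_proj].
Qed.

Lemma Comp_cQF : Comp O 2 (fun xs => cQF (nth 0 xs 0) (nth 0 xs 1)).
Proof. by apply: Comp_cEq; apply: Comp_cVar; apply: Comp_proj. Qed.

Lemma Comp_cEx1 : Comp O 1 (fun xs => cEx (nth 0 xs 0)).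
Proof. by apply/Comp_cEx/Comp_proj. Qed.

Lemma Comp_phi k F : Comp O k F -> Comp O k (fun xs => code_f (phi (F xs))).
Proof.
apply: (Comp_existsF (cX := cEx) (ce := cEF) (cq := cQF)) => //.
- exact: Comp_cEx1.
- exact: Comp_cEF.
- exact: Comp_cQF.
Qed.

Lemma Comp_uniqF k F : Comp O k F -> Comp O k (fun xs => code_f (uniqF (F xs))).
Proof.
move=> hF.
have hS v : Comp O k (fun xs => code_f (sizeF Ex EF QF (F xs).+1 v)).
  apply: (Comp_sizeF (cX := cEx) (ce := cEF) (cq := cQF)) => //.
  - exact: Comp_cEx1.
  - exact: Comp_cEF.
  - exact: Comp_cQF.
  - exact: Comp_S.
  - exact: Comp_const.
pose S v xs := code_f (sizeF Ex EF QF (F xs).+1 v).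
apply: (@Comp_cAll k (fun xs => cAll (cImp (S 0 xs) (cImp (S 1 xs) (code_f (EF 0 1)))))).
apply: Comp_cAll; apply: Comp_cImp; first exact: hS.
by apply: Comp_cImp; [exact: hS | exact: (Comp_const _ _ (code_f (EF 0 1)))].
Qed.

Lemma Comp_pad k F (a : seq nat -> form) : Comp O k F -> Comp O k (fun xs => code_f (a xs)) ->
  Comp O k (fun xs => code_f (pad (F xs) (a xs))).
Proof.
move=> hF ha; apply: Comp_ext (@Comp_rec O k (fun xs => code_f (a xs))
  (fun ys => cImp cTru (nth 0 ys 1)) F ha _ hF).
  by move=> xs _; elim: (F xs) => //= n ->.
by apply: Comp_cImp; [apply: Comp_const | apply: Comp_proj].
Qed.

Lemma CompB_dvd k F G : Comp O k F -> Comp O k G -> CompB O k (fun xs => F xs %| G xs).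
Proof.
apply: (@Comp_app2 O k (fun x y => nat_of_bool (x %| y))).
apply: (@Comp_ext O 2 (fun xs => has (fun i => (fun ys => nth 0 ys 0 * nth 0 ys 1 == nth 0 ys 2) (i :: xs))
   (iota 0 (nth 0 xs 1).+1))); last first.
  apply: (@CompB_has O 2 (fun ys => nth 0 ys 0 * nth 0 ys 1 == nth 0 ys 2)
    (fun xs => (nth 0 xs 1).+1)); last by apply/Comp_S/Comp_proj.
  by apply: CompB_eq; [apply: Comp_mul|]; apply: Comp_proj.
move=> xs _; congr nat_of_bool; apply/hasP/dvdnP => [[k' _ /eqP /= E]|[m E]]; first by exists k'.
have [y0|ypos] := posnP (nth 0 xs 1).
  by exists 0; rewrite ?mem_iota //= y0 mul0n.
exists m; last by rewrite /= E.
by rewrite mem_iota /= ltnS E leq_pmulr //; case: (nth 0 xs 0) E ypos => //; lia.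
Qed.

End CompCode.

(** Craig's trick: the padding, and with it the witness for membership in A or B, is found by a
    search bounded by the code of the axiom. *)
Lemma pad_code_ge p a : p <= code_f (pad p a).
Proof.
elim: p => // p IH; rewrite -[code_f _]/(cImp (code_f Tru) (code_f (pad p a))) ltnS.
exact: leq_trans IH (leq_trans (cpair_ger (code_f Tru) _) (cpair_ger 2 _)).
Qed.

Section Decision.
Variable q : prog.
Let A := inA q.
Let B := inB q.
Let D (x : nat) : Prop := exists v, eval emptyset q [:: x] v.

Definition axb (c : nat) : bool :=
  [|| c == code_f reflF, c == code_f symF, c == code_f transF,
      has (fun n => c == code_f (pad n (uniqF n))) (iota 0 c.+1) |
      has (fun p => has (fun n => has (fun s => (p == cpair n s) &&
        (bev [:: n; s] (alphaF q) && (c == code_f (pad p (phi n))) ||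
         bev [:: n; s] (betaF q) && (c == code_f (pad p (Neg (phi n))))))
      (iota 0 p.+1)) (iota 0 p.+1)) (iota 0 c.+1)].

(* Opacity keeps conversion from evaluating codes of closed formulas to unary numerals. *)
Local Opaque code_f.
Lemma axbP c : reflect (codes (UAx q) c) (axb c).
Proof.
apply: (iffP idP).
  move=> /or4P[/eqP->|/eqP->|/eqP->|/orP[/hasP[n _ /eqP->]|]].
  - by exists reflF; split=> //; constructor.
  - by exists symF; split=> //; constructor.
  - by exists transF; split=> //; constructor.
  - by exists (pad n (uniqF n)); split=> //; constructor.
  move=> /hasP[p _ /hasP[n _ /hasP[s _ /andP[/eqP-> /orP[] /andP[h /eqP->]]]]].
  - by exists (pad (cpair n s) (phi n)); split=> //; constructor.
  - by exists (pad (cpair n s) (Neg (phi n))); split=> //; constructor.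
have ge p a : p \in iota 0 (code_f (pad p a)).+1 by rewrite mem_iota /= ltnS pad_code_ge.
have gel n s : n \in iota 0 (cpair n s).+1 by rewrite mem_iota /= ltnS cpair_gel.
have ger n s : s \in iota 0 (cpair n s).+1 by rewrite mem_iota /= ltnS cpair_ger.
move=> [a [<- h]]; rewrite /axb; case: h => {a}.
- apply/orP; left; exact: eqxx.
- apply/orP; right; apply/orP; left; exact: eqxx.
- do 2 (apply/orP; right); apply/orP; left; exact: eqxx.
- move=> n; do 3 (apply/orP; right); apply/orP; left.
  by apply/hasP; exists n; [exact: ge | exact: eqxx].
- move=> n s h; do 4 (apply/orP; right).
  apply/hasP; exists (cpair n s); first exact: ge.
  apply/hasP; exists n; first exact: gel.
  apply/hasP; exists s; first exact: ger.
  apply/andP; split; first exact: eqxx.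
  apply/orP; left; apply/andP; split; [exact: h | exact: eqxx].
- move=> n s h; do 4 (apply/orP; right).
  apply/hasP; exists (cpair n s); first exact: ge.
  apply/hasP; exists n; first exact: gel.
  apply/hasP; exists s; first exact: ger.
  apply/andP; split; first exact: eqxx.
  apply/orP; right; apply/andP; split; [exact: h | exact: eqxx].
Qed.

Local Transparent code_f.

Lemma CompB_axb O : CompB O 1 (fun xs => axb (nth 0 xs 0)).
Proof.
have P i k : Comp O k (fun xs => nth 0 xs i) by apply: Comp_proj.
have C n k : Comp O k (fun xs => n) by apply: Comp_const.
do 3 (apply: CompB_or; first by apply: CompB_eq).
apply: CompB_or.
  apply: (@CompB_has O 1 (fun ys => nth 0 ys 1 == code_f (pad (nth 0 ys 0) (uniqF (nth 0 ys 0))))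
    (fun xs => (nth 0 xs 0).+1)); last exact: Comp_S.
  by apply: CompB_eq => //; apply: Comp_pad => //; apply: Comp_uniqF.
apply: (@CompB_has O 1 (fun ys => has (fun n => has (fun s => (nth 0 ys 0 == cpair n s) &&
        (bev [:: n; s] (alphaF q) && (nth 0 ys 1 == code_f (pad (nth 0 ys 0) (phi n))) ||
         bev [:: n; s] (betaF q) && (nth 0 ys 1 == code_f (pad (nth 0 ys 0) (Neg (phi n))))))
      (iota 0 (nth 0 ys 0).+1)) (iota 0 (nth 0 ys 0).+1))
  (fun xs => (nth 0 xs 0).+1)); last exact: Comp_S.
apply: (@CompB_has O 2 (fun ys => has (fun s => (nth 0 ys 1 == cpair (nth 0 ys 0) s) &&
        (bev [:: nth 0 ys 0; s] (alphaF q) && (nth 0 ys 2 == code_f (pad (nth 0 ys 1) (phi (nth 0 ys 0)))) ||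
         bev [:: nth 0 ys 0; s] (betaF q) && (nth 0 ys 2 == code_f (pad (nth 0 ys 1) (Neg (phi (nth 0 ys 0)))))))
      (iota 0 (nth 0 ys 1).+1))
  (fun xs => (nth 0 xs 0).+1)); last exact: Comp_S.
apply: (@CompB_has O 3 (fun ys => (nth 0 ys 2 == cpair (nth 0 ys 1) (nth 0 ys 0)) &&
        (bev [:: nth 0 ys 1; nth 0 ys 0] (alphaF q) && (nth 0 ys 3 == code_f (pad (nth 0 ys 2) (phi (nth 0 ys 1)))) ||
         bev [:: nth 0 ys 1; nth 0 ys 0] (betaF q) && (nth 0 ys 3 == code_f (pad (nth 0 ys 2) (Neg (phi (nth 0 ys 1)))))))
  (fun xs => (nth 0 xs 1).+1)); last exact: Comp_S.
apply: CompB_and; first by apply: CompB_eq => //; apply: Comp_cpair.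
apply: CompB_or; apply: CompB_and; try by apply: Comp_bev2.
  by apply: CompB_eq => //; apply: Comp_pad => //; apply: Comp_phi.
apply: CompB_eq => //; apply: Comp_pad => //.
by apply: (@Comp_cNeg O 4 (fun xs => code_f (phi (nth 0 xs 1)))); apply: Comp_phi.
Qed.

Lemma computable_axioms : computable (codes (UAx q)).
Proof.
apply/Treducible_Comp; apply: Comp_ext (CompB_axb emptyset) => xs _.
by congr nat_of_bool; apply/axbP/asboolP.
Qed.

End Decision.

Definition decides (p : prog) (A : nat -> Prop) : Prop :=
  forall n, (A n -> eval emptyset p [:: n] 1) /\ (~ A n -> eval emptyset p [:: n] 0).

Lemma decides_eval p A n : decides p A -> eval emptyset p [:: n] 1 <-> A n.
Proof.
move=> dp; have [h1 h2] := dp n; split=> [h|//]; apply: contrapT => /h2 h3.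
by have := eval_det h h3.
Qed.

Lemma H_prov_iff p T a : decides p (codes T) -> H 9 [:: code_prog p; code_f a] <-> prov T a.
Proof.
move=> dp; split=> [h|]; last first.
  by apply: H_prov => b Tb; apply/(decides_eval _ dp)/codes_code.
have /(_ p T erefl) := H_sound h; case=> [n /(decides_eval _ dp) //|b /code_f_inj -> //].
Qed.

Lemma H_sentence n : H 10 [:: 0; n] <-> exists2 a, code_f a = n & sentence LE a.
Proof.
split=> [/H_sound //|[a E h]]; case: (H_form_dec 0 n) => // /H_sound /(_ a E).
by case: h => h1 h2; case.
Qed.

Lemma H_nsentence n : H 11 [:: 0; n] <-> ~ exists2 a, code_f a = n & sentence LE a.
Proof.
split=> [/H_sound h [a E [h1 h2]]|]; first by apply: (h a E).
by case: (H_form_dec 0 n) => // /H_sentence.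
Qed.

Section CompFacts.
Variable O : nat -> Prop.

Lemma CompB_step k F G : Comp O k F -> Comp O k G -> CompB O k (fun xs => step (F xs) (G xs)).
Proof.
move=> hF hG; apply: Comp_ext (Comp_bev2 (stepF (PatV 0) 1) hF hG) => xs _.
by rewrite stepFP.
Qed.

Lemma Comp_fact2 r k F G : Comp O k F -> Comp O k G ->
  Comp O k (fun xs => fact r [:: F xs; G xs]).
Proof.
move=> hF hG; apply: Comp_cpair; first exact: Comp_const.
apply/Comp_S/Comp_cpair => //; apply/Comp_S/Comp_cpair => //; exact: Comp_const.
Qed.

Lemma CompB_inset k F G J : Comp O k F -> Comp O k G -> Comp O k J ->
  CompB O k (fun xs => inset (F xs) (G xs) (J xs)).
Proof.
by move=> hF hG hJ; apply: CompB_dvd => //; apply/Comp_S/Comp_mul => //; apply: Comp_S.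
Qed.
End CompFacts.

(** * Turing equivalence of the theory and D *)

Section Reduction.
Variable q : prog.
Let A := inA q.
Let B := inB q.
Let D (x : nat) : Prop := exists v, eval emptyset q [:: x] v.

(** Row 0 of A is a copy of D, and U proves [phi n] exactly for n in A. *)
Lemma prov_reduces : Treducible D (codes (th_set (Utheory q))).
Proof.
apply/Treducible_Comp.
have cf : Comp (codes (th_set (Utheory q))) 1 (fun xs => code_f (phi (cpair 0 (nth 0 xs 0)))).
  by apply/Comp_phi/Comp_cpair; [apply: Comp_const | apply: Comp_proj].
apply: Comp_ext (Comp_oracle cf) => xs _; congr nat_of_bool.
apply/asboolP/asboolP; rewrite codes_code /=.
  by move=> [_ /prov_phi /inA_row0].
move=> h; split; last by apply/prov_phi/inA_row0.
exact/LEformP/LE_phi.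
Qed.

(** The guess is coded by a pair a, b, so that a search over guesses becomes a search over
    numbers. *)
Definition chi (r a b m : nat) : nat :=
  nat_rect (fun=> nat) m
    (fun i c => cImp (if inset a b i then code_f (phi i) else cNeg (code_f (phi i))) c) r.

Lemma code_chiF r a b f : code_f (chiF r (inset a b) f) = chi r a b (code_f (Neg f)).
Proof.
elim: r => [//|r IH]; rewrite -[LHS]/(cImp (code_f (if inset a b r then phi r else Neg (phi r)))
  (code_f (chiF r (inset a b) f))) IH.
by rewrite -[RHS]/(cImp (if inset a b r then code_f (phi r) else cNeg (code_f (phi r)))
  (chi r a b (code_f (Neg f)))); congr cImp; case: inset.
Qed.

Lemma Comp_chi O k F G J L : Comp O k F -> Comp O k G -> Comp O k J -> Comp O k L ->
  Comp O k (fun xs => chi (F xs) (G xs) (J xs) (L xs)).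
Proof.
move=> hF hG hJ hL; apply: (@Comp_comp O 4 k (fun ys => chi (nth 0 ys 0) (nth 0 ys 1)
  (nth 0 ys 2) (nth 0 ys 3)) [:: F; G; J; L]) => //.
apply: (@Comp_rec O 4 (fun xs => nth 0 xs 3) (fun ys => cImp (if inset (nth 0 ys 3) (nth 0 ys 4) (nth 0 ys 0)
  then code_f (phi (nth 0 ys 0)) else cNeg (code_f (phi (nth 0 ys 0)))) (nth 0 ys 1)) (fun xs => nth 0 xs 0));
  try exact: Comp_proj.
apply: Comp_cImp; last exact: Comp_proj.
apply: Comp_if; first by apply: CompB_inset; apply: Comp_proj.
  exact/Comp_phi/Comp_proj.
exact/Comp_cNeg/Comp_phi/Comp_proj.
Qed.

(** Here alone the search of [reduces_prov] consults the oracle: A and B are decided below r. *)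
Definition admb (r a b : nat) : bool :=
  all (fun i => if inset a b i then ~~ `[< B i >] else ~~ `[< A i >]) (iota 0 r).

Lemma admbP r a b : admb r a b <-> admissible q r (inset a b).
Proof.
split=> [/allP h i lt|h]; last apply/allP => i.
  by have := h i; rewrite mem_iota => /(_ lt); case: inset => /asboolPn.
by rewrite mem_iota /= add0n => /h; case: inset => h'; apply/asboolPn.
Qed.

Lemma CompB_admb k F G J : Comp D k F -> Comp D k G -> Comp D k J ->
  CompB D k (fun xs => admb (F xs) (G xs) (J xs)).
Proof.
have [cA cB] := inA_inB_computable q.
apply: (@Comp_app3 D k (fun x y z => nat_of_bool (admb x y z))).
have P i m : Comp D m (fun xs => nth 0 xs i) by apply: Comp_proj.
apply: (@CompB_all D 3 (fun ys => if inset (nth 0 ys 2) (nth 0 ys 3) (nth 0 ys 0)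
  then ~~ `[< B (nth 0 ys 0) >] else ~~ `[< A (nth 0 ys 0) >]) (fun xs => nth 0 xs 0)) => //.
apply: (@Comp_ext _ _ (fun ys => if inset (nth 0 ys 2) (nth 0 ys 3) (nth 0 ys 0)
  then nat_of_bool (~~ `[< B (nth 0 ys 0) >]) else nat_of_bool (~~ `[< A (nth 0 ys 0) >]))).
  by move=> xs _; case: inset.
apply: Comp_if; first exact: CompB_inset.
  by apply: CompB_neg; apply: (@Comp_app1 D 4 (fun n => nat_of_bool `[< B n >])).
by apply: CompB_neg; apply: (@Comp_app1 D 4 (fun n => nat_of_bool `[< A n >])).
Qed.

Lemma refute_coded f : sentence LE f -> ~ prov (UAx q) f ->
  exists r a b, admissible q r (inset a b) /\ prov (UAx q) (chiF r (inset a b) f).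
Proof.
move=> sf /(refute_complete sf)[r [X [adm h]]].
have [|a [b hab]] := @inset_exists [seq i <- iota 0 r | X i] r.
  by move=> u; rewrite mem_filter mem_iota /= add0n => /andP[_ /ltnW].
have E i : i < r -> inset a b i = X i.
  by move=> lt; rewrite hab; [rewrite mem_filter mem_iota /= add0n lt andbT | apply: ltnW].
exists r, a, b; split; first by move=> i lt; rewrite E //; apply: adm.
suff -> : chiF r (inset a b) f = chiF r X f by [].
by elim: r E {adm h hab} => //= r IH E; rewrite E // IH // => i lt; apply: E; apply: ltnW.
Qed.

(** With oracle D the theory and its complement are both enumerable, the complement as the numbers
    that code no sentence together with the sentences refuted under an admissible guess. For each n
    one of the two searches succeeds. *)
Lemma reduces_prov : Treducible (codes (th_set (Utheory q))) D.
Proof.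
have [pU dU] := computable_axioms q; set u := code_prog pU.
pose R r a b n w := admb r a b && step (fact 9 [:: u; chi r a b (cNeg n)]) w.
pose Yes n w := step (fact 10 [:: 0; n]) w && step (fact 9 [:: u; n]) w.
pose No n w := step (fact 11 [:: 0; n]) w ||
  has (fun r => has (fun a => has (fun b => R r a b n w) (iota 0 w.+1)) (iota 0 w.+1)) (iota 0 w.+1).
have stepH r l w : step (fact r l) w -> H r l by move=> h; apply/step_H; exists w.
have YesP n w : Yes n w -> codes (th_set (Utheory q)) n.
  move=> /andP[/stepH/H_sentence[a <- sa] /stepH/(H_prov_iff _ dU) h].
  by exists a.
have NoP n w : No n w -> ~ codes (th_set (Utheory q)) n.
  move=> /orP[/stepH/H_nsentence h [a [E [sa _]]]|]; first by apply: h; exists a.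
  move=> /hasP[r _ /hasP[a _ /hasP[b _ /andP[/admbP adm /stepH h]]]] [f [E [sf pf]]].
  move: h; rewrite -E -[cNeg _]/(code_f (Neg f)) -code_chiF => /(H_prov_iff _ dU) h.
  exact: refute_sound adm h pf.
have mono r l w w' : w <= w' -> step (fact r l) w -> step (fact r l) w' by apply: step_mono.
have P i k : Comp D k (fun xs => nth 0 xs i) by apply: Comp_proj.
have C n k : Comp D k (fun xs => n) by apply: Comp_const.
have cYes k F G : Comp D k F -> Comp D k G -> CompB D k (fun xs => Yes (F xs) (G xs)).
  by move=> hF hG; apply: CompB_and; apply: CompB_step => //; apply: Comp_fact2.
have cNo : CompB D 2 (fun xs => No (nth 0 xs 1) (nth 0 xs 0)).
  apply: CompB_or; first by apply: CompB_step => //; apply: Comp_fact2.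
  apply: (@CompB_has D 2 (fun ys => has (fun a => has (fun b => R (nth 0 ys 0) a b (nth 0 ys 2) (nth 0 ys 1))
    (iota 0 (nth 0 ys 1).+1)) (iota 0 (nth 0 ys 1).+1)) (fun xs => (nth 0 xs 0).+1)); last exact: Comp_S.
  apply: (@CompB_has D 3 (fun ys => has (fun b => R (nth 0 ys 1) (nth 0 ys 0) b (nth 0 ys 3) (nth 0 ys 2))
    (iota 0 (nth 0 ys 2).+1)) (fun xs => (nth 0 xs 1).+1)); last exact: Comp_S.
  apply: (@CompB_has D 4 (fun ys => R (nth 0 ys 2) (nth 0 ys 1) (nth 0 ys 0) (nth 0 ys 4) (nth 0 ys 3))
    (fun xs => (nth 0 xs 2).+1)); last exact: Comp_S.
  apply: CompB_and; first exact: CompB_admb.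
  apply: CompB_step => //; apply: Comp_fact2 => //; apply: Comp_chi => //; exact: Comp_cNeg.
have cW : CompB D 2 (fun xs => Yes (nth 0 xs 1) (nth 0 xs 0) || No (nth 0 xs 1) (nth 0 xs 0)).
  by apply: CompB_or => //; apply: cYes.
have tot n : exists w, Yes n w || No n w.
  have [[f E sf]|/H_nsentence/step_H[w h]] := EM (exists2 a, code_f a = n & sentence LE a); last first.
    by exists w; rewrite /No h orbT.
  subst n; have [pf|npf] := EM (prov (UAx q) f).
    have /H_sentence/step_H[w1 h1] : exists2 a, code_f a = code_f f & sentence LE a by exists f.
    have /step_H[w2 h2] := (H_prov_iff f dU).2 pf.
    by exists (maxn w1 w2); rewrite /Yes (mono _ _ _ _ _ h1) ?leq_maxl // (mono _ _ _ _ _ h2) ?leq_maxr.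
  have [r [a [b [adm h]]]] := refute_coded sf npf.
  have /step_H[w hw] := (H_prov_iff _ dU).2 h.
  (* A single number bounds the stage and the parameters of the guess, because [No] uses one bound
     for all of them. *)
  pose W := maxn w (maxn r (maxn a b)).
  have /andP[w1 /and3P[r1 a1 b1]] : [&& w <= W, r <= W, a <= W & b <= W].
    by rewrite /W !leq_max !leqnn !orbT.
  exists W; apply/orP; right; apply/orP; right.
  apply/hasP; exists r; first by rewrite mem_iota.
  apply/hasP; exists a; first by rewrite mem_iota.
  apply/hasP; exists b; first by rewrite mem_iota.
  apply/andP; split; first exact/admbP.
  by rewrite -[cNeg _]/(code_f (Neg f)) -code_chiF; apply: mono hw.
have [|G cG hG] := @Comp_mu D 1 _ cW.
  by move=> [|n [|? ?]] // _; apply: tot.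
apply/Treducible_Comp.
apply: (@Comp_ext _ _ (fun xs => Yes (nth 0 xs 0) (G xs))); last exact: cYes.
move=> [|n [|? ?]] sz; [discriminate sz | | discriminate sz].
congr nat_of_bool; apply/idP/asboolP => [/YesP //|h].
by have /orP[//|/NoP] := hG [:: n] erefl.
Qed.

End Reduction.

(** * Incompleteness *)

Section Translation.
Variable tau : interp.

Definition trX (b : form) : form := Neg (All (Imp (idom tau) (Neg b))).
Definition trE (i j : nat) : form := tr_form tau (EF i j).
Definition trQ (i j : nat) : form := tr_form tau (QF i j).

Lemma trQE i j : trQ i j = Ex (And (Eq (Var 0) (Var i.+1)) (Eq (Var 0) (Var j.+1))).
Proof. by []. Qed.

Lemma trEE i j : trE i j = Ex (Ex (And
  (And (And (dom_at tau 0) (Eq (Var 0) (Var (i + 2))))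
       (And (And (dom_at tau 1) (Eq (Var 1) (Var (j + 2)))) Tru)) (irel tau 0 2))).
Proof. by []. Qed.

Lemma tr_distinctF i j : tr_form tau (distinctF QF i j) = distinctF trQ i j.
Proof. by elim: j => //= j ->. Qed.

Lemma tr_familyF m k : tr_form tau (familyF EF QF m k) = familyF trE trQ m k.
Proof. by elim: k => //= k ->; rewrite tr_distinctF. Qed.

Lemma tr_geF k v : tr_form tau (geF Ex EF QF k v) = geF trX trE trQ k v.
Proof.
rewrite /geF -tr_familyF; move: (familyF EF QF _ _) => a.
by elim: k => //= l ->.
Qed.

Lemma tr_phi n : tr_form tau (phi n) = existsF trX trE trQ n.
Proof. by rewrite /existsF /sizeF -!tr_geF. Qed.

(** The formulas of the interpretation are fixed, so their codes enter the computation as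
    constants. *)
Lemma Comp_tr_phi O k F : Comp O k F -> Comp O k (fun xs => code_f (tr_form tau (phi (F xs)))).
Proof.
pose cX c := cNeg (cAll (cImp (code_f (idom tau)) (cNeg c))).
pose cE i j := cEx (cEx (cAnd
  (cAnd (cAnd (code_f (dom_at tau 0)) (cEq (cVar 0) (cVar (i + 2))))
        (cAnd (cAnd (code_f (dom_at tau 1)) (cEq (cVar 1) (cVar (j + 2)))) cTru))
  (code_f (irel tau 0 2)))).
pose cQ i j := cEx (cAnd (cEq (cVar 0) (cVar i.+1)) (cEq (cVar 0) (cVar j.+1))).
have P i m : Comp O m (fun xs => nth 0 xs i) by apply: Comp_proj.
have C n m : Comp O m (fun xs => n) by apply: Comp_const.
move=> hF; apply: (@Comp_ext _ _ (fun xs => code_f (existsF trX trE trQ (F xs)))).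
  by move=> xs _; rewrite tr_phi.
apply: (@Comp_existsF O trX trE trQ cX cE cQ) => //.
- by apply/Comp_cNeg/Comp_cAll/Comp_cImp => //; apply: Comp_cNeg.
- apply/Comp_cEx/Comp_cEx/Comp_cAnd => //; apply: Comp_cAnd; apply: Comp_cAnd => //.
    by apply: Comp_cEq => //; apply/Comp_cVar/Comp_add.
  by apply: Comp_cAnd => //; apply: Comp_cEq => //; apply/Comp_cVar/Comp_add.
- by apply/Comp_cEx/Comp_cAnd; apply: Comp_cEq; apply: Comp_cVar => //; apply: Comp_S.
Qed.

End Translation.

Section G1.
Variable q : prog.
Let D (x : nat) : Prop := exists v, eval emptyset q [:: x] v.

Lemma Utheory_rec : rec_axiomatizable (Utheory q).
Proof.
split; last first.
  exists (UAx q); split; first exact: UAx_sentence.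
  by split=> [|a sa]; [exact: computable_axioms | split=> [[]|]].
split; apply/Treducible_Comp.
  apply: (@Comp_ext _ _ (fun _ => 0)); last exact: Comp_const.
  by move=> xs _; case: asboolP => // -[f [k []]].
apply: (@Comp_ext _ _ (fun xs => nat_of_bool (nth 0 xs 0 == cpair 0 2))).
  move=> xs _; congr nat_of_bool; apply/eqP/asboolP => [->|]; first by exists 0, 2.
  by move=> [r [k [/andP[/eqP-> /eqP->]]]].
by apply: CompB_eq; [apply: Comp_proj | apply: Comp_const].
Qed.

Lemma Utheory_G1 : ~ computable D -> G1 (Utheory q).
Proof.
move=> nD; split; first exact: Utheory_rec.
split; first exact: Utheory_consistent.
move=> S thS [_ [T [_ [[p dp] hT]]]] conS [tau [_ [_ [_ [_ [_ hU]]]]]] compS.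
apply: nD; pose C n := th_set S (tr_form tau (phi n)).
have SU a : sentence LE a -> prov (UAx q) a -> th_set S (tr_form tau a).
  by move=> h1 h2; apply: hU.
have sphi n : sentence LE (phi n) by apply/LEformP/LE_phi.
have strphi n : sentence (th_lang S) (tr_form tau (phi n)).
  (* A theory contains sentences only, so translating the tautology [Imp (phi n) (phi n)] shows that
     the translation of [phi n] is a sentence of S. *)
  have /thS[[/andP[h1 _] /andP[h2 _]] _] : th_set S (tr_form tau (Imp (phi n) (phi n))).
    apply: SU; last exact: prov_id.
    by apply/LEformP; apply: LE_Imp; apply: LE_phi.
  by split.
have sneg n : sentence (th_lang S) (Neg (tr_form tau (phi n))).
  by have [h1 h2] := strphi n; split; apply/andP; split.
have contra n : C n -> ~ th_set S (Neg (tr_form tau (phi n))).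
  move=> h1 h2; apply: conS; apply/thS; split; first by split.
  exact: pr_mp (pr_ax h2) (pr_ax h1).
apply: (@inseparable q C).
- by move=> n /prov_phi; apply: SU.
- move=> n Bn Cn; apply: (contra n Cn).
  apply: (SU (Neg (phi n))); last exact: prov_Neg_phi.
  by apply/LEformP/LE_Neg/LE_phi.
pose c := code_prog p.
pose tp n := code_f (tr_form tau (phi n)).
have ctp k F : Comp emptyset k F -> Comp emptyset k (fun xs => tp (F xs)) by apply: Comp_tr_phi.
pose Pos n w := step (fact 9 [:: c; tp n]) w.
pose Ng n w := step (fact 9 [:: c; cNeg (tp n)]) w.
have PosP n : (exists w, Pos n w) <-> C n.
  apply: iff_trans (iff_sym (step_H _ _)) _.
  exact: iff_trans (H_prov_iff _ dp) (iff_sym (hT _ (strphi n))).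
have NgP n : (exists w, Ng n w) <-> th_set S (Neg (tr_form tau (phi n))).
  apply: iff_trans (iff_sym (step_H _ _)) _.
  exact: iff_trans (H_prov_iff (Neg _) dp) (iff_sym (hT _ (sneg n))).
have cPos k F G : Comp emptyset k F -> Comp emptyset k G -> CompB emptyset k (fun xs => Pos (F xs) (G xs)).
  by move=> hF hG; apply: CompB_step => //; apply: Comp_fact2; [apply: Comp_const | apply: ctp].
have cNg k F G : Comp emptyset k F -> Comp emptyset k G -> CompB emptyset k (fun xs => Ng (F xs) (G xs)).
  move=> hF hG; apply: CompB_step => //; apply: Comp_fact2; first exact: Comp_const.
  exact/Comp_cNeg/ctp.
(* As S is complete, the search for a proof of the translation or of its negation always ends. *)
have [||G cG hG] := @Comp_mu emptyset 1 (fun xs => Pos (nth 0 xs 1) (nth 0 xs 0) || Ng (nth 0 xs 1) (nth 0 xs 0)).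
- by apply: CompB_or; [apply: cPos | apply: cNg]; apply: Comp_proj.
- move=> [|n [|? ?]] // _; have [/PosP[w h]|/NgP[w h]] := compS _ (strphi n).
    by exists w; apply/orP; left.
  by exists w; apply/orP; right.
apply/Treducible_Comp.
apply: (@Comp_ext _ _ (fun xs => Pos (nth 0 xs 0) (G xs))); last first.
  by apply: cPos => //; apply: Comp_proj.
move=> [|n [|? ?]] sz; [discriminate sz | | discriminate sz].
congr nat_of_bool; apply/idP/asboolP => [h|Cn]; first by apply/PosP; exists (G [:: n]).
have /orP[//|h] := hG [:: n] erefl.
by case: (contra n Cn); apply/NgP; exists (G [:: n]).
Qed.

End G1.

(** * Bounded formulas in models of R *)

Fixpoint bt2t (t : bterm) : term :=
  match t with
  | BV i => Var i
  | BC n => num n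
  | BAdd t u => plus (bt2t t) (bt2t u)
  | BMul t u => times (bt2t t) (bt2t u)
  end.

Fixpoint bf2f (a : bform) : form :=
  match a with
  | BFal => Fal
  | BEq t u => Eq (bt2t t) (bt2t u)
  | BLe t u => le (bt2t t) (bt2t u)
  | BImp a b => Imp (bf2f a) (bf2f b)
  | BAll t a => All (Imp (le (Var 0) (subst_t (fun k => Var k.+1) (bt2t t))) (bf2f a))
  end.

Fixpoint btbound (d : nat) (t : bterm) : bool :=
  match t with
  | BV i => i < d
  | BC _ => true
  | BAdd t u | BMul t u => btbound d t && btbound d u
  end.

Fixpoint bbound (d : nat) (a : bform) : bool :=
  match a with
  | BFal => true
  | BEq t u | BLe t u => btbound d t && btbound d u
  | BImp a b => bbound d a && bbound d b
  | BAll t a => btbound d t && bbound d.+1 a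
  end.

(** [P] marks the variables with standard values. A mere bound on the variables is too coarse: in
    Rosser's formula the B part stands below a quantifier whose variable may be nonstandard. *)
Fixpoint btvars (P : nat -> bool) (t : bterm) : bool :=
  match t with
  | BV i => P i
  | BC _ => true
  | BAdd t u | BMul t u => btvars P t && btvars P u
  end.

Fixpoint bvars (P : nat -> bool) (a : bform) : bool :=
  match a with
  | BFal => true
  | BEq t u | BLe t u => btvars P t && btvars P u
  | BImp a b => bvars P a && bvars P b
  | BAll t a => btvars P t && bvars (true .: P) a
  end.

Lemma btev_bound d t xs ys : (forall i, i < d -> nth 0 xs i = nth 0 ys i) ->
  btbound d t -> btev xs t = btev ys t.
Proof.
by move=> E; elim: t => //= t IHt u IHu /andP[/IHt-> /IHu->].
Qed.

Lemma bev_bound d a xs ys : (forall i, i < d -> nth 0 xs i = nth 0 ys i) ->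
  bbound d a -> bev xs a = bev ys a.
Proof.
elim: a d xs ys => [|t u|t u|a IHa b IHb|t a IH] d xs ys E //= /andP[h1 h2].
- by rewrite !bev_Eq !(btev_bound E).
- by rewrite !bev_Le !(btev_bound E).
- by rewrite !bev_Imp (IHa d xs ys) // (IHb d xs ys).
- have E' i n : n < d.+1 -> nth 0 (i :: xs) n = nth 0 (i :: ys) n by case: n => //= n /E.
  apply/bev_AllP/bev_AllP => h i hi.
    by rewrite -(IH _ _ _ (E' i) h2); apply: h; rewrite (btev_bound E).
  by rewrite (IH _ _ _ (E' i) h2); apply: h; rewrite -(btev_bound E).
Qed.

(* [a] read in the environment consisting of variables i and j. *)
Definition rearr (i j : nat) (a : bform) : bform :=
  BEx (BV j) (BAnd (BEq (BV 0) (BV j.+1)) (BEx (BV i.+1) (BAnd (BEq (BV 0) (BV i.+2)) a))).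

Lemma bev_rearr i j a xs : bbound 2 a ->
  bev xs (rearr i j a) = bev [:: nth 0 xs i; nth 0 xs j] a.
Proof.
move=> ha; have E : bev [:: nth 0 xs i, nth 0 xs j & xs] a = bev [:: nth 0 xs i; nth 0 xs j] a.
  by apply: bev_bound ha => -[|[|n]].
rewrite -E; apply/bev_ExP/idP => [[y _]|h].
  rewrite bev_And bev_Eq /= => /andP[/eqP-> /bev_ExP[z _]].
  by rewrite bev_And bev_Eq /= => /andP[/eqP->].
exists (nth 0 xs j) => //; rewrite bev_And bev_Eq /= eqxx /=.
by apply/bev_ExP; exists (nth 0 xs i) => //; rewrite bev_And bev_Eq /= eqxx.
Qed.

Lemma tbound_num d n : tbound d (num n).
Proof. by elim: n => //= n ->. Qed.

Lemma term_in_num n : term_in LA (num n).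
Proof. by elim: n => //= n ->. Qed.

Lemma tbound_subst k m s t : (forall n, n < k -> tbound m (s n)) ->
  tbound k t -> tbound m (subst_t s t).
Proof.
move=> E; elim/term_nested_ind: t => [n /E //|f ts H /=].
by elim: ts H => //= t ts IH [h1 h2] /andP[/h1-> /(IH h2)].
Qed.

Lemma fbound_subst k m s a : (forall n, n < k -> tbound m (s n)) ->
  fbound k a -> fbound m (subst_f s a).
Proof.
elim: a k m s => //=.
- by move=> t u k m s E /andP[h1 h2]; rewrite !(tbound_subst E).
- move=> r ts k m s E; elim: ts => //= t ts IH /andP[h1 /IH->].
  by rewrite (tbound_subst E).
- by move=> a IHa b IHb k m s E /andP[h1 h2]; rewrite (IHa k) // (IHb k).
- move=> a IH k m s E; apply: IH => -[|n] //= /E.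
  exact: tbound_subst.
Qed.

Lemma term_in_subst L s t : (forall n, term_in L (s n)) -> term_in L t -> term_in L (subst_t s t).
Proof.
move=> E; elim/term_nested_ind: t => [n _|f ts H /= /andP[h1 h2]]; first exact: E.
rewrite size_map h1 /=; by elim: ts H h2 {h1} => //= t ts IH [h1 h2] /andP[/h1-> /(IH h2)].
Qed.

Lemma form_in_subst L s a : (forall n, term_in L (s n)) -> form_in L a -> form_in L (subst_f s a).
Proof.
elim: a s => //=.
- by move=> t u s E /andP[h1 h2]; rewrite !term_in_subst.
- move=> r ts s E /andP[h1 h2]; rewrite size_map h1 /=.
  by elim: ts h2 {h1} => //= t ts IH /andP[h1 /IH->]; rewrite term_in_subst.
- by move=> a IHa b IHb s E /andP[h1 h2]; rewrite IHa // IHb.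
- by move=> a IH s E; apply: IH => -[|n] //=; apply: term_in_subst.
Qed.

Lemma btbound_term d t : btbound d t -> tbound d (bt2t t).
Proof.
by elim: t => //= [n _|t IHt u IHu /andP[/IHt-> /IHu->]|t IHt u IHu /andP[/IHt-> /IHu->]] //;
  apply: tbound_num.
Qed.

Lemma bbound_form d a : bbound d a -> fbound d (bf2f a).
Proof.
elim: a d => [|t u|t u|a IHa b IHb|t a IH] d //= /andP[h1 h2].
- by rewrite !btbound_term.
- by rewrite !btbound_term.
- by rewrite IHa // IHb.
- rewrite IH // !andbT; apply: (@tbound_subst d) => //.
  exact: btbound_term.
Qed.

Lemma bt2t_in t : term_in LA (bt2t t).
Proof. by elim: t => //= [n|t -> u ->|t -> u ->] //; apply: term_in_num. Qed.

Lemma bf2f_in a : form_in LA (bf2f a).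
Proof.
elim: a => [|t u|t u|a IHa b IHb|t a IH] //=; rewrite ?bt2t_in ?IHa ?IHb //.
by rewrite IH !andbT; apply: term_in_subst => //; apply: bt2t_in.
Qed.

Lemma fbound_bigOr d l : all (fbound d) l -> fbound d (bigOr l).
Proof. by elim: l => //= a l IH /andP[-> /IH->]. Qed.

Lemma R_ax_closed a : R_ax a -> fbound 0 a.
Proof.
have H l : all (fbound 1) (map (fun i => Eq (Var 0) (num i)) l).
  by elim: l => //= i l ->; rewrite tbound_num.
case=> {a} [m n|m n|m n _|n|n]; try by rewrite /= !tbound_num.
rewrite -[fbound 0 _]/(fbound 1 (le (Var 0) (num n)) && fbound 1 (bigOr _)).
by apply/andP; split; [rewrite /= tbound_num | apply/fbound_bigOr/H].
Qed.

Section StandardPart.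
Variable M : structure.
Hypothesis MR : models M R_ax.

Definition N (n : nat) : dom M := iter n (fun x => fI 1 [:: x]) (fI 0 [::]).
Definition leM (x y : dom M) : Prop := rI 0 [:: x; y].
Definition addM (x y : dom M) : dom M := fI 2 [:: x; y].
Definition mulM (x y : dom M) : dom M := fI 3 [:: x; y].
Let e0 : nat -> dom M := fun=> N 0.

Lemma teval_num (e : nat -> dom M) n : teval e (num n) = N n.
Proof. by elim: n => //= n ->. Qed.

Lemma addM_N m n : addM (N m) (N n) = N (m + n).
Proof. by have := MR (Rax_plus m n) e0; rewrite /= !teval_num. Qed.

Lemma mulM_N m n : mulM (N m) (N n) = N (m * n).
Proof. by have := MR (Rax_times m n) e0; rewrite /= !teval_num. Qed.

Lemma N_inj : injective N.
Proof.
move=> m n E; apply/eqP; apply: contraT => /eqP ne.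
by have := MR (Rax_neq ne) e0; rewrite /= !teval_num.
Qed.

Lemma leM_N x n : leM x (N n) -> exists2 i, i <= n & x = N i.
Proof.
move=> h; have := MR (Rax_le n) e0 x => H.
have : sat (x .: e0) (bigOr (map (fun i => Eq (Var 0) (num i)) (iota 0 n.+1))).
  by apply: H; rewrite /= teval_num.
have -> : (exists2 i, i <= n & x = N i) = exists2 i, i \in iota 0 n.+1 & x = N i.
  by apply: propext; split=> -[i h1 h2]; exists i => //; move: h1; rewrite mem_iota.
elim: (iota 0 n.+1) => // i l IH; rewrite [bigOr _]/= sat_Or => -[|/IH[j hj ->]].
  by rewrite /= teval_num => ->; exists i; rewrite ?inE ?eqxx.
by exists j; rewrite // inE hj orbT.
Qed.

Lemma leM_total x n : leM x (N n) \/ leM (N n) x.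
Proof.
have : sat (x .: e0) (Or (le (Var 0) (num n)) (le (num n) (Var 0))) := MR (Rax_tot n) e0 x.
by rewrite sat_Or /= teval_num.
Qed.

Lemma leM_NN m n : leM (N m) (N n) <-> m <= n.
Proof.
split=> [/leM_N[i le /N_inj->] //|le].
case: (leM_total (N m) n) => // h; have [i hi /N_inj E] := leM_N h.
by move: h; have -> : m = n by lia.
Qed.

Lemma teval_bt2t e xs (P : nat -> bool) t : (forall i, P i -> e i = N (nth 0 xs i)) ->
  btvars P t -> teval e (bt2t t) = N (btev xs t).
Proof.
move=> E; elim: t => //= [n _|t IHt u IHu|t IHt u IHu]; first exact: teval_num.
  by move=> /andP[/IHt-> /IHu->]; apply: addM_N.
by move=> /andP[/IHt-> /IHu->]; apply: mulM_N.
Qed.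

(** Below a standard bound a model of R has standard elements only, so bounded formulas with
    standard arguments are absolute. *)
Lemma sat_bf2f a (P : nat -> bool) (e : nat -> dom M) xs :
  (forall i, P i -> e i = N (nth 0 xs i)) -> bvars P a -> sat e (bf2f a) <-> bev xs a.
Proof.
elim: a P e xs => [|t u|t u|a IHa b IHb|t a IH] P e xs E //= /andP[h1 h2].
- by rewrite bev_Eq !(teval_bt2t E) //; split=> [/N_inj->|/eqP->].
- by rewrite bev_Le !(teval_bt2t E) //; apply: leM_NN.
- by rewrite bev_Imp (IHa P e xs) // (IHb P e xs) //; split=> /implyP.
have E' i n : (true .: P) n -> (N i .: e) n = N (nth 0 (i :: xs) n).
  by case: n => [//|n]; apply: E.
split=> [h|/bev_AllP h x].
  apply/bev_AllP => i hi; rewrite -(IH _ _ _ (E' i) h2); apply: h.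
  by rewrite teval_subst /= (teval_bt2t E) //; apply/leM_NN.
rewrite teval_subst /= (teval_bt2t E) // => /leM_N[i hi ->].
by rewrite (IH _ _ _ (E' i) h2); apply: h.
Qed.

End StandardPart.

(** * Interpretation in R *)

(* Block n consists of the numbers (n + i)^2 + i with i <= n. *)
Definition elt (t u : term) : term := plus (times (plus t u) (plus t u)) u.

Definition preblockF (n x : nat) : form :=
  And (le (Var n) (Var x))
      (Ex (And (le (Var 0) (Var n.+1)) (Eq (Var x.+1) (elt (Var n.+1) (Var 0))))).

(* Elements lying in two blocks are discarded, so that nonstandard blocks are disjoint too. *)
Definition blockF (n x : nat) : form :=
  And (preblockF n x) (All (Imp (preblockF 0 x.+1) (Eq (Var 0) (Var n.+1)))).

(* Good nonstandard blocks are infinite: i |-> (n + i)^2 + i is injective on the standard i. *)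
Definition goodF (n : nat) : form :=
  And (All (Imp (le (Var 0) (Var n.+1))
         (All (Imp (Eq (Var 0) (elt (Var n.+2) (Var 1))) (blockF n.+2 0)))))
      (All (All (Imp (le (Var 1) (Var n.+2)) (Imp (le (Var 0) (Var n.+2))
         (Imp (Eq (elt (Var n.+2) (Var 1)) (elt (Var n.+2) (Var 0))) (Eq (Var 1) (Var 0))))))).

Lemma form_in_And L a b : form_in L (And a b) = form_in L a && form_in L b.
Proof. by rewrite /= !andbT. Qed.

Lemma form_in_Ex L a : form_in L (Ex a) = form_in L a.
Proof. by rewrite /= !andbT. Qed.

Lemma fbound_And d a b : fbound d (And a b) = fbound d a && fbound d b.
Proof. by rewrite /= !andbT. Qed.

Lemma fbound_Ex d a : fbound d (Ex a) = fbound d.+1 a.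
Proof. by rewrite /= !andbT. Qed.

Section Blocks.
Variable M : structure.
Hypothesis MR : models M R_ax.
Let N := N M.

Definition eltM (n i : dom M) : dom M := addM (mulM (addM n i) (addM n i)) i.
Definition preblock (n x : dom M) : Prop := leM n x /\ exists i, leM i n /\ x = eltM n i.
Definition block (n x : dom M) : Prop := preblock n x /\ forall m, preblock m x -> m = n.
Definition good (n : dom M) : Prop :=
  (forall i, leM i n -> block n (eltM n i)) /\
  forall i j, leM i n -> leM j n -> eltM n i = eltM n j -> i = j.

Lemma sat_preblockF (e : nat -> dom M) n x : sat e (preblockF n x) <-> preblock (e n) (e x).
Proof.
rewrite sat_And sat_Ex; split=> -[h1 [i]].
  by rewrite sat_And => h2; split=> //; exists i.
by move=> h2; split=> //; exists i; rewrite sat_And.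
Qed.

Lemma sat_blockF (e : nat -> dom M) n x : sat e (blockF n x) <-> block (e n) (e x).
Proof.
rewrite sat_And sat_preblockF; split=> -[h1 h2]; split=> // m.
  by move=> hm; apply: (h2 m); apply/(sat_preblockF (m .: e) 0 x.+1).
by move=> /(sat_preblockF (m .: e) 0 x.+1); apply: h2.
Qed.

Lemma sat_goodF (e : nat -> dom M) n : sat e (goodF n) <-> good (e n).
Proof.
rewrite sat_And; split=> -[h1 h2]; split.
- move=> i hi; apply/(sat_blockF (eltM (e n) i .: (i .: e)) n.+2 0).
  exact: (h1 i hi (eltM (e n) i)).
- by move=> i j; apply: (h2 i j).
- move=> i hi x hx; apply/(sat_blockF (x .: (i .: e)) n.+2 0).
  by move: hx => /= ->; apply: h1.
- by move=> i j; apply: (h2 i j).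
Qed.

Lemma eltM_N n i : eltM (N n) (N i) = N ((n + i) * (n + i) + i).
Proof. by rewrite /eltM !addM_N // mulM_N // addM_N. Qed.

Lemma elt_inj n i m j : i <= n -> j <= m ->
  (n + i) * (n + i) + i = (m + j) * (m + j) + j -> n = m /\ i = j.
Proof.
move=> hi hj E; have E' : n + i = m + j by nia.
by nia.
Qed.

(** The conjunct [leM n x] of [preblock] is decisive: any m whose block contains a standard element
    lies below this element, hence is standard, and [elt_inj] applies. *)
Lemma good_N n : good (N n).
Proof.
split=> [i /(leM_N MR)[i' hi ->]|i j /(leM_N MR)[i' hi ->] /(leM_N MR)[j' hj ->]]; last first.
  by rewrite !eltM_N => /(N_inj MR)/(elt_inj hi hj)[_ ->].
rewrite eltM_N; split.
  split; first by apply/(leM_NN MR); nia.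
  by exists (N i'); rewrite eltM_N; split=> //; apply/(leM_NN MR).
move=> m [/(leM_N MR)[m' hm ->] [j [/(leM_N MR)[j' hj ->]]]].
by rewrite eltM_N => /(N_inj MR)/(elt_inj hi hj)[-> _].
Qed.

Lemma block_N n x : block (N n) x -> exists2 i, i <= n & x = eltM (N n) (N i).
Proof. by move=> [[_ [i [/(leM_N MR)[i' hi ->] ->]]] _]; exists i'. Qed.

Lemma block_uniq n m x : block n x -> block m x -> m = n.
Proof. by move=> [_ h] [h' _]; apply: h. Qed.

End Blocks.

Section Interpretation.
Variable rho : form.
Hypothesis rho_in : form_in LA rho.
Hypothesis rho_bound : fbound 1 rho.

Definition domF : form := Ex (And (And (goodF 0) rho) (blockF 0 1)).
Definition relF : form := Ex (And (And (goodF 0) rho) (And (blockF 0 1) (blockF 0 2))).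
Definition tau : interp := Interp domF (fun _ _ => Fal) (fun _ _ => relF).

Lemma domF_in : form_in LA domF.
Proof. by rewrite /= rho_in. Qed.

Lemma relF_in : form_in LA relF.
Proof. by rewrite /= rho_in. Qed.

Lemma domF_bound : fbound 1 domF.
Proof. by rewrite /= (fbound_mono _ rho_bound). Qed.

Lemma relF_bound : fbound 2 relF.
Proof. by rewrite /= (fbound_mono _ rho_bound). Qed.

Lemma tr_in_bound d a : LEform d a -> form_in LA (tr_form tau a) /\ fbound d (tr_form tau a).
Proof.
have dI i : form_in LA (dom_at tau i).
  by apply: form_in_subst domF_in => -[|n].
have dB i d' : i < d' -> fbound d' (dom_at tau i).
  by move=> lt; apply: fbound_subst domF_bound => -[|n].
elim=> {d a}.
- by [].
- by move=> d i j hi hj; split=> //=; rewrite !ltnS hi hj.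
- move=> d i j hi hj; rewrite -[tr_form _ _]/(trE tau i j) trEE.
  rewrite !form_in_Ex !form_in_And !fbound_Ex !fbound_And !dI !dB //.
  rewrite relF_in (fbound_mono _ relF_bound) //=.
  by rewrite !addn2 !ltnS hi hj.
- by move=> d a b _ [h1 h2] _ [h3 h4]; split=> /=; rewrite ?h1 ?h2 ?h3 ?h4.
- move=> d a _ [h1 h2]; split.
    by apply/andP; split; [apply: domF_in | apply: h1].
  by apply/andP; split; [apply: fbound_mono domF_bound | apply: h2].
Qed.

Section Model.
Variable M : structure.
Hypothesis MR : models M R_ax.
Let N := N M.

Definition rhoM (n : dom M) : Prop := sat (n .: fun=> N 0) rho.

Lemma sat_rho (e : nat -> dom M) n : sat (n .: e) rho <-> rhoM n.
Proof. by apply: sat_bound rho_bound => -[|]. Qed.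

Definition inDom (x : dom M) : Prop := exists n, [/\ good n, rhoM n & block n x].

Lemma sat_domF (e : nat -> dom M) x : sat (x .: e) domF <-> inDom x.
Proof.
rewrite sat_Ex; split=> -[n].
  by rewrite 2!sat_And sat_goodF sat_rho sat_blockF => -[[h1 h2] h3]; exists n.
by move=> [h1 h2 h3]; exists n; rewrite 2!sat_And sat_goodF sat_rho sat_blockF.
Qed.

Lemma sat_relF (e : nat -> dom M) :
  sat e relF <-> exists n, [/\ good n, rhoM n, block n (e 0) & block n (e 1)].
Proof.
rewrite sat_Ex; split=> -[n].
  by rewrite 2!sat_And sat_goodF sat_rho sat_And !sat_blockF => -[[h1 h2] [h3 h4]]; exists n.
by move=> [h1 h2 h3 h4]; exists n; rewrite 2!sat_And sat_goodF sat_rho sat_And !sat_blockF.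
Qed.

Variable x0 : {x : dom M | inDom x}.

Definition sub_model : structure :=
  @Structure {x : dom M | inDom x} (fun _ _ => x0)
    (fun _ l => if l is [:: x; y]
      then exists n, [/\ good n, rhoM n, block n (sval x) & block n (sval y)] else False).

Lemma sub_equivalence : equivalence sub_model.
Proof.
split=> [x|x y [n [h1 h2 h3 h4]]|x y z [n [h1 h2 h3 h4]] [m [_ _ h5 h6]]].
- by have [n [h1 h2 h3]] := svalP x; exists n.
- by exists n.
- by exists n; split=> //; rewrite -(block_uniq h4 h5).
Qed.

Section ClassSize.
Variables (x : dom sub_model) (n : dom M).
Hypotheses (gn : good n) (rn : rhoM n) (bn : block n (sval x)).

Lemma class_lower k : (forall i, i < k -> leM (N i) n) -> Ge k x.
Proof.
move=> hk; have inD i : leM (N i) n -> inDom (eltM n (N i)).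
  by move=> h; exists n; split=> //; apply: gn.1.
pose g i : dom sub_model :=
  if pselect (leM (N i) n) is left h then exist _ (eltM n (N i)) (inD i h) else x.
have gE i : i < k -> sval (g i) = eltM n (N i).
  by move=> /hk h; rewrite /g; case: pselect.
exists g; split=> [i hi|i j lt hi E].
  by exists n; split=> //; rewrite gE //; apply: gn.1; apply: hk.
have hj := ltn_trans lt hi.
have : eltM n (N i) = eltM n (N j) by rewrite -!gE // E.
move=> /(gn.2 _ _ (hk _ hi) (hk _ hj))/(N_inj MR) E'.
by rewrite E' ltnn in lt.
Qed.

Lemma class_upper n0 k : n = N n0 -> Ge k x -> k <= n0.+1.
Proof.
move=> En [g [g1 g2]].
have [f hf] : exists f : nat -> nat, forall i, i < k ->
    f i <= n0 /\ sval (g i) = eltM (N n0) (N (f i)).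
  have : forall i, exists j, i < k -> j <= n0 /\ sval (g i) = eltM (N n0) (N j).
    move=> i; have [lt|le] := ltnP i k; last by exists 0.
    have [m [_ _ h1 h2]] := g1 i lt; move: h1; rewrite (block_uniq bn h2) En.
    by move=> /(block_N MR)[j hj E]; exists j.
  by move=> /choice.
have : size (map f (iota 0 k)) <= size (iota 0 n0.+1).
  apply: uniq_leq_size.
    rewrite map_inj_in_uniq ?iota_uniq // => i j; rewrite !mem_iota /= => hi hj E.
    have Eg : g i = g j by apply: sval_inj; rewrite (hf i hi).2 (hf j hj).2 E.
    by have [lt|lt|//] := ltngtP i j; [case: (g2 j i lt hj) | case: (g2 i j lt hi)].
  by move=> j /mapP[i]; rewrite !mem_iota /= => hi ->; rewrite add0n ltnS (hf i hi).1.
by rewrite size_map !size_iota.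
Qed.

Lemma class_standard n0 : n = N n0 -> Sz n0.+1 x.
Proof.
move=> En; split; last by move=> /(class_upper En); rewrite ltnn.
by apply: class_lower => i; rewrite ltnS En => le; apply/(leM_NN MR).
Qed.

(** By [leM_total] and [leM_N] a nonstandard label lies above all standard numbers, so [class_lower]
    makes its class infinite; a finite size forces a standard label. *)
Lemma class_size k : Sz k.+1 x -> n = N k.
Proof.
move=> sz; have [[n0 E]|nst] := EM (exists n0, n = N n0).
  by rewrite E; have [->] := Sz_uniq (class_standard E) sz.
case: sz.2; apply: class_lower => i _; case: (leM_total MR n i) => // /(leM_N MR)[j _ E].
by case: nst; exists j.
Qed.

End ClassSize.

Lemma sub_uniq n (x y : dom sub_model) : Sz n.+1 x -> Sz n.+1 y -> ER x y.
Proof.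
have [m [h1 h2 h3]] := svalP x; have [m' [h4 h5 h6]] := svalP y.
move=> /(class_size h1 h2 h3) E /(class_size h4 h5 h6) E'; subst m m'.
by exists (N n).
Qed.

Lemma sub_exists n : (exists x : dom sub_model, Sz n.+1 x) <-> rhoM (N n).
Proof.
split=> [[x]|rn].
  by have [m [h1 h2 h3]] := svalP x => /(class_size h1 h2 h3) <-.
have gn := good_N MR n; have bn := gn.1 _ ((leM_NN MR 0 n).2 (leq0n n)).
have inD : inDom (eltM (N n) (N 0)) by exists (N n).
exists (exist _ _ inD); exact: (class_standard (n := N n)).
Qed.

(** [sub_model] is the structure that the interpretation defines inside M: relativized quantifiers
    range over its domain, and equality is not reinterpreted. *)
Lemma sat_tr d a : LEform d a -> forall e : nat -> dom sub_model,
  sat (fun n => sval (e n)) (tr_form tau a) <-> sat e a.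
Proof.
elim=> {d a}.
- by [].
- move=> d i j _ _ e; rewrite -[tr_form _ _]/(trQ tau i j) trQE sat_Ex.
  split=> [[x]|E]; first by rewrite sat_And => -[/= -> E]; apply: sval_inj.
  by exists (sval (e i)); rewrite sat_And; split=> //=; congr sval.
- move=> d i j _ _ e; rewrite -[tr_form _ _]/(trE tau i j) trEE.
  have dS (e' : nat -> dom M) k : sat e' (dom_at tau k) <-> inDom (e' k).
    rewrite /dom_at sat_subst -(sat_domF (fun n => e' n.+1)).
    by apply: sat_bound domF_bound => -[|].
  rewrite sat_Ex; split=> [[x]|].
    rewrite sat_Ex => -[y]; rewrite sat_And sat_relF => -[h [n [h1 h2 h3 h4]]].
    move: h; rewrite !sat_And => -[[_ E1] [[_ E2] _]].
    exists n; move: E1 E2 h3 h4; rewrite /= !addn2 /= => -> ->; split=> //.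
  move=> [n [h1 h2 h3 h4]]; exists (sval (e j)); rewrite sat_Ex; exists (sval (e i)).
  rewrite sat_And sat_relF; split; last by exists n.
  rewrite !sat_And !dS /= !addn2 /=; do !split => //; exact: svalP.
- by move=> d a b _ IHa _ IHb e; split=> /= h /IHa/h/IHb.
- move=> d a _ IH e.
  have E x : (fun n => sval ((x .: e) n)) = sval x .: (fun n => sval (e n)).
    by apply: funext => -[|].
  split=> h x.
    by apply/IH; rewrite E; apply: h; apply/sat_domF; apply: svalP.
  move=> /sat_domF hx; have := h (exist _ x hx) => /IH.
  by rewrite E.
Qed.

End Model.
End Interpretation.

(* Rosser: a witness for A with no smaller witness for B.  R compares every element with every
   standard one, so a standard witness on either side settles the question. *)
Definition rosserF (q : prog) : form :=
  Ex (And (bf2f (rearr 1 0 (alphaF q)))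
          (All (Imp (le (Var 0) (Var 1)) (Neg (bf2f (rearr 2 0 (betaF q))))))).

Section Rosser.
Variable q : prog.

Lemma rosserF_in : form_in LA (rosserF q).
Proof.
rewrite form_in_Ex form_in_And bf2f_in.
have h := bf2f_in (rearr 2 0 (betaF q)).
by rewrite -[form_in _ (All _)]/(true && (form_in LA (bf2f (rearr 2 0 (betaF q))) && true)) h.
Qed.

Lemma rosserF_bound : fbound 1 (rosserF q).
Proof.
rewrite fbound_Ex fbound_And bbound_form //.
have h : fbound 3 (bf2f (rearr 2 0 (betaF q))) by apply: bbound_form.
by rewrite -[fbound _ (All _)]/(true && (fbound 3 (bf2f (rearr 2 0 (betaF q))) && true)) h.
Qed.

Variable M : structure.
Hypothesis MR : models M R_ax.

Lemma sat_alpha n s (e : nat -> dom M) :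
  sat (N M s .: (N M n .: e)) (bf2f (rearr 1 0 (alphaF q))) <-> bev [:: n; s] (alphaF q).
Proof.
rewrite (@sat_bf2f M MR _ (fun i => i < 2) _ [:: s; n]) ?bev_rearr //.
by move=> [|[|i]].
Qed.

Lemma sat_beta n t s (e : nat -> dom M) :
  sat (N M t .: (s .: (N M n .: e))) (bf2f (rearr 2 0 (betaF q))) <-> bev [:: n; t] (betaF q).
Proof.
rewrite (@sat_bf2f M MR _ (fun i => (i == 0) || (i == 2)) _ [:: t; 0; n]) ?bev_rearr //.
by move=> [|[|[|i]]].
Qed.

Lemma rosser_pos n : inA q n -> rhoM (rosserF q) (N M n).
Proof.
move=> [s hs]; rewrite /rhoM sat_Ex; exists (N M s); rewrite sat_And sat_alpha; split=> //.
move=> t /(leM_N MR)[t' _ E] h; have {E} E : t = N M t' := E; subst t.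
by move: h => /(sat_beta n t' (N M s) _).1; apply/negP/(alpha_beta _ hs).
Qed.

Lemma rosser_neg n : inB q n -> ~ rhoM (rosserF q) (N M n).
Proof.
move=> [t ht]; rewrite /rhoM sat_Ex => -[s]; rewrite sat_And => -[hs hb].
case: (leM_total MR s t) => [/(leM_N MR)[s' _ E]|h].
  move: hs; rewrite E sat_alpha => hs.
  by have := alpha_beta t hs; rewrite ht.
by apply: (hb (N M t) h); apply/sat_beta.
Qed.

End Rosser.

Lemma LE_interprets q : interprets (Utheory q) R_theory.
Proof.
set rho := rosserF q; have hin := rosserF_in q; have hb := rosserF_bound q.
exists (tau rho); split; first by split; [exact: domF_in hin | exact: domF_bound hb].
split; first by [].
split; first by move=> r k /andP[_ /eqP->]; split; [exact: relF_in hin | exact: relF_bound hb].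
(* The domain is never empty: [cpair 1 0] lies in row 1, hence in A, and its standard block is
   always in use. *)
have inD M (MR : models M R_ax) : exists x : dom M, inDom rho x.
  have gn := good_N MR (cpair 1 0).
  have bn := gn.1 _ ((leM_NN MR 0 (cpair 1 0)).2 (leq0n _)).
  exists (eltM (N M (cpair 1 0)) (N M 0)); exists (N M (cpair 1 0)); split=> //.
  exact/(rosser_pos MR)/inA_row1.
split.
  split; first by rewrite /sentence form_in_Ex fbound_Ex; split; [exact: domF_in hin | exact: domF_bound hb].
  apply: (completeness R_ax_closed) => M MR e; rewrite sat_Ex.
  by have [x hx] := inD M MR; exists x; apply/(sat_domF hb).
split; first by [].
move=> a [/LEformP sa pa]; have [i1 i2] := tr_in_bound hin hb sa.
split; first by split.
apply: (completeness R_ax_closed) => M MR e; have [x hx] := inD M MR.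
pose x0 : {x : dom M | inDom rho x} := exist _ x hx.
(* The translation is closed, so it may be evaluated at an assignment with values in the domain of
   the interpretation, as [sat_tr] requires. *)
rewrite (@sat_closed M _ (fun n => x) _ i2).
apply/(sat_tr hb sa (fun=> x0)); apply: soundness pa _.
apply/UmodelP; first exact: inhabits x0.
split.
- exact: sub_equivalence.
- exact: (sub_uniq MR).
- by move=> n /(rosser_pos MR); apply: (sub_exists MR x0 n).2.
- by move=> n /(rosser_neg MR) h /(sub_exists MR x0 n).
Qed.

Theorem mainTheorem10 (D : nat -> Prop) :
  ce D ->
  ~ computable D ->
  Treducible D K ->
  ~ Treducible K D ->
  exists U : theory,
    is_theory U /\ G1 U /\ interprets U R_theory /\ Tequiv (codes (th_set U)) D.
Proof.
move=> [q hq] nD _ _.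
have E : D = fun x => exists v, eval emptyset q [:: x] v by apply: funext => x; apply: propext.
subst D; exists (Utheory q); split; first exact: is_theory_axioms.
split; first exact: Utheory_G1 nD.
split; first exact: LE_interprets.
by split; [exact: reduces_prov | exact: prov_reduces].
Qed.
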